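(* Let $n\ge0$. Up to isomorphism, the modules $P_a\{i\}$, for $a\in\bigsqcup_{k=0}^nB^{n-k,k}$ and $i\in\mathbb Z$, are the only indecomposable projective finitely generated graded $A^n$-modules. The projective Grothendieck group $K_p(A^n\text{-gmod})$ is a free $\mathbb Z[q,q^{-1}]$-module of rank $2^n$ with basis $\{[P_a]\}_{a\in\bigsqcup_{k=0}^nB^{n-k,k}}$. Moreover, $\{p_a\}_{a\in\bigsqcup_{k=0}^nB^{n-k,k}}$ is a basis of the free $\mathbb Z[q,q^{-1}]$-module $V^n$, so that $[P_a]\mapsto p_a$ defines an isomorphism of $\mathbb Z[q,q^{-1}]$-modules $K_p(A^n\text{-gmod})\cong V^n$.
   Context: TQFT. Let $\mathcal A$ be the free graded abelian group with basis $\mathbf 1$ (degree $-1$) and $X$ (degree $1$), with unit $\iota(1)=\mathbf 1$, trace $\varepsilon(\mathbf 1)=0,\ \varepsilon(X)=1$, commutative multiplication $m$: $\mathbf 1^2=\mathbf 1,\ \mathbf 1X=X\mathbf 1=X,\ X^2=0$, and comultiplication $\Delta(\mathbf 1)=\mathbf 1\otimes X+X\otimes\mathbf 1$, $\Delta(X)=X\otimes X$. Let $\mathcal F$ be the 2-dimensional TQFT assigning $\mathcal A^{\otimes k}$ to $k$ circles and $\iota,\varepsilon,m,\Delta$ to birth of a circle, death of a circle, merging of two circles, splitting of a circle. For a graded group, $\{j\}$ raises the grading by $j$. Rings. $B^n$ is the set of crossingless matchings of $2n$ points on a horizontal line; $W(b)$ is the reflection of $b$ in the horizontal axis, and $W(b)a$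 is the closed 1-manifold obtained by gluing $W(b)$ and $a$ along their $2n$ endpoints. For $0\le k\le n$, $B^{n-k,k}\subset B^n$ consists of matchings with no arc joining two of the first $n-k$ points and no arc joining two of the last $k$ points. The first $n-k$ points form the left platform, the last $k$ points the right platform, and the remaining $n$ points are called free. Let $\widetilde A^{n-k,k}=\bigoplus_{a,b\in B^{n-k,k}}\mathcal F(W(b)a)\{n\}$ with multiplication $\mathcal F(W(b)a)\otimes\mathcal F(W(a)c)\to\mathcal F(W(b)c)$ induced by the minimal cobordism contracting $a$ with $W(a)$ by saddles (one for each of the $n$ arcs of $a$), all other products of summands being zero. A circle is of type I if it is disjoint from platforms, type III if it meets some platform at least twice, and type II otherwise. ${}_b(I^{n-k,k})_a$ is all of $\mathcal F(W(b)a)$ if $W(b)a$ has a type III circle; otherwise it is the span of those tensors with entries in $\{\mathbf 1,X\}$ (one for each circle) in which at least one type II circle is labelled $X$. $I^{n-k,k}=\bigoplus_{a,b}{}_b(I^{n-k,k})_a$ is a two-sided ideal; $A^{n-k,k}=\widetilde A^{n-k,k}/I^{n-k,k}$, and $A^n=\prod_{k=0}^n A^{n-k,k}$. For $a\in B^{n-k,k}$, $1_a=\mathbf 1^{\otimes n}\in\mathcal F(W(a)a)\{n\}$ (mod $I^{n-k,k}$) is an idempotent, and $P_a=A^n1_a$ is the corresponding graded projective left module. Grothendieck group. $K_p(A^n\text{-gmod})$ is generated by symbols $[P]$ for finitely generated graded projective $A^n$-modules $P$, with relations $[P_1]=[P_2]+[P_3]$ whenever $P_1\cong P_2\oplus P_3$;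 $q$ acts by the grading shift, $q[P]=[P\{1\}]$. The lattice. $V^n$ is the free $\mathbb Z[q,q^{-1}]$-module with basis $v_s=v_{s_1}\otimes\cdots\otimes v_{s_n}$ over all sequences $s\in\{1,-1\}^n$, i.e. the $n$-th tensor power of the free module $V^1$ with basis $v_1,v_{-1}$. For $a\in B^{n-k,k}$ the element $p_a\in V^n$ is the tensor product, with factors placed at the positions of the $n$ free points of $a$, of: $v_1\otimes v_{-1}+q\,v_{-1}\otimes v_1$ for each arc joining two free points (first factor at the left endpoint); $v_{-1}$ for the free end of each arc with other end on the left platform; $v_1$ for the free end of each arc with other end on the right platform. Arcs joining the two platforms contribute nothing. *)

(* Defs.v *)
From HB Require Import structures.
From mathcomp Require Import all_boot all_order all_algebra.
From mathcomp Require Import boolp.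

Set Implicit Arguments.
Unset Strict Implicit.
Unset Printing Implicit Defensive.

Import GRing.Theory.
Local Open Scope ring_scope.

(* A closed 1-manifold is presented by a finite set [T] of points and two
fixed-point-free involutions [o], [i] of [T], the two systems of arcs; its
circles are the classes of the relation generated by [o] and [i]. *)

Section TQFT.
Variable T : finType.
Implicit Types (o i : T -> T) (l : {ffun T -> bool}).

Definition arc_rel o i : rel T := fun x y => (y == o x) || (y == i x).
Definition same_circle o i : rel T := connect (arc_rel o i).
Definition circles o i : {set {set T}} :=
  equivalence_partition (same_circle o i) [set: T].

(* The basis {1, X} of the Frobenius algebra is encoded by [bool], with [true]
   standing for X.  A basis tensor of F(o, i) is a labelling of the circles,
   that is, a labelling of the points which is constant on circles. *)
Definition is_labelling o i l : bool :=
  [forall x, (l (o x) == l x) && (l (i x) == l x)].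

Definition labelled_X l (C : {set T}) : bool := [exists x in C, l x].

Definition tensor_degree o i l : int :=
  \sum_(C in circles o i) (if labelled_X l C then 1 else -1).

(* [frob_mul u v w] is the coefficient of w in u v. *)
Definition frob_mul (u v w : bool) : int := (~~ (u && v) && (w == u || v))%:R.

(* [frob_comul u v w] is the coefficient of v (x) w in Delta(u). *)
Definition frob_comul (u v w : bool) : int :=
  (if u then v && w else v (+) w)%:R.

(* The integral combinations of point labellings; F(o, i) is the subgroup of
   those supported on the labellings that are constant on circles. *)
Definition chain := {ffun {ffun T -> bool} -> int}.

(* The saddle that replaces the two arcs p--q and p'--q' of [i] by p--p' and
   q--q', where [i'] is the resulting involution: it merges the circles of
   p and p' if they are distinct, and otherwise splits their common circle into
   the circle of p and the circle of q.  [saddle_coef] is the coefficient of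
   the tensor [l'] in the image of the tensor [l]. *)
Definition saddle_coef o i i' (p p' q : T) l l' : int :=
  if [&& is_labelling o i' l' &
      [forall x, (same_circle o i p x || same_circle o i p' x)
                 || (l' x == l x)]]
  then if same_circle o i p p' then frob_comul (l p) (l' p) (l' q)
       else frob_mul (l p) (l p') (l' p)
  else 0.

Definition saddle o i i' (p p' q : T) (f : chain) : chain :=
  [ffun l' => \sum_l f l * saddle_coef o i i' p p' q l l'].

End TQFT.

(* The points on the line are numbered 0, ..., 2n - 1 from left to right, and a
matching is the involution that sends a point to the other end of its arc. *)

Definition crossingless n (a : {ffun 'I_n.*2 -> 'I_n.*2}) : bool :=
  [&& [forall x, (a x != x) && (a (a x) == x)] &
      [forall x : 'I_n.*2, forall y : 'I_n.*2,
         ~~ [&& x < y, y < a x & a x < a y]%N]].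

Definition left_platform n (k : nat) (x : 'I_n.*2) : bool := (x < n - k)%N.
Definition right_platform n (k : nat) (x : 'I_n.*2) : bool := (n.*2 - k <= x)%N.

Definition platform_free n (k : nat) (a : {ffun 'I_n.*2 -> 'I_n.*2}) : bool :=
  [forall x, ~~ (left_platform k x && left_platform k (a x))
             && ~~ (right_platform k x && right_platform k (a x))].

(* The disjoint union of the sets B^{n-k,k} for 0 <= k <= n. *)
Definition is_pmatching n (t : 'I_n.+1 * {ffun 'I_n.*2 -> 'I_n.*2}) : bool :=
  crossingless t.2 && platform_free t.1 t.2.

Record pmatching n := PMatching {
  pm_val :> 'I_n.+1 * {ffun 'I_n.*2 -> 'I_n.*2};
  _ : is_pmatching pm_val }.
HB.instance Definition _ n := [isSub for @pm_val n].
HB.instance Definition _ n := [Finite of pmatching n by <:].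

Definition pm_k n (a : pmatching n) : 'I_n.+1 := a.1.
Definition pm_arc n (a : pmatching n) : 'I_n.*2 -> 'I_n.*2 := a.2.

Lemma pm_arc_spec n (a : pmatching n) x :
  (pm_arc a x != x) && (pm_arc a (pm_arc a x) == x).
Proof. by have /andP[/andP[/forallP + _] _] := valP a; apply. Qed.

Lemma pm_arcK n (a : pmatching n) : involutive (pm_arc a).
Proof. by move=> x; have /andP[_ /eqP] := pm_arc_spec a x. Qed.

Lemma pm_arc_neq n (a : pmatching n) x : pm_arc a x != x.
Proof. by have /andP[] := pm_arc_spec a x. Qed.

(* [(b, a, l)] is the basis tensor of F(W(b)a) with labelling [l]. *)
Definition is_tensor n
    (t : pmatching n * pmatching n * {ffun 'I_n.*2 -> bool}) : bool :=
  (pm_k t.1.1 == pm_k t.1.2)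
  && is_labelling (pm_arc t.1.1) (pm_arc t.1.2) t.2.

Record tensor n := Tensor {
  tensor_val :> pmatching n * pmatching n * {ffun 'I_n.*2 -> bool};
  _ : is_tensor tensor_val }.
HB.instance Definition _ n := [isSub for @tensor_val n].
HB.instance Definition _ n := [Finite of tensor n by <:].

Definition tsrc n (t : tensor n) : pmatching n := t.1.1.
Definition ttgt n (t : tensor n) : pmatching n := t.1.2.
Definition tlab n (t : tensor n) : {ffun 'I_n.*2 -> bool} := t.2.

(* The product over k of the rings \tilde A^{n-k,k}, as an abelian group. *)
Definition Atilde n := {ffun tensor n -> int}.
HB.instance Definition _ n := GRing.Zmodule.on (Atilde n).

(* The shift {n} is included. *)
Definition tdeg n (t : tensor n) : int :=
  tensor_degree (pm_arc (tsrc t)) (pm_arc (ttgt t)) (tlab t) + n%:Z.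

Definition Atilde_deg n (j : int) (x : Atilde n) : Prop :=
  forall t, x t != 0 -> tdeg t = j.

(* The minimal cobordism from W(b)a and W(a)c to W(b)c.  The points
   [(false, x)] are the endpoints of the arcs of W(b)a and the points
   [(true, x)] those of W(a)c.  The outer arcs, those of b and of c, do not
   change; the inner arcs are those of a and W(a), except on the set [D] of the
   points whose arc has already been contracted: such a point is joined with
   its copy on the other line. *)
Section Cobordism.
Variables (n : nat) (b a c : pmatching n).

Definition outer_arc (z : bool * 'I_n.*2) : bool * 'I_n.*2 :=
  if z.1 then (true, pm_arc c z.2) else (false, pm_arc b z.2).

Definition inner_arc (D : {set 'I_n.*2}) (z : bool * 'I_n.*2)
    : bool * 'I_n.*2 :=
  if z.2 \in D then (~~ z.1, z.2) else (z.1, pm_arc a z.2).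

Fixpoint contract (D : {set 'I_n.*2}) (s : seq 'I_n.*2)
    (f : chain (bool * 'I_n.*2)%type) : chain (bool * 'I_n.*2)%type :=
  if s is x :: s' then
    let D' := D :|: [set x; pm_arc a x] in
    contract D' s'
      (saddle outer_arc (inner_arc D) (inner_arc D')
              (false, x) (true, x) (false, pm_arc a x) f)
  else f.

Definition left_ends : seq 'I_n.*2 := 
  [seq x : 'I_n.*2 <- enum 'I_n.*2 | (x < pm_arc a x)%N].

Definition disjoint_tensor (l1 l2 : {ffun 'I_n.*2 -> bool}) :
    chain (bool * 'I_n.*2)%type :=
  [ffun l => (l == [ffun z => if z.1 then l2 z.2 else l1 z.2])%:R].

(* The coefficient of the tensor [l] of F(W(b)c) in the product of the tensors
   [l1] of F(W(b)a) and [l2] of F(W(a)c).  After all the contractions the two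
   copies of each point lie on the same circle. *)
Definition mul_coef (l1 l2 l : {ffun 'I_n.*2 -> bool}) : int :=
  contract set0 left_ends (disjoint_tensor l1 l2) [ffun z => l z.2].

End Cobordism.

Definition Atilde_mul n (x y : Atilde n) : Atilde n :=
  [ffun t : tensor n =>
    \sum_(u : tensor n | tsrc u == tsrc t)
    \sum_(v : tensor n | (tsrc v == ttgt u) && (ttgt v == ttgt t))
      x u * y v * mul_coef (tsrc u) (ttgt u) (ttgt v)
                           (tlab u) (tlab v) (tlab t)].

Lemma idem_tensor_proof n (a : pmatching n) :
  is_tensor (a, a, [ffun=> false]).
Proof. by rewrite /is_tensor eqxx; apply/forallP=> x; rewrite !ffunE eqxx. Qed.

(* The tensor all of whose entries are 1 in F(W(a)a). *)
Definition idem_tensor n (a : pmatching n) : tensor n :=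
  Tensor (idem_tensor_proof a).

Definition Atilde_idem n (a : pmatching n) : Atilde n :=
  [ffun t => (t == idem_tensor a)%:R].

Definition Atilde_one n : Atilde n := \sum_a Atilde_idem a.

Section CircleTypes.
Variables (n : nat) (k : nat).
Implicit Types C : {set 'I_n.*2}.

Definition type_I C : bool :=
  [forall x in C, ~~ left_platform k x && ~~ right_platform k x].

Definition type_III C : bool :=
  (1 < #|[set x in C | left_platform k x]|)%N
  || (1 < #|[set x in C | right_platform k x]|)%N.

Definition type_II C : bool := ~~ type_I C && ~~ type_III C.

End CircleTypes.

Definition tensor_circles n (t : tensor n) : {set {set 'I_n.*2}} :=
  circles (pm_arc (tsrc t)) (pm_arc (ttgt t)).

Definition ideal_tensor n (t : tensor n) : bool :=
  [exists C in tensor_circles t, type_III (pm_k (tsrc t)) C]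
  || [exists C in tensor_circles t,
        type_II (pm_k (tsrc t)) C && labelled_X (tlab t) C].

(* The span of the tensors that satisfy [ideal_tensor]. *)
Definition Atilde_ideal n (x : Atilde n) : Prop :=
  forall t, x t != 0 -> ideal_tensor t.

(* M is the direct sum of the subgroups [D j]. *)
Definition is_grading (M : zmodType) (D : int -> M -> Prop) : Prop :=
  [/\ forall j, D j 0 /\ (forall x y, D j x -> D j y -> D j (x - y)),
      forall x, exists (s : seq int) (h : int -> M),
        [/\ uniq s, forall j, D j (h j) & x = \sum_(j <- s) h j]
    & forall (s : seq int) (h : int -> M),
        uniq s -> (forall j, D j (h j)) -> \sum_(j <- s) h j = 0 ->
        forall j, j \in s -> h j = 0].

Record gring := GRingPack {
  gr_ring :> pzRingType;
  rdeg : int -> gr_ring -> Prop;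
  rdeg_grading : is_grading rdeg;
  rdeg1 : rdeg 0 1;
  rdegM : forall i j x y, rdeg i x -> rdeg j y -> rdeg (i + j) (x * y) }.

Record gmod (A : gring) := GMod {
  gmod_lmod :> lmodType A;
  mdeg : int -> gmod_lmod -> Prop;
  mdeg_grading : is_grading mdeg;
  mdegZ : forall i j (x : A) (m : gmod_lmod),
    rdeg i x -> mdeg j m -> mdeg (i + j) (x *: m) }.

Section GradedModules.
Variable A : gring.
Implicit Types M N P : gmod A.

Definition ghom M N (f : {linear M -> N}) : Prop :=
  forall j x, mdeg j x -> mdeg j (f x).

Definition giso M N : Prop :=
  exists f : {linear M -> N}, bijective f /\ forall j x, mdeg j x <-> mdeg j (f x).

Definition finitely_generated M : Prop :=
  exists (r : nat) (g : 'I_r -> M),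
    forall x, exists c : 'I_r -> A, x = \sum_i c i *: g i.

Definition gprojective P : Prop :=
  forall M N (g : {linear M -> N}) (f : {linear P -> N}),
    ghom g -> (forall y, exists x, g x = y) -> ghom f ->
    exists h : {linear P -> M}, ghom h /\ forall x, g (h x) = f x.

(* The shift {i} raises degrees by i. *)
Definition shift_deg M (i j : int) (x : M) : Prop := mdeg (j - i) x.

Lemma shift_grading M i : is_grading (@shift_deg M i).
Proof.
have [sub0 span indep] := mdeg_grading M.
split=> [j|x|s h us hD h0 j js]; first exact: sub0.
  have [s [h [us hD ->]]] := span x.
  exists [seq j + i | j <- s], (fun j => h (j - i)); split.
  - by rewrite map_inj_uniq //; apply: addIr.
  - by move=> j; apply: hD.
  - by rewrite big_map; apply: eq_bigr => j _; rewrite addrK.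
have := indep [seq j - i | j <- s] (fun j => h (j + i)).
rewrite map_inj_uniq; last exact: addIr.
move=> /(_ us); rewrite big_map; under eq_bigr do rewrite subrK.
have hD' k : mdeg k (h (k + i)) by have := hD (k + i); rewrite /shift_deg addrK.
by move=> /(_ hD' h0 (j - i)); rewrite subrK; apply; apply: map_f.
Qed.

Lemma shift_scale M k i j (x : A) (m : M) :
  rdeg i x -> shift_deg k j m -> shift_deg k (i + j) (x *: m).
Proof. by move=> xi mj; rewrite /shift_deg -addrA; apply: mdegZ. Qed.

Definition gshift M (i : int) : gmod A :=
  GMod (@shift_grading M i) (@shift_scale M i).

Definition dsum_deg M N (j : int) (x : M * N) : Prop :=
  mdeg j x.1 /\ mdeg j x.2.

Lemma dsum_grading M N : is_grading (@dsum_deg M N).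
Proof.
have [sub1 span1 indep1] := mdeg_grading M.
have [sub2 span2 indep2] := mdeg_grading N.
split=> [j|[x y]|s h us hD h0 j js].
- have [[z1 b1] [z2 b2]] := (sub1 j, sub2 j); split=> [//|x y [x1 x2] [y1 y2]].
  by split; [apply: b1 | apply: b2].
- have [s1 [h1 [us1 hD1 ->]]] := span1 x; have [s2 [h2 [us2 hD2 ->]]] := span2 y.
  exists (undup (s1 ++ s2)).
  exists (fun j => (if j \in s1 then h1 j else 0, if j \in s2 then h2 j else 0)).
  split; first exact: undup_uniq.
    by move=> j; split=> /=; case: ifP => _ //;
      [case: (sub1 j) | case: (sub2 j)].
  rewrite [RHS]surjective_pairing !raddf_sum /=; congr (_, _); rewrite -big_mkcond /=.
    rewrite -[RHS]big_filter; apply: perm_big; apply: uniq_perm => //.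
      by rewrite filter_uniq ?undup_uniq.
    by move=> j; rewrite mem_filter mem_undup mem_cat; case: (j \in s1).
  rewrite -[RHS]big_filter; apply: perm_big; apply: uniq_perm => //.
    by rewrite filter_uniq ?undup_uniq.
  by move=> j; rewrite mem_filter mem_undup mem_cat orbC; case: (j \in s2).
have h01 : \sum_(j <- s) (h j).1 = 0.
  by have := congr1 fst h0; rewrite raddf_sum.
have h02 : \sum_(j <- s) (h j).2 = 0.
  by have := congr1 snd h0; rewrite raddf_sum.
rewrite [h j]surjective_pairing.
rewrite (indep1 s (fun j => (h j).1) us _ h01 j js); last first.
  by move=> i; case: (hD i).
by rewrite (indep2 s (fun j => (h j).2) us _ h02 j js) // => i; case: (hD i).
Qed.

Lemma dsum_scale M N i j (x : A) (m : M * N) :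
  rdeg i x -> dsum_deg j m -> dsum_deg (i + j) (x *: m).
Proof. by move=> xi [m1 m2]; split; apply: mdegZ. Qed.

Definition gdsum M N : gmod A := GMod (@dsum_grading M N) (@dsum_scale M N).

Definition gzero M : Prop := forall x : M, x = 0.

Definition gindecomposable M : Prop :=
  ~ gzero M /\ forall M1 M2, giso M (gdsum M1 M2) -> gzero M1 \/ gzero M2.

End GradedModules.

Section LeftIdeal.
Variables (A : pzRingType) (e : A).

Definition in_left_ideal : pred A^o := fun x => `[< exists y : A, x = y * e >].

Lemma in_left_ideal_submod : submod_closed in_left_ideal.
Proof.
split; first by apply/asboolP; exists 0; rewrite mul0r.
move=> c x y /asboolP[x' ->] /asboolP[y' ->]; apply/asboolP.
by exists (c * x' + y'); rewrite mulrDl -mulrA.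
Qed.

HB.instance Definition _ :=
  GRing.isSubmodClosed.Build A A^o in_left_ideal in_left_ideal_submod.

Record left_ideal := LeftIdeal {
  left_ideal_val :> A^o;
  _ : left_ideal_val \in in_left_ideal }.
HB.instance Definition _ := [isSub for left_ideal_val].
HB.instance Definition _ := [Choice of left_ideal by <:].
HB.instance Definition _ := [SubChoice_isSubLmodule of left_ideal by <:].

End LeftIdeal.

Section GradedLeftIdeal.
Variables (A : gring) (e : A) (e0 : rdeg 0 e).

Definition lideal_deg (j : int) (x : left_ideal e) : Prop := rdeg j (val x : A).

Lemma lideal_grading : is_grading lideal_deg.
Proof.
have [sub0 span indep] := rdeg_grading A.
split=> [j|[x xP]|s h us hD h0 j js].
- have [z bz] := sub0 j; split; first by rewrite /lideal_deg raddf0.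
  by move=> x y xj yj; rewrite /lideal_deg raddfB; apply: bz.
- have [y xE] := asboolP _ xP; have [s [h [us hD yE]]] := span y.
  have hP j : (h j * e : A^o) \in in_left_ideal e by apply/asboolP; exists (h j).
  exists s, (fun j => LeftIdeal (hP j)); split=> [//|j|].
    by have := rdegM (hD j) e0; rewrite addr0.
  by apply: val_inj; rewrite raddf_sum /= xE yE mulr_suml.
apply: val_inj; rewrite raddf0.
by apply: (indep s (fun j => val (h j))) => //; rewrite -raddf_sum h0 raddf0.
Qed.

Lemma lideal_scale i j (x : A) (m : left_ideal e) :
  rdeg i x -> lideal_deg j m -> lideal_deg (i + j) (x *: m).
Proof. by move=> xi mj; rewrite /lideal_deg linearZ; apply: rdegM. Qed.

Definition glideal : gmod A := GMod lideal_grading lideal_scale.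

End GradedLeftIdeal.

(* The quotient of the graded ring [Atilde n] by its ideal, together with the
   projection.  These data determine the graded ring up to a unique
   isomorphism. *)
Record arc_quotient n := ArcQuotient {
  aq_ring :> gring;
  aq_proj : {additive Atilde n -> aq_ring};
  aq_surj : forall y, exists x, aq_proj x = y;
  aq_ker : forall x, aq_proj x = 0 <-> Atilde_ideal x;
  aq_one : aq_proj (Atilde_one n) = 1;
  aq_mul : forall x y, aq_proj (Atilde_mul x y) = aq_proj x * aq_proj y;
  aq_deg : forall j y,
    rdeg j y <-> exists x, Atilde_deg j x /\ aq_proj x = y }.

Section IdempotentDegree.
Variables (n : nat) (a : pmatching n).
Let sc := same_circle (pm_arc a) (pm_arc a).

Lemma same_circle_pm x y : sc x y = (y \in [set x; pm_arc a x]).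
Proof.
apply/idP/idP; rewrite !inE; last first.
  by case/orP=> /eqP->; [exact: connect0 | apply: connect1; rewrite /arc_rel eqxx].
case/connectP=> p + ->; elim/last_ind: p => [|p z IHp]; first by rewrite eqxx.
rewrite rcons_path last_rcons => /andP[/IHp /orP[]/eqP->].
  by rewrite /arc_rel orbb orbC => ->.
by rewrite /arc_rel orbb pm_arcK => ->.
Qed.

Lemma card_circles_pm : #|circles (pm_arc a) (pm_arc a)| = n.
Proof.
have eqv : {in [set: 'I_n.*2] & &, equivalence_rel sc}.
  move=> x y z _ _ _; split; first exact: connect0.
  rewrite !same_circle_pm !inE => /orP[]/eqP-> //.
  by rewrite pm_arcK orbC.
have part := equivalence_partitionP eqv.
have := card_uniform_partition (n := 2) _ part.
rewrite cardsT card_ord muln2 => E; apply/esym/double_inj/E.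
move=> C /imsetP[x _ ->].
rewrite (_ : [set y in _ | _] = [set x; pm_arc a x]); last first.
  by apply/setP=> y; rewrite !inE -/sc same_circle_pm !inE.
by rewrite cards2 eq_sym pm_arc_neq.
Qed.

Lemma tdeg_idem : tdeg (idem_tensor a) = 0.
Proof.
rewrite /tdeg /tensor_degree /tsrc /ttgt /tlab /=.
rewrite (eq_bigr (fun=> -1)) => [|C _].
  by rewrite sumr_const card_circles_pm mulNrn natz addNr.
by case: ifP => // /existsP[x]; rewrite ffunE andbF.
Qed.

End IdempotentDegree.

Definition aq_idem n (A : arc_quotient n) (a : pmatching n) : A :=
  aq_proj A (Atilde_idem a).

Lemma aq_idem_deg n (A : arc_quotient n) a : rdeg 0 (aq_idem A a).
Proof.
apply/aq_deg; exists (Atilde_idem a); split=> // t; rewrite ffunE.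
by have [-> _|_] := eqVneq t (idem_tensor a); [exact: tdeg_idem | rewrite eqxx].
Qed.

(* The module P_a = A^n 1_a. *)
Definition proj_module n (A : arc_quotient n) (a : pmatching n) : gmod A :=
  glideal (aq_idem_deg A a).

(* Z[q, q^-1] is the subring of the field of fractions of Z[X] consisting of the
fractions with denominator a power of X. *)

Local Notation "x %:F" := (@FracField.tofrac _ x).

Definition qfrac : {fraction {poly int}} := ('X : {poly int})%:F.

Definition is_laurent : pred {fraction {poly int}} :=
  fun x => `[< exists (m : nat) (p : {poly int}), x * qfrac ^+ m = p%:F >].

Lemma is_laurent_subring : subring_closed is_laurent.
Proof.
split.
- by apply/asboolP; exists 0, 1; rewrite expr0 mulr1 rmorph1.
- move=> x y /asboolP[m [p xE]] /asboolP[r [s yE]]; apply/asboolP.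
  exists (m + r)%N, (p * 'X ^+ r - s * 'X ^+ m).
  rewrite rmorphB !rmorphM !rmorphXn /= -xE -yE mulrBl exprD mulrA.
  by congr (_ - _); rewrite -mulrA [qfrac ^+ m * _]mulrC.
- move=> x y /asboolP[m [p xE]] /asboolP[r [s yE]]; apply/asboolP.
  by exists (m + r)%N, (p * s); rewrite rmorphM /= -xE -yE exprD mulrACA.
Qed.

HB.instance Definition _ :=
  GRing.isSubringClosed.Build {fraction {poly int}} is_laurent
    is_laurent_subring.

Record laurent := Laurent {
  laurent_val :> {fraction {poly int}};
  _ : laurent_val \in is_laurent }.
HB.instance Definition _ := [isSub for laurent_val].
HB.instance Definition _ := [Choice of laurent by <:].
HB.instance Definition _ := [SubChoice_isSubComNzRing of laurent by <:].

Lemma q_proof : qfrac \in is_laurent.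
Proof. by apply/asboolP; exists 0, 'X; rewrite expr0 mulr1. Qed.

Definition q : laurent := Laurent q_proof.

Definition is_basis (R : pzRingType) (L : lmodType R) (I : finType) (e : I -> L)
    : Prop :=
  forall x, exists! c : {ffun I -> R}, x = \sum_i c i *: e i.

Section Grothendieck.
Variable A : gring.

Definition fgproj (P : gmod A) : Prop := finitely_generated P /\ gprojective P.

Definition additive_on_fgproj (G : zmodType) (f : gmod A -> G) : Prop :=
  forall P1 P2 P3, fgproj P1 -> fgproj P2 -> fgproj P3 ->
    giso P1 (gdsum P2 P3) -> f P1 = f P2 + f P3.

(* [K], with the symbols [cls P] for [fgproj P], is the abelian group presented
   by these symbols and the relations [P1] = [P2] + [P3], and q acts on it by
   the shift.  The values of [cls] on other modules are irrelevant.  The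
   presentation is expressed by its universal property because the graded
   modules form a large type, on which no free abelian group can be formed
   inside [zmodType]. *)
Definition is_Kp (K : lmodType laurent) (cls : gmod A -> K) : Prop :=
  [/\ additive_on_fgproj cls,
      forall (G : zmodType) (f : gmod A -> G), additive_on_fgproj f ->
        exists h : {additive K -> G},
          (forall P, fgproj P -> h (cls P) = f P)
          /\ forall h' : {additive K -> G},
               (forall P, fgproj P -> h' (cls P) = f P) -> h' =1 h
    & forall P, fgproj P -> q *: cls P = cls (gshift P 1)].

End Grothendieck.

(* A sequence in {1, -1}^n is encoded by a function to [bool], with [true]
   standing for 1; an element of V^n is given by its coordinates in the basis
   of the v_s. *)
Definition Vlattice n := {ffun {ffun 'I_n -> bool} -> laurent^o}.
HB.instance Definition _ n := GRing.Lmodule.on (Vlattice n).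

Lemma free_point_proof n (k : 'I_n.+1) (i : 'I_n) : (n - k + i < n.*2)%N.
Proof.
by rewrite -addnn -addnS; apply: leq_add; [apply: leq_subr | apply: ltn_ord].
Qed.

Definition free_point n (k : 'I_n.+1) (i : 'I_n) : 'I_n.*2 :=
  Ordinal (free_point_proof k i).

(* The coefficient of v_s (x) v_t in v_1 (x) v_{-1} + q v_{-1} (x) v_1. *)
Definition cup_coef (s t : bool) : laurent :=
  match s, t with
  | true, false => 1
  | false, true => q
  | _, _ => 0
  end.

Definition p_vec n (a : pmatching n) : Vlattice n :=
  let fp := free_point (pm_k a) in
  [ffun s : {ffun 'I_n -> bool} =>
    (\prod_(i < n) \prod_(j < n | (i < j)%N && (pm_arc a (fp i) == fp j))
       cup_coef (s i) (s j))
    * (\prod_(i < n | left_platform (pm_k a) (pm_arc a (fp i))) (~~ s i)%:R)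
    * (\prod_(i < n | right_platform (pm_k a) (pm_arc a (fp i))) (s i)%:R)].

(* Main.v *)
Require Import Defs.
From HB Require Import structures.
From mathcomp Require Import all_boot all_order all_algebra perm ring zify.
From mathcomp Require Import boolp.

Set Implicit Arguments.
Unset Strict Implicit.
Unset Printing Implicit Defensive.

Import Order.TTheory GRing.Theory Num.Theory.
Local Open Scope ring_scope.

(** The theorem has three sources.

    The ring.  The product of tensors is associative because the Frobenius
    algebra can be deformed to X^2 = s^2 over Z[s], where it becomes a ring of
    functions: a tensor is determined by its values at the choices of a root
    X = s or X = - s on every circle ([chain_ev_inj]), a saddle that merges two
    circles preserves these values, and a saddle that splits a circle multiplies
    them by 2 X ([saddle_ev]).  A product is therefore a product of values times
    a weight which depends only on how many splits occur, and that number is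
    determined by the numbers of circles ([saddle_count]).  The weights form a
    cocycle ([weight_cocycle]), which is associativity ([dmul_coefA]); putting
    s = 0 gives it for the original product ([mul_coefA]).  The fact that a
    saddle always merges or splits rests on the colouring of points by parity
    ([saddle_dichotomy]).  A saddle raises the degree by one
    ([saddle_degree]) and keeps a tensor of the ideal in the ideal
    ([saddle_degenerate]), so that the quotient exists and has the tensors
    outside the ideal as a basis ([arc_quotient_model]).  A circle contains at
    least two points; hence all degrees are non-negative and a tensor of degree
    0 is some 1_a ([tdeg_eq0]).  So the quotient is a non-negatively graded
    ring whose part of degree 0 is a product of copies of Z ([arc_basic]).

    The modules.  Over such a ring a finitely generated graded projective module
    is a retract of a sum of modules P_a{i}, which is recorded by vectors x_j and
    functionals phi_j.  For fixed (a, i) the coefficients of phi_k(x_j) form an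
    idempotent integer matrix, and if it is non-zero, its Smith normal form
    yields integer combinations m of the x_j and g of the phi_k with g(m) = 1_a
    ([idempotent_unit_minor]).  They split off a summand P_a{i}
    and lower the rank of the matrix, so induction gives a decomposition
    ([orthonormalize], [fgproj_basis]).  The multiplicities are unique by
    tr(UV) = tr(VU) ([frame_count]).  Consequently the P_a{i} are the
    indecomposable projectives, and K_p is free on the classes of the P_a
    ([std_class_Kp], [Kp_iso]).

    The lattice.  A matching is determined by which of its free points open an
    arc: with the left platform as opening and the right platform as closing
    brackets this is a Dyck word, and every sign sequence occurs exactly once
    ([signs_bij]).  The coefficient of p_a at the sign sequence of a is 1, and the
    other coefficients sit at lexicographically smaller sequences, so the p_a
    form a basis by triangularity ([p_vec_basis]). *)

(** * Merging two classes of an equivalence relation *)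

Section Partition.
Variables (T : finType) (R : rel T).
Hypothesis Rrefl : reflexive R.
Hypothesis Rsym : symmetric R.
Hypothesis Rtrans : transitive R.

Definition eqclass (x : T) : {set T} := [set y | R x y].

Lemma eqclassP x y : (eqclass x == eqclass y) = R x y.
Proof.
apply/eqP/idP => [/setP/(_ y)|Rxy]; first by rewrite !inE Rrefl.
apply/setP => z; rewrite !inE.
by apply/idP/idP; apply: Rtrans => //; rewrite Rsym.
Qed.

Lemma partitionE :
  equivalence_partition R [set: T] = [set eqclass x | x : T].
Proof.
apply/setP => C; apply/imsetP/imsetP => -[x _ ->]; exists x => //;
  by apply/setP => y; rewrite !inE.
Qed.

Lemma mem_eqclass x : eqclass x \in equivalence_partition R [set: T].
Proof. by rewrite partitionE imset_f. Qed.

End Partition.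

Section Merge.
Variables (T : finType) (R R' : rel T) (p p' : T).
Hypotheses (Rrefl : reflexive R) (Rsym : symmetric R) (Rtrans : transitive R).
Hypothesis npp' : ~~ R p p'.
Hypothesis R'E : forall x y,
  R' x y = [|| R x y, R x p && R p' y | R x p' && R p y].

Lemma merge_class_out x : ~~ R x p -> ~~ R x p' -> eqclass R' x = eqclass R x.
Proof.
by move=> /negPf xp /negPf xp'; apply/setP=> y; rewrite !inE R'E xp xp' orbF.
Qed.

Variables (M : Type) (idx : M) (op : Monoid.com_law idx).

(** [R'] arises from [R] by joining the class of [p] with that of [p'].  With
    [big_merged_classes], this compares an operation over the circles before and
    after a saddle: both are a few boundary terms times the same remainder. *)
Lemma big_split_classes (h : {set T} -> M) :
  \big[op/idx]_(C in equivalence_partition R [set: T]) h C =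
  op (h (eqclass R p)) (op (h (eqclass R p'))
   (\big[op/idx]_(C in equivalence_partition R [set: T] | (p \notin C) && (p' \notin C))
       h C)).
Proof.
rewrite (bigD1 (eqclass R p)) ?mem_eqclass //=; congr (op _ _).
rewrite (bigD1 (eqclass R p')) /=; last first.
  by rewrite mem_eqclass /= eqclassP // Rsym.
congr (op _ _); apply: eq_bigl => C; rewrite -andbA.
apply: andb_id2l; rewrite partitionE => /imsetP[x _ ->].
by rewrite !eqclassP // !inE.
Qed.

Lemma big_merged_classes (h : {set T} -> M) :
  \big[op/idx]_(C in equivalence_partition R' [set: T]) h C =
  op (h (eqclass R' p))
   (\big[op/idx]_(C in equivalence_partition R [set: T] | (p \notin C) && (p' \notin C))
       h C).
Proof.
rewrite (bigD1 (eqclass R' p)) ?mem_eqclass //=; congr (op _ _).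
apply: eq_bigl => C; rewrite !partitionE; apply/andP/and3P.
  case=> /imsetP[x _ ->] Cp.
  have nxp : ~~ R x p.
    apply: contra Cp => xp; apply/eqP/setP => y; rewrite !inE !R'E Rrefl /=.
    rewrite (negPf npp') orbF xp /=.
    have -> : R x y = R p y by apply/idP/idP; apply: Rtrans; rewrite // Rsym.
    by case: (R p y); case: (R p' y); rewrite ?andbF ?orbT ?orbF.
  have nxp' : ~~ R x p'.
    apply: contra Cp => xp; apply/eqP/setP => y; rewrite !inE !R'E Rrefl /=.
    rewrite (negPf npp') orbF xp /=.
    have -> : R x y = R p' y by apply/idP/idP; apply: Rtrans; rewrite // Rsym.
    by case: (R p y); case: (R p' y); rewrite ?andbF ?orbT ?orbF.
  by rewrite merge_class_out // imset_f // !inE.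
case=> /imsetP[x _ ->]; rewrite !inE => nxp nxp'.
rewrite -merge_class_out // imset_f //; split=> //.
apply: contra nxp => /eqP/setP/(_ x); rewrite !inE !R'E Rrefl Rrefl /=.
rewrite (negPf npp') orbF => /esym/orP[]; first by rewrite Rsym.
by rewrite Rsym (negPf nxp').
Qed.

End Merge.

Section Circles.
Variables (T : finType) (o i : T -> T).
Hypotheses (oK : involutive o) (iK : involutive i).

Lemma same_circle_refl : reflexive (same_circle o i).
Proof. exact: connect0. Qed.

Lemma same_circle_sym : symmetric (same_circle o i).
Proof.
apply/sym_connect_sym=> x y; rewrite /arc_rel.
by rewrite -(inj_eq (can_inj oK) y) oK -(inj_eq (can_inj iK) y) iK ![_ == x]eq_sym.
Qed.

Lemma same_circle_trans : transitive (same_circle o i).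
Proof. by move=> y x z; apply: connect_trans. Qed.

Lemma same_circle_o x : same_circle o i x (o x).
Proof. by apply: connect1; rewrite /arc_rel eqxx. Qed.

Lemma same_circle_i x : same_circle o i x (i x).
Proof. by apply: connect1; rewrite /arc_rel eqxx orbT. Qed.

Definition circle x := eqclass (same_circle o i) x.

Lemma mem_circle x y : (y \in circle x) = same_circle o i x y.
Proof. by rewrite inE. Qed.

Lemma circlesE : circles o i = [set circle x | x : T].
Proof. exact: partitionE. Qed.

Lemma mem_circles x : circle x \in circles o i.
Proof. exact: mem_eqclass. Qed.

Lemma circlesP C : reflect (exists x, C = circle x) (C \in circles o i).
Proof.
rewrite circlesE; apply: (iffP imsetP) => [[x _ ->]|[x ->]]; by exists x.
Qed.

Lemma labelling_circle (l : {ffun T -> bool}) :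
  is_labelling o i l -> forall x y, same_circle o i x y -> l y = l x.
Proof.
move=> /forallP lab x y /connectP[s + ->] {y}.
elim: s x => //= y s IHs x /andP[xy /IHs ->].
by have /andP[/eqP lo /eqP li] := lab x; case/orP: xy => /eqP->.
Qed.

Lemma labelled_X_circle (l : {ffun T -> bool}) x :
  is_labelling o i l -> labelled_X l (circle x) = l x.
Proof.
move=> lab; apply/existsP/idP => [[y]|lx].
  by rewrite mem_circle => /andP[/(labelling_circle lab)->].
by exists x; rewrite mem_circle same_circle_refl.
Qed.

Lemma same_circle_sub (R : rel T) :
  reflexive R -> transitive R -> (forall x, R x (o x) && R x (i x)) ->
  forall x y, same_circle o i x y -> R x y.
Proof.
move=> Rr Rt Ra x y /connectP[s + ->] {y}.
elim: s x => //= y s IHs x /andP[xy /IHs]; apply: Rt.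
by have /andP[] := Ra x; case/orP: xy => /eqP->.
Qed.

End Circles.
(** * A saddle merges or splits *)

Lemma eqNb (b c : bool) : (~~ b == c) = (b != c).
Proof. by case: b; case: c. Qed.

Section ColouredCircles.
Variables (T : finType) (o i : T -> T) (col : T -> bool) (c : bool).
Hypotheses (oK : involutive o) (iK : involutive i).
Hypotheses (col_o : forall x, col (o x) = ~~ col x)
           (col_i : forall x, col (i x) = ~~ col x).

(** Two consecutive arcs lead from a point to one of the same colour.  A circle
    that alternates in colour thus becomes, on the points of colour [c], a cycle
    of this permutation. *)
Definition double_step x := if col x == c then o (i x) else x.

Lemma col_double_step x : col (double_step x) = col x.
Proof. by rewrite /double_step; case: ifP => // _; rewrite col_o col_i negbK. Qed.

Lemma double_step_inj : injective double_step.
Proof.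
move=> x y xy; have := congr1 col xy; rewrite !col_double_step => cxy.
move: xy; rewrite /double_step cxy; case: ifP => // _.
by move/(can_inj oK)/(can_inj iK).
Qed.

Definition circle_perm := perm double_step_inj.

Lemma same_circle_porbit x y : col x = c -> col y = c ->
  same_circle o i x y = (y \in porbit circle_perm x).
Proof.
move=> xc yc; apply/idP/idP => [|/porbitP[k ->]]; last first.
  elim: k => [|k IHk]; first by rewrite expg0 perm1 same_circle_refl.
  rewrite expgSr permM; apply: (same_circle_trans IHk).
  rewrite permE /double_step; case: ifP => _; last exact: same_circle_refl.
  by apply: (same_circle_trans (same_circle_i _ _ _)); exact: same_circle_o.
pose nb z := if col z == c then z else o z.
pose R u v := nb v \in porbit circle_perm (nb u).
have Rt : transitive R.
  by move=> v u w; rewrite /R -!eq_porbit_mem => /eqP vu /eqP wv; rewrite wv vu.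
have nbx z : col z = c -> nb z = z by move=> zc; rewrite /nb zc eqxx.
(* Points of the other colour are represented by their neighbour along [o]. *)
suff sub u v : same_circle o i u v -> R u v by move/sub; rewrite /R !nbx.
apply: same_circle_sub => //; first by move=> z; exact: porbit_id.
move=> z; rewrite /R /nb col_o col_i; case: (eqVneq (col z) c) => zc.
  have -> : (~~ col z == c) = false by rewrite eqNb zc eqxx.
  rewrite oK porbit_id /=.
  have -> : o (i z) = circle_perm z by rewrite permE /double_step zc eqxx.
  exact: (mem_porbit _ 1).
have zc' : ~~ col z == c by rewrite eqNb.
rewrite zc' porbit_id /= porbit_sym.
have -> : o z = circle_perm (i z) by rewrite permE /double_step col_i zc' iK.
exact: (mem_porbit _ 1).
Qed.

End ColouredCircles.

(** Multiplying by a transposition changes the number of cycles by one: up if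
    its two points lie on the same cycle, down otherwise. *)
Lemma tperm_porbit_xor (T : finType) (s : {perm T}) (x y : T) : x != y ->
  (y \in porbit s x) = ~~ (y \in porbit (tperm x y * s) x).
Proof.
move=> xy; have E := porbits_mul_tperm s x y.
have := porbits_mul_tperm (tperm x y * s)%g x y.
rewrite /= mulgA tperm2 mul1g xy /= => E'; move: E; rewrite xy /=.
rewrite ![x \in _]porbit_sym; rewrite ![x \in _]porbit_sym in E'.
move: E'; case: (y \in porbit s x); case: (y \in porbit _ x) => //=; lia.
Qed.

(** The saddle replaces the arcs p--q and p'--q' of [i] by p--p' and q--q'.  All
    arcs change the colour [col]; this orientability is what excludes the
    surgery that turns one circle into one circle. *)
Record saddle_site (T : finType) (o i i' : T -> T) (col : T -> bool)
    (p p' q q' : T) : Prop := SaddleSite {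
  site_oK : involutive o;
  site_iK : involutive i;
  site_iK' : involutive i';
  site_col_o : forall x, col (o x) = ~~ col x;
  site_col_i : forall x, col (i x) = ~~ col x;
  site_col_p : col p' = ~~ col p;
  site_ip : i p = q;
  site_ip' : i p' = q';
  site_i'p : i' p = p';
  site_i'q : i' q = q';
  site_i'E : forall x, x \notin [:: p; q; p'; q'] -> i' x = i x;
  site_p'q : p' != q }.

Section Saddle.
Variables (T : finType) (o i i' : T -> T) (col : T -> bool) (p p' q q' : T).
Hypothesis site : saddle_site o i i' col p p' q q'.

Let oK := site_oK site.
Let iK := site_iK site.
Let i'K := site_iK' site.
Let col_o := site_col_o site.
Let col_i := site_col_i site.
Let col_p' := site_col_p site.
Let ip := site_ip site.
Let ip' := site_ip' site.
Let i'p := site_i'p site.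
Let i'q := site_i'q site.
Let i'E := site_i'E site.
Let p'q := site_p'q site.

Let col_q : col q = ~~ col p. Proof. by rewrite -ip col_i. Qed.
Let col_q' : col q' = col p. Proof. by rewrite -ip' col_i col_p' negbK. Qed.
Let i'p' : i' p' = p. Proof. by rewrite -i'p i'K. Qed.
Let i'q' : i' q' = q. Proof. by rewrite -i'q i'K. Qed.
Let iq : i q = p. Proof. by rewrite -ip iK. Qed.
Let iq' : i q' = p'. Proof. by rewrite -ip' iK. Qed.

Lemma saddle_col x : col (i' x) = ~~ col x.
Proof.
have [|/i'E->//] := boolP (x \in [:: p; q; p'; q']).
rewrite !inE => /or4P[]/eqP->;
  by rewrite ?i'p ?i'q ?i'p' ?i'q' ?col_p' ?col_q ?col_q' ?negbK.
Qed.

(** On the points of the colour of [p], the saddle multiplies the cycle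
    permutation of the circles by the transposition of [p] and [q'], so exactly
    one of the two configurations has [p] and [q'] on a common circle. *)
Lemma saddle_dichotomy : same_circle o i p p' = ~~ same_circle o i' p q.
Proof.
have pq' : p != q' by apply: contra p'q => /eqP pq'; rewrite -ip pq' iq'.
have s1 : same_circle o i p p' = same_circle o i p q'.
  apply/idP/idP => h; apply: (same_circle_trans h).
    by rewrite -ip' same_circle_i.
  by rewrite -iq' same_circle_i.
have s2 : same_circle o i' p q = same_circle o i' p q'.
  apply/idP/idP => h; apply: (same_circle_trans h).
    by rewrite -i'q same_circle_i.
  by rewrite -i'q' same_circle_i.
rewrite s1 s2 (same_circle_porbit oK iK col_o col_i erefl col_q').
rewrite (same_circle_porbit oK i'K col_o saddle_col erefl col_q').
rewrite (tperm_porbit_xor _ pq'); congr (~~ (_ \in porbit _ _)).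
apply/permP => x; rewrite permM !permE /double_step /=.
have [->|xp] := eqVneq x p; first by rewrite col_q' eqxx iq' i'p.
have [->|xq'] := eqVneq x q'; first by rewrite col_q' eqxx ip i'q'.
case: eqP => // xc; rewrite i'E // !inE (negPf xp) (negPf xq') orbF /=.
rewrite negb_or; apply/andP; split; apply: contra_eq_neq xc => ->;
  by rewrite ?col_q ?col_p'; case: (col p).
Qed.

Let sc := same_circle o i.
Let sc' := same_circle o i'.

(** Joining the ends of the saddle before or after the surgery generates the
    same equivalence relation, the connectedness in the saddle cobordism. *)
Lemma saddle_join x y :
  [|| sc x y, sc x p && sc p' y | sc x p' && sc p y] =
  [|| sc' x y, sc' x p && sc' q y | sc' x q && sc' p y].
Proof.
(* The relation that [R] and the pair (u, v) generate. *)
have gen (R : rel T) u v : reflexive R -> symmetric R -> transitive R ->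
    let J := fun x y => [|| R x y, R x u && R v y | R x v && R u y] in
    [/\ reflexive J, transitive J, subrel R J & J u v].
  move=> Rr Rs Rt J; split.
  - by move=> z; rewrite /J Rr.
  - move=> b a d; rewrite /J => /or3P[ab|/andP[au vb]|/andP[av ub]]
      /or3P[bd|/andP[bu vd]|/andP[bv ud]].
    + by rewrite (Rt _ _ _ ab bd).
    + by rewrite (Rt _ _ _ ab bu) vd orbT.
    + by rewrite (Rt _ _ _ ab bv) ud !orbT.
    + by rewrite au (Rt _ _ _ vb bd) orbT.
    + by rewrite au vd orbT.
    + by rewrite (Rt _ _ _ au ud).
    + by rewrite av (Rt _ _ _ ub bd) !orbT.
    + by rewrite (Rt _ _ _ av vd).
    + by rewrite av ud !orbT.
  - by move=> a b ab; rewrite /J ab.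
  - by rewrite /J !Rr orbT.
have scs : symmetric sc := same_circle_sym oK iK; have sct : transitive sc := @same_circle_trans T o i.
have scs' : symmetric sc' := same_circle_sym oK i'K; have sct' : transitive sc' := @same_circle_trans T o i'.
have [Jr Jt J1 Jp] := gen sc p p' (same_circle_refl o i) scs sct.
have [Jr' Jt' J1' Jq] := gen sc' p q (same_circle_refl o i') scs' sct'.
set J := (fun x y => _) in Jr Jt J1 Jp; set J' := (fun x y => _) in Jr' Jt' J1' Jq.
have Js : symmetric J.
  move=> a b; rewrite /J (scs a b) (scs a p) (scs p' b) (scs a p').
  by rewrite (scs p b) (andbC (sc p a)) (andbC (sc p' a)) (orbC (_ && _)).
have Js' : symmetric J'.
  move=> a b; rewrite /J' (scs' a b) (scs' a p) (scs' q b) (scs' a q).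
  by rewrite (scs' p b) (andbC (sc' p a)) (andbC (sc' q a)) (orbC (_ && _)).
have sub' a b : sc' a b -> J a b.
  apply: same_circle_sub => // z; rewrite (J1 _ _ (same_circle_o _ _ _)) /=.
  have [|/i'E->] := boolP (z \in [:: p; q; p'; q']); last exact: J1 (same_circle_i _ _ _).
  have Jqq' : J q q'.
    apply: (Jt p'); first by apply: (Jt p) => //; apply: J1; rewrite -[X in sc _ X]iq; exact: same_circle_i.
    by apply: J1; rewrite -ip'; exact: same_circle_i.
  by rewrite !inE => /or4P[]/eqP->; rewrite ?i'p ?i'q ?i'p' ?i'q' ?Jqq' // Js.
have sub a b : sc a b -> J' a b.
  apply: same_circle_sub => // z; rewrite (J1' _ _ (same_circle_o _ _ _)) /=.
  have [|/i'E<-] := boolP (z \in [:: p; q; p'; q']); last exact: J1' (same_circle_i _ _ _).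
  have Jpq : J' p' q'.
    apply: (Jt' q); last by apply: J1'; rewrite -i'q; exact: same_circle_i.
    by apply: (Jt' p) => //; apply: J1'; rewrite -[X in sc' _ X]i'p'; exact: same_circle_i.
  by rewrite !inE => /or4P[]/eqP->; rewrite ?ip ?iq ?ip' ?iq' ?Jpq // Js'.
have Jpq : J p q by apply: J1; rewrite -ip; exact: same_circle_i.
have Jpp : J' p p' by apply: J1'; rewrite -i'p; exact: same_circle_i.
apply/idP/idP.
  case/or3P => [/sub//|/andP[/sub h1 /sub h2]|/andP[/sub h1 /sub h2]].
    by apply: (Jt' _ _ _ h1); apply: (Jt' _ _ _ Jpp).
  by apply: (Jt' _ _ _ h1); apply: Jt' h2; rewrite Js'.
case/or3P => [/sub'//|/andP[/sub' h1 /sub' h2]|/andP[/sub' h1 /sub' h2]].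
  by apply: (Jt _ _ _ h1); apply: (Jt _ _ _ Jpq).
by apply: (Jt _ _ _ h1); apply: Jt h2; rewrite Js.
Qed.

Lemma saddle_merge : ~~ sc p p' ->
  forall x y, sc' x y = [|| sc x y, sc x p && sc p' y | sc x p' && sc p y].
Proof.
rewrite /sc saddle_dichotomy negbK => pq x y; rewrite saddle_join.
apply/idP/or3P => [xy|]; first by constructor.
have scs' : symmetric sc' := same_circle_sym oK i'K.
case=> [//|/andP[xp qy]|/andP[xq py]].
  exact: (same_circle_trans xp (same_circle_trans pq qy)).
by apply: (same_circle_trans xq (same_circle_trans _ py)); exact: etrans (scs' _ _) pq.
Qed.

Lemma saddle_split : sc p p' ->
  forall x y, sc x y = [|| sc' x y, sc' x p && sc' q y | sc' x q && sc' p y].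
Proof.
move=> pp x y; rewrite -saddle_join.
have scs : symmetric sc := same_circle_sym oK iK.
apply/idP/or3P => [xy|]; first by constructor.
case=> [//|/andP[xp qy]|/andP[xq py]].
  exact: (same_circle_trans xp (same_circle_trans pp qy)).
by apply: (same_circle_trans xq (same_circle_trans _ py)); exact: etrans (scs _ _) pp.
Qed.

End Saddle.
(** * The deformed algebra X^2 = s^2 *)

Local Notation poly := {poly int}.

(** [dmul] and [dcomul] are the structure constants of the Frobenius algebra
    with X^2 = s^2, where s is the indeterminate of [{poly int}]; at s = 0 they
    are those of [frob_mul] and [frob_comul]. *)
Definition dmul (u v w : bool) : poly :=
  if u && v then (if w then 0 else 'X ^+ 2) else (w == u || v)%:R.

Definition dcomul (u v w : bool) : poly :=
  if u then (if v == w then (if v then 1 else 'X ^+ 2) else 0) else (v (+) w)%:R.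

Definition sroot (b : bool) : poly := if b then - 'X else 'X.

(** The value of 1 (for [u = false]) or X (for [u = true]) at the root - s (for
    [b = true]) or s (for [b = false]) of X^2 - s^2. *)
Definition wt (u b : bool) : poly := if u then sroot b else 1.

(** Evaluation at a root is multiplicative. *)
Lemma dmul_wt u v b : \sum_w dmul u v w * wt w b = wt u b * wt v b.
Proof.
rewrite big_bool /dmul /wt /sroot; case: u; case: v; case: b => /=; ring.
Qed.

(** Comultiplication followed by multiplication is multiplication by 2 X.  At two
    different roots the value of X (x) 1 + 1 (x) X is s + (- s) = 0. *)
Lemma dcomul_wt u b b' :
  \sum_v \sum_w dcomul u v w * (wt v b * wt w b') =
  (if b == b' then 2%:R * sroot b else 0) * wt u b.
Proof.
rewrite !big_bool /dcomul /wt /sroot; case: u; case: b; case: b' => /=; ring.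
Qed.

Section Labellings.
Variables (T : finType) (o i : T -> T).
Hypotheses (oK : involutive o) (iK : involutive i).
Implicit Types l : {ffun T -> bool}.

Lemma is_labellingP l :
  reflect (forall x y, same_circle o i x y -> l x = l y) (is_labelling o i l).
Proof.
apply: (iffP idP) => [lab x y xy|cst].
  by rewrite (labelling_circle lab xy).
apply/forallP => x; rewrite -(cst x (o x)) ?same_circle_o //.
by rewrite -(cst x (i x)) ?same_circle_i // eqxx.
Qed.

(** The value of the tensor [l] at the choice [sg] of a root on each circle. *)
Definition ev l sg : poly :=
  \prod_(C in circles o i) wt (labelled_X l C) (labelled_X sg C).

End Labellings.

Section DeformedSaddle.
Variable T : finType.
Implicit Types (o i : T -> T) (l : {ffun T -> bool}).

Definition dsaddle_coef o i i' (p p' q : T) l l' : poly :=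
  if [&& is_labelling o i' l' &
      [forall x, (same_circle o i p x || same_circle o i p' x)
                 || (l' x == l x)]]
  then if same_circle o i p p' then dcomul (l p) (l' p) (l' q)
       else dmul (l p) (l p') (l' p)
  else 0.

Definition dchain := {ffun {ffun T -> bool} -> poly}.

Definition dsaddle o i i' (p p' q : T) (f : dchain) : dchain :=
  [ffun l' => \sum_l f l * dsaddle_coef o i i' p p' q l l'].

Lemma dsaddle_coef0 o i i' p p' q l l' :
  (dsaddle_coef o i i' p p' q l l').[0] = (saddle_coef o i i' p p' q l l')%:~R.
Proof.
rewrite /dsaddle_coef /saddle_coef; case: ifP => _; last by rewrite horner0.
case: ifP => _.
  rewrite /dcomul /frob_comul; case: (l p); case: (l' p); case: (l' q) => //=;
  by rewrite ?hornerE ?expr0n.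
rewrite /dmul /frob_mul; case: (l p); case: (l p'); case: (l' p) => //=;
by rewrite ?hornerE ?expr0n.
Qed.

End DeformedSaddle.

Definition chain_ev (T : finType) (o i : T -> T) (f : dchain T) sg : poly :=
  \sum_l f l * ev o i l sg.

Section SaddleEv.
Variables (T : finType) (o i i' : T -> T) (col : T -> bool) (p p' q q' : T).
Hypothesis site : saddle_site o i i' col p p' q q'.
Implicit Types l : {ffun T -> bool}.
Let sc := same_circle o i.
Let sc' := same_circle o i'.
Let oK := site_oK site.
Let iK := site_iK site.
Let i'K := site_iK' site.
Let scr : reflexive sc := same_circle_refl o i.
Let scr' : reflexive sc' := same_circle_refl o i'.
Let scs : symmetric sc := same_circle_sym oK iK.
Let scs' : symmetric sc' := same_circle_sym oK i'K.
Let sct : transitive sc := @same_circle_trans T o i.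
Let sct' : transitive sc' := @same_circle_trans T o i'.

Let rest (l sg : {ffun T -> bool}) :=
  \prod_(C in circles o i | (p \notin C) && (p' \notin C))
     wt (labelled_X l C) (labelled_X sg C).

Lemma rest_eq l l' sg :
  (forall x, (sc p x || sc p' x) || (l' x == l x)) -> rest l' sg = rest l sg.
Proof.
move=> E; apply: eq_bigr => _ /andP[/circlesP[x ->]].
rewrite !mem_circle => /andP[xp xp']; congr (wt _ _).
apply: eq_existsb => y; rewrite mem_circle; apply: andb_id2l => xy.
have := E y; case/orP => [/orP[]py|/eqP->//].
  by rewrite (same_circle_trans xy) // -/sc scs in xp.
by rewrite (same_circle_trans xy) // -/sc scs in xp'.
Qed.

Section MergeCase.
Hypothesis npp' : ~~ sc p p'.
Let sc'E := saddle_merge site npp'.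

Lemma merge_circle_p x : sc' p x = sc p x || sc p' x.
Proof. by rewrite /sc' sc'E -/sc scr (negPf npp') orbF. Qed.

Lemma merge_labelling l : is_labelling o i' l -> is_labelling o i l.
Proof.
move=> /is_labellingP lab; apply/is_labellingP => x y xy; apply: lab.
by rewrite sc'E xy.
Qed.

Let put l w : {ffun T -> bool} := [ffun x => if sc p x || sc p' x then w else l x].

Lemma put_labelling l w : is_labelling o i l -> is_labelling o i' (put l w).
Proof.
move=> /is_labellingP lab; apply/is_labellingP => x y xy; rewrite !ffunE.
rewrite -!merge_circle_p.
have -> : sc' p x = sc' p y.
  by apply/idP/idP => h; apply: (sct' h) => //; rewrite scs'.
case: ifP => // py; apply: lab; move: xy; rewrite sc'E -/sc => /or3P[//||].
  by case/andP => _ py'; rewrite merge_circle_p py' orbT in py.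
by case/andP => _ py'; rewrite merge_circle_p py' in py.
Qed.

(** On labellings that agree away from the saddle, only the factor of the merged
    circle varies, and [dmul_wt] applies to it. *)
Lemma merge_ev l sg : is_labelling o i l -> is_labelling o i' sg ->
  \sum_l' dsaddle_coef o i i' p p' q l l' * ev o i' l' sg = ev o i l sg.
Proof.
move=> lab slab'; have slab := merge_labelling slab'.
have sgp' : sg p' = sg p.
  by rewrite -(site_i'p site); have /forallP/(_ p)/andP[_ /eqP] := slab'.
pose cond (l' : {ffun T -> bool}) := is_labelling o i' l' &&
      [forall x, (sc p x || sc p' x) || (l' x == l x)].
transitivity (\sum_(l' | cond l') dmul (l p) (l p') (l' p) *
                 (wt (l' p) (sg p) * rest l sg)).
  rewrite [RHS]big_mkcond; apply: eq_bigr => l' _.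
  rewrite /dsaddle_coef -/(cond l') -/sc (negPf npp').
  case: ifP => [/andP[lab' /forallP E]|_]; last by rewrite mul0r.
  rewrite /ev /circles (big_merged_classes scr scs sct npp' sc'E) -/(rest _ _).
  by rewrite (rest_eq _ E) !labelled_X_circle.
rewrite (reindex_onto (put l) (fun l' => l' p)) /=; last first.
  move=> l' /andP[/is_labellingP lab' /forallP E]; apply/ffunP => x; rewrite ffunE.
  rewrite -merge_circle_p; case: ifP => [/lab'//|px].
  by have := E x; rewrite -merge_circle_p px => /eqP.
have putp w : put l w p = w by rewrite ffunE scr.
transitivity (\sum_w dmul (l p) (l p') w * wt w (sg p) * rest l sg).
  apply: eq_big => [w|w _]; rewrite putp ?mulrA // eqxx andbT.
  rewrite /cond put_labelling //; apply/forallP => x; rewrite ffunE.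
  by case: ifP; rewrite ?eqxx.
rewrite -big_distrl /= dmul_wt /ev /circles (big_split_classes scr scs sct npp').
by rewrite -mulrA !labelled_X_circle // sgp'.
Qed.

End MergeCase.

Section SplitCase.
Hypothesis pp' : sc p p'.
Let scE := saddle_split site pp'.

Lemma split_npq : ~~ sc' p q.
Proof. by rewrite /sc' -(saddle_dichotomy site). Qed.
Let npq := split_npq.

Let srest (l sg : {ffun T -> bool}) :=
  \prod_(C in circles o i' | (p \notin C) && (q \notin C))
     wt (labelled_X l C) (labelled_X sg C).

Lemma split_circle_p x : sc p x = sc' p x || sc' q x.
Proof. by rewrite /sc scE -/sc' scr' (negPf npq) orbF. Qed.

Lemma split_circle_p' x : sc p' x = sc p x.
Proof. by apply/idP/idP => h; apply: (sct _ h); rewrite // scs. Qed.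

Lemma srest_eq l l' sg :
  (forall x, (sc p x || sc p' x) || (l' x == l x)) -> srest l' sg = srest l sg.
Proof.
move=> E; apply: eq_bigr => _ /andP[/circlesP[x ->]].
rewrite !mem_circle => /andP[xp xq]; congr (wt _ _).
apply: eq_existsb => y; rewrite mem_circle; apply: andb_id2l => xy.
have := E y; rewrite split_circle_p' orbb split_circle_p => /orP[/orP[]py|/eqP->//].
  by rewrite (same_circle_trans xy) // -/sc' scs' in xp.
by rewrite (same_circle_trans xy) // -/sc' scs' in xq.
Qed.

Lemma split_labelling l : is_labelling o i' l -> l p = l q -> is_labelling o i l.
Proof.
move=> /is_labellingP lab lpq; apply/is_labellingP => x y.
rewrite scE => /or3P[/lab//|/andP[/lab-> /lab<-]//|/andP[/lab-> /lab<-]//].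
Qed.

Let put l (vw : bool * bool) : {ffun T -> bool} :=
  [ffun x => if sc' p x then vw.1 else if sc' q x then vw.2 else l x].

Lemma split_put_labelling l vw : is_labelling o i l -> is_labelling o i' (put l vw).
Proof.
move=> /is_labellingP lab; apply/is_labellingP => x y xy; rewrite !ffunE.
have E r : sc' r x = sc' r y.
  by apply/idP/idP => h; apply: (sct' h) => //; rewrite scs'.
by rewrite !E (lab x y) // scE xy.
Qed.

Lemma split_ev l sg : is_labelling o i l -> is_labelling o i' sg ->
  \sum_l' dsaddle_coef o i i' p p' q l l' * ev o i' l' sg =
  (if sg p == sg q then 2%:R * sroot (sg p) else 0) * ev o i l sg.
Proof.
move=> lab slab'.
pose cond (l' : {ffun T -> bool}) := is_labelling o i' l' &&
      [forall x, (sc p x || sc p' x) || (l' x == l x)].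
transitivity (\sum_(l' | cond l') dcomul (l p) (l' p) (l' q) *
                 (wt (l' p) (sg p) * (wt (l' q) (sg q) * srest l sg))).
  rewrite [RHS]big_mkcond; apply: eq_bigr => l' _.
  rewrite /dsaddle_coef -/(cond l') -/sc pp'.
  case: ifP => [/andP[lab' /forallP E]|_]; last by rewrite mul0r.
  rewrite /ev /circles (big_split_classes scr' scs' sct' npq) -/(srest _ _).
  by rewrite (srest_eq _ E) !labelled_X_circle.
have putp vw : put l vw p = vw.1 by rewrite ffunE scr'.
have putq vw : put l vw q = vw.2 by rewrite ffunE (negPf npq) scr'.
rewrite (reindex_onto (put l) (fun l' => (l' p, l' q))) /=; last first.
  move=> l' /andP[/is_labellingP lab' /forallP E]; apply/ffunP => x; rewrite ffunE /=.
  case: ifP => [/lab'//|px]; case: ifP => [/lab'//|qx].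
  by have := E x; rewrite split_circle_p' orbb split_circle_p px qx => /eqP.
transitivity (\sum_vw dcomul (l p) vw.1 vw.2 * (wt vw.1 (sg p) * wt vw.2 (sg q))
                * srest l sg).
  apply: eq_big => [vw|vw _]; rewrite putp putq ?mulrA // -surjective_pairing eqxx andbT.
  rewrite /cond split_put_labelling //; apply/forallP => x; rewrite ffunE.
  rewrite split_circle_p' orbb split_circle_p; case: ifP => //= _.
  by case: ifP; rewrite ?eqxx.
rewrite -big_distrl /= -(pair_bigA _ (fun v w => dcomul (l p) v w *
  (wt v (sg p) * wt w (sg q)))) /= dcomul_wt.
case: eqP => [spq|_]; last by rewrite !mul0r.
have slab := split_labelling slab' spq.
rewrite /ev /circles (big_merged_classes scr' scs' sct' npq scE).
by rewrite /= !labelled_X_circle // !mulrA.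
Qed.

End SplitCase.

(** In the coordinates given by evaluation every saddle is a scalar. *)
Lemma saddle_ev (f : dchain T) sg :
  (forall l, f l != 0 -> is_labelling o i l) -> is_labelling o i' sg ->
  chain_ev o i' (dsaddle o i i' p p' q f) sg =
  (if ~~ sc p p' then 1 else if sg p == sg q then 2%:R * sroot (sg p) else 0)
  * chain_ev o i f sg.
Proof.
move=> flab slab'; rewrite /chain_ev mulr_sumr.
under eq_bigr => l' _ do rewrite ffunE mulr_suml.
rewrite exchange_big /=; apply: eq_bigr => l _.
have [->|fl] := eqVneq (f l) 0.
  by rewrite !(mul0r, mulr0); apply: big1 => l' _; rewrite !mul0r.
under eq_bigr => l' _ do rewrite -mulrA.
rewrite -mulr_sumr mulrCA; congr (_ * _).
have [pp'|npp'] := boolP (sc p p') => /=; first exact: split_ev (flab _ fl) _.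
by rewrite mul1r merge_ev // flab.
Qed.

Lemma dsaddle_labelling (f : dchain T) l' :
  dsaddle o i i' p p' q f l' != 0 -> is_labelling o i' l'.
Proof.
rewrite ffunE; apply: contraNT => nlab; rewrite big1 // => l _.
by rewrite /dsaddle_coef (negPf nlab) mulr0.
Qed.

End SaddleEv.

Definition circle_count (T : finType) (o i : T -> T) (sg : {ffun T -> bool}) b : nat :=
  \sum_(C in circles o i) (labelled_X sg C == b).

Section SaddleCount.
Variables (T : finType) (o i i' : T -> T) (col : T -> bool) (p p' q q' : T).
Hypothesis site : saddle_site o i i' col p p' q q'.

(** A merging of circles with value [b] removes one of them and a splitting adds
    one, so the circles before and after determine which case occurs. *)
Lemma saddle_count sg b : is_labelling o i sg -> is_labelling o i' sg ->
  ((same_circle o i p p' && (sg p == b)).*2 + circle_count o i sg b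
   = (sg p == b) + circle_count o i' sg b)%N.
Proof.
move=> slab slab'; have [iK i'K oK] := And3 (site_iK site) (site_iK' site) (site_oK site).
have sgp' : sg p' = sg p.
  by rewrite -(site_i'p site); have /forallP/(_ p)/andP[_ /eqP] := slab'.
have sgq : sg q = sg p.
  by rewrite -(site_ip site); have /forallP/(_ p)/andP[_ /eqP] := slab.
have r := same_circle_refl o; have s := same_circle_sym oK iK.
have s' := same_circle_sym oK i'K; have t := @same_circle_trans T o.
rewrite /circle_count /circles; have [pp'|npp'] := boolP (same_circle o i p p').
  have npq := split_npq site pp'.
  rewrite (big_split_classes (r i') s' (@t i') npq).
  rewrite (big_merged_classes (r i') s' (@t i') npq (saddle_split site pp')) /=.
  rewrite !labelled_X_circle // sgq; lia.
rewrite (big_split_classes (r i) s (@t i) npp').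
rewrite (big_merged_classes (r i) s (@t i) npp' (saddle_merge site npp')) /=.
rewrite !labelled_X_circle // sgp'; lia.
Qed.

End SaddleCount.
(** * Contracting a matching *)

(** [m] orders the points; the involution exchanges the points that are smaller
    than their image with the others. *)
Lemma card_involution (T : finType) (f : T -> T) (m : T -> nat) (S : {set T}) :
  injective m -> involutive f -> (forall x, f x != x) ->
  (forall x, x \in S -> f x \in S) -> ~~ odd #|S|.
Proof.
move=> mi fK fN fS; rewrite -(cardsID [set x | (m x < m (f x))%N] S).
have -> : S :\: [set x | (m x < m (f x))%N] = f @: (S :&: [set x | (m x < m (f x))%N]).
  apply/setP => x; rewrite !inE; apply/andP/imsetP => [[nx xS]|[y + ->]].
    exists (f x); rewrite ?fK // !inE fS // fK.
    by rewrite ltn_neqAle leqNgt nx andbT; apply: contra (fN x) => /eqP/mi->.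
  by rewrite !inE fK -leqNgt => /andP[/fS-> /ltnW->].
by rewrite card_imset ?addnn ?odd_double //; apply: can_inj fK.
Qed.

Lemma card_between (m x z : nat) : (z <= m)%N ->
  #|[set y : 'I_m | x < y < z]%N| = (z - x.+1)%N.
Proof.
move=> zm; rewrite cardE -(size_map val) -[RHS](size_iota x.+1); apply: perm_size.
apply: uniq_perm; [by rewrite map_inj_uniq ?enum_uniq //; exact: val_inj
                  | exact: iota_uniq | move=> y].
rewrite mem_iota; apply/mapP/idP => [[w]|yP].
  by rewrite mem_enum inE => /andP[h1 h2] -> /=; lia.
have ym : (y < m)%N by lia.
by exists (Ordinal ym); rewrite // mem_enum inE /=; lia.
Qed.

Section Parity.
Variable n : nat.
Implicit Types (a : pmatching n) (x y : 'I_n.*2).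

Lemma pm_crossingless a x y :
  ~~ [&& (x < y)%N, (y < pm_arc a x)%N & (pm_arc a x < pm_arc a y)%N].
Proof.
by have /andP[/andP[_ /forallP/(_ x)/forallP/(_ y)]] := valP a.
Qed.

Lemma pm_arc_inj a : injective (pm_arc a).
Proof. exact: can_inj (pm_arcK a). Qed.

Lemma pm_arc_between a x y :
  (x < y < pm_arc a x)%N -> (x < pm_arc a y < pm_arc a x)%N.
Proof.
case/andP => xy yx.
have N : nat_of_ord (pm_arc a y) <> pm_arc a x.
  by move/val_inj/pm_arc_inj => E; rewrite E ltnn in xy.
have N' : nat_of_ord (pm_arc a y) <> x.
  by move/val_inj => E; rewrite -E pm_arcK ltnn in yx.
have := pm_crossingless a x y; have := pm_crossingless a (pm_arc a y) x.
rewrite pm_arcK; lia.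
Qed.

(** The points under an arc of a crossingless matching are matched among
    themselves, so there is an even number of them. *)
Lemma pm_arc_parity a x : odd (pm_arc a x) = ~~ odd x.
Proof.
wlog xa : x / (x < pm_arc a x)%N => [W|].
  have := pm_arc_neq a x; rewrite -val_eqE neq_ltn => /orP[lt|]; last exact: W.
  by have := W (pm_arc a x); rewrite pm_arcK => /(_ lt) ->; rewrite negbK.
have := @card_involution _ (pm_arc a) val [set y : 'I_n.*2 | x < y < pm_arc a x]%N
  val_inj (pm_arcK a) (pm_arc_neq a).
rewrite card_between ?(ltnW (ltn_ord _)) // => E.
suff: ~~ odd (pm_arc a x - x.+1) by lia.
by apply: E => y; rewrite !inE => /pm_arc_between.
Qed.

End Parity.

Section Cobordism.
Variables (n : nat) (b a c : pmatching n).
Local Notation point := (bool * 'I_n.*2)%type.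
Implicit Types (D : {set 'I_n.*2}) (z : point).

Let oa := outer_arc b c.
Let ia := inner_arc a.
Let col z := z.1 (+) odd z.2.

(** [D] is a union of arcs of [a], as it is at every stage of the contraction. *)
Definition stable D := forall y, (pm_arc a y \in D) = (y \in D).

Lemma outer_arcK : involutive oa.
Proof. by case=> [[] x]; rewrite /oa /outer_arc /= pm_arcK. Qed.

Lemma inner_arcK D : stable D -> involutive (ia D).
Proof.
move=> stD [e x]; rewrite /ia /inner_arc /=; have [xD|xD] := boolP (x \in D).
  by rewrite /= xD negbK.
by rewrite /= stD (negPf xD) pm_arcK.
Qed.

Lemma stable_contract D x : stable D -> stable (D :|: [set x; pm_arc a x]).
Proof.
move=> stD y; rewrite !inE stD (inj_eq (@pm_arc_inj _ a)).
by rewrite -{1}[x](pm_arcK a) (inj_eq (@pm_arc_inj _ a)) (orbC (y == _)).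
Qed.

Lemma stable0 : stable set0. Proof. by move=> y; rewrite !inE. Qed.
(** The points are coloured by the parity of their position plus the line on
    which they lie: then the arcs of the matchings, which join different parities
    on one line, and the vertical arcs all change the colour. *)
Lemma contract_site D x : stable D -> x \notin D ->
  saddle_site oa (ia D) (ia (D :|: [set x; pm_arc a x])) col
    (false, x) (true, x) (false, pm_arc a x) (true, pm_arc a x).
Proof.
move=> stD xD; have stD' := stable_contract x stD; split.
- exact: outer_arcK.
- exact: inner_arcK.
- exact: inner_arcK.
- by case=> [[] y]; rewrite /oa /outer_arc /col /= pm_arc_parity //= ?negbK.
- case=> [e y]; rewrite /ia /inner_arc /col /=; case: ifP => _ /=.
    by rewrite addNb.
  by rewrite pm_arc_parity addbN.
- by [].
- by rewrite /ia /inner_arc /= (negPf xD).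
- by rewrite /ia /inner_arc /= (negPf xD).
- by rewrite /ia /inner_arc /= !inE eqxx orbT.
- by rewrite /ia /inner_arc /= !inE eqxx !orbT.
- case=> e y yP; rewrite /ia /inner_arc /= !inE.
  have -> : (y == x) = false.
    by apply: contraNF yP => /eqP ->; rewrite !inE; case: e; rewrite eqxx ?orbT.
  have -> : (y == pm_arc a x) = false; last by rewrite !orbF.
  by apply: contraNF yP => /eqP ->; rewrite !inE; case: e; rewrite eqxx ?orbT.
- by [].
Qed.

(** Starting from [D], the list [s] contracts each remaining arc exactly once. *)
Fixpoint exhausts D (s : seq 'I_n.*2) : bool :=
  if s is x :: s' then (x \notin D) && exhausts (D :|: [set x; pm_arc a x]) s'
  else D == setT.

Lemma exhausts_mem D s : exhausts D s ->
  forall y, [|| y \in D, y \in s | pm_arc a y \in s].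
Proof.
elim: s D => [|x s IHs] D /=; first by move=> /eqP-> y; rewrite inE.
case/andP => _ /IHs h y; have := h y; rewrite !inE.
rewrite -[y == pm_arc a x](inj_eq (@pm_arc_inj _ a)) pm_arcK.
by case: (y \in D); case: (y == x); case: (pm_arc a y == x); rewrite ?orbT.
Qed.

Lemma mem_left_ends x : (x \in left_ends a) = (x < pm_arc a x)%N.
Proof. by rewrite mem_filter mem_enum andbT. Qed.

Lemma exhausts_left_ends : exhausts set0 (left_ends a).
Proof.
suff gen (s : seq 'I_n.*2) D : uniq s ->
    (forall x, x \in s -> (x < pm_arc a x)%N) ->
    (forall x, (x \in D) = (x \notin s) && (pm_arc a x \notin s)) -> exhausts D s.
  apply: gen; first by rewrite filter_uniq ?enum_uniq.
    by move=> x; rewrite mem_left_ends.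
  move=> x; rewrite !mem_left_ends pm_arcK !inE.
  by have := pm_arc_neq a x; rewrite -val_eqE /= => h; lia.
elim: s D => [|x s IHs] D /=.
  by move=> _ _ h; apply/eqP/setP => y; rewrite h !inE.
case/andP => xs us lt DE; rewrite DE inE eqxx /=; apply: IHs => //.
  by move=> y ys; apply: lt; rewrite inE ys orbT.
have axs : pm_arc a x \notin s.
  apply/negP => h; have := lt (pm_arc a x); rewrite inE h orbT pm_arcK => /(_ isT).
  by have := lt x (mem_head _ _); lia.
move=> y; rewrite !inE DE !inE.
rewrite -[y == pm_arc a x](inj_eq (@pm_arc_inj _ a)) pm_arcK.
have [->|_] /= := eqVneq y x; first by rewrite xs axs.
have [/esym E|_] /= := eqVneq (pm_arc a y) x; last by rewrite !orbF.
have yE : y = pm_arc a x by rewrite E pm_arcK.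
by rewrite orbT -E xs yE axs.
Qed.

Fixpoint dcontract D (s : seq 'I_n.*2) (f : dchain point) : dchain point :=
  if s is x :: s' then
    let D' := D :|: [set x; pm_arc a x] in
    dcontract D' s'
      (dsaddle oa (ia D) (ia D') (false, x) (true, x) (false, pm_arc a x) f)
  else f.

(** At s = 0 the deformed contraction is the one that defines the product. *)
Lemma dcontract0 D s (f : dchain point) (g : chain point) :
  (forall l, (f l).[0] = g l) ->
  forall l, (dcontract D s f l).[0] = contract b a c D s g l.
Proof.
elim: s D f g => //= x s IHs D f g fg; apply: IHs => l.
rewrite !ffunE horner_sum; apply: eq_bigr => l' _.
by rewrite hornerM fg dsaddle_coef0 intz.
Qed.

(** A choice of roots on the circles after all contractions is a choice of roots
    on the circles at stage [D] if it takes equal values at the two ends of each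
    arc that is still to be contracted. *)
Lemma inner_labelling D s (sg : {ffun point -> bool}) :
  exhausts D s -> is_labelling oa (ia setT) sg ->
  all (fun x => sg (false, x) == sg (false, pm_arc a x)) s ->
  is_labelling oa (ia D) sg.
Proof.
move=> ex slab sE; apply/forallP => -[e y].
have lay e' w : sg (e', w) = sg (false, w).
  case: e' => //; have /forallP/(_ (false, w))/andP[_ /eqP] := slab.
  by rewrite /ia /inner_arc /= inE.
have /forallP/(_ (e, y))/andP[-> _] := slab.
rewrite /ia /inner_arc /=; case: ifP => yD; first by rewrite !(lay _ y) eqxx.
rewrite !(lay e) /=.
have := exhausts_mem ex y; rewrite yD /= => /orP[] /(allP sE) //.
  by rewrite eq_sym.
by rewrite pm_arcK.
Qed.

(** The factor produced by [S v] splittings of circles with root [v]. *)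
Definition split_weight (S : bool -> nat) : poly :=
  \prod_(v : bool) (2%:R * sroot v) ^+ S v.

(** The contraction multiplies the value at [sg] by one factor 2 X for each
    splitting if [sg] descends to all intermediate stages; otherwise some
    splitting separates circles with different roots and the value is 0.  The
    numbers of splittings are pinned down by the numbers of circles. *)
Lemma dcontract_ev D s (f : dchain point) (sg : {ffun point -> bool}) :
  stable D -> exhausts D s -> (forall l, f l != 0 -> is_labelling oa (ia D) l) ->
  is_labelling oa (ia setT) sg ->
  exists S : bool -> nat,
    (all (fun x => sg (false, x) == sg (false, pm_arc a x)) s ->
     forall v, ((S v).*2 + circle_count oa (ia D) sg v =
        \sum_(x <- s) (sg (false, x) == v) + circle_count oa (ia setT) sg v)%N)
    /\ chain_ev oa (ia setT) (dcontract D s f) sg =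
       (if all (fun x => sg (false, x) == sg (false, pm_arc a x)) s
        then split_weight S else 0) * chain_ev oa (ia D) f sg.
Proof.
move=> + + + slab; elim: s D f => [|x s IHs] D f stD /=.
  move=> /eqP-> _; exists (fun=> 0%N); split=> [_ v|]; first by rewrite big_nil.
  by rewrite /split_weight big_bool /= !expr0 !mul1r.
case/andP => xD ex flab; have site := contract_site stD xD.
set D' := D :|: _ in site ex *; set F := dsaddle _ _ _ _ _ _ f.
have stD' : stable D' := stable_contract x stD.
have Flab l : F l != 0 -> is_labelling oa (ia D') l by exact: dsaddle_labelling.
have [S [SE SW]] := IHs D' F stD' ex Flab.
case sE : (all _ s) SE SW => SE SW; last first.
  exists S; rewrite andbF; split; first by case/negP.
  exact: etrans SW (etrans (mul0r _) (esym (mul0r _))).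
have slabD' := inner_labelling ex slab sE.
rewrite andbT SW (saddle_ev site flab slabD').
have cnt := saddle_count site; have merge := @merge_labelling _ _ _ _ _ _ _ _ _ site.
have lab := @split_labelling _ _ _ _ _ _ _ _ _ site.
case: ifP => [npp'|/negbFE pp'].
  have slabD := merge npp' _ slabD'.
  have E : sg (false, x) == sg (false, pm_arc a x).
    have /forallP/(_ (false, x))/andP[_ /eqP<-] := slabD.
    by rewrite /ia /inner_arc /= (negPf xD).
  exists S; split; last by rewrite E; congr (_ * _); exact: mul1r.
  move=> _ v; have := SE isT v; have := cnt _ v slabD slabD'.
  rewrite (negPf npp') /= big_cons.
  move: (circle_count _ _ _ _) (circle_count _ _ _ _) (circle_count _ _ _ _) => A B C.
  move: (\sum_(_ <- _) _)%N (S v) (sg _ == v) => U s' e; clear; lia.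
case: ifP => E; last first.
  by exists S; split; [by case/negP | rewrite (mul0r (chain_ev _ _ f _)); exact: mulr0].
have slabD := lab pp' _ slabD' (eqP E).
exists (fun v => S v + (sg (false, x) == v))%N; split=> [_ v|].
  have := SE isT v; have := cnt _ v slabD slabD'; rewrite pp' /= big_cons.
  move: (circle_count _ _ _ _) (circle_count _ _ _ _) (circle_count _ _ _ _) => A B C.
  move: (\sum_(_ <- _) _)%N (S v) (sg _ == v) => U s' e; clear; lia.
rewrite mulrA; congr (_ * _); rewrite /split_weight !big_bool /=.
case: (sg _); rewrite /= ?addn0 ?addn1 exprS; ring.
Qed.

End Cobordism.
(** * The two ends of the contraction cobordism *)

Lemma same_circleC (T : finType) (o i : T -> T) :
  same_circle o i =2 same_circle i o.
Proof. by apply: eq_connect => x y; rewrite /arc_rel orbC. Qed.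

Lemma is_labellingC (T : finType) (o i : T -> T) (l : {ffun T -> bool}) :
  is_labelling o i l = is_labelling i o l.
Proof. by apply: eq_forallb => x; rewrite andbC. Qed.

Section Ends.
Variables (n : nat) (b a c : pmatching n).
Local Notation point := (bool * 'I_n.*2)%type.
Let oa := outer_arc b c.
Let ia := inner_arc a.

Lemma same_circle_fin z z' :
  same_circle oa (ia setT) z z' = same_circle (pm_arc b) (pm_arc c) z.2 z'.2.
Proof.
apply/idP/idP.
  apply: (same_circle_sub (R := fun u v => same_circle (pm_arc b) (pm_arc c) u.2 v.2))
    => [x|y x w|[e x]]; first exact: same_circle_refl.
    exact: same_circle_trans.
  rewrite /oa /ia /outer_arc /inner_arc /= inE same_circle_refl andbT.
  by case: e; rewrite /= (same_circle_o, same_circle_i).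
have flip e x : same_circle oa (ia setT) (e, x) (~~ e, x).
  have -> : (~~ e, x) = ia setT (e, x) by rewrite /ia /inner_arc inE.
  exact: same_circle_i.
case: z z' => [e x] [e' y] /= xy.
apply: (same_circle_trans (y := (false, x))).
  by case: e; [exact: flip | exact: same_circle_refl].
apply: (same_circle_trans (y := (false, y))); last first.
  by case: e'; [exact: flip | exact: same_circle_refl].
move: xy.
apply: (same_circle_sub (R := fun u v => same_circle oa (ia setT) (false, u) (false, v)))
  => [u|u v w|u]; first exact: same_circle_refl.
  exact: same_circle_trans.
apply/andP; split; first exact: (same_circle_o oa _ (false, u)).
apply: (same_circle_trans (flip false u)).
apply: (same_circle_trans (y := (true, pm_arc c u))); last exact: flip.
exact: (same_circle_o oa _ (true, u)).
Qed.

Lemma same_circle_init z z' :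
  same_circle oa (ia set0) z z' =
  (z.1 == z'.1) && same_circle (if z.1 then pm_arc c else pm_arc b) (pm_arc a) z.2 z'.2.
Proof.
apply/idP/idP.
  apply: (same_circle_sub (R := fun z z' => (z.1 == z'.1) &&
    same_circle (if z.1 then pm_arc c else pm_arc b) (pm_arc a) z.2 z'.2))
    => [x|y x w|[e x]].
  - by rewrite eqxx same_circle_refl.
  - by move=> /andP[/eqP-> h] /andP[-> ]; apply: same_circle_trans.
  - rewrite /oa /ia /outer_arc /inner_arc /= inE /=.
    by case: e => /=; rewrite same_circle_i same_circle_o.
case: z z' => [e x] [e' y] /= /andP[/eqP <- {e'}].
apply: (same_circle_sub (R := fun u v => same_circle oa (ia set0) (e, u) (e, v)))
  => [u|u v w|u]; first exact: same_circle_refl.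
  exact: same_circle_trans.
apply/andP; split.
  have -> : (e, (if e then pm_arc c else pm_arc b) u) = oa (e, u).
    by rewrite /oa /outer_arc; case: e.
  exact: same_circle_o.
have -> : (e, pm_arc a u) = ia set0 (e, u) by rewrite /ia /inner_arc inE.
exact: same_circle_i.
Qed.

Section Big.
Variables (M : Type) (idx : M) (op : Monoid.com_law idx) (h : {set point} -> M).

(** After all contractions the circles are those of W(b)c, each doubled on the
    two lines. *)
Lemma big_circles_fin :
  \big[op/idx]_(C in circles oa (ia setT)) h C =
  \big[op/idx]_(C in circles (pm_arc b) (pm_arc c)) h (snd @^-1: C).
Proof.
have -> : circles oa (ia setT) =
    [set snd @^-1: C | C : {set 'I_n.*2} in circles (pm_arc b) (pm_arc c)].
  apply/setP => C; apply/circlesP/imsetP => [[z ->]|[_ /circlesP[x ->] ->]].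
    exists (circle (pm_arc b) (pm_arc c) z.2); first exact: mem_circles.
    by apply/setP => w; rewrite mem_circle inE mem_circle same_circle_fin.
  by exists (false, x); apply/setP => w; rewrite mem_circle inE mem_circle same_circle_fin.
rewrite big_imset //= => C C' _ _ /setP E; apply/setP => x.
by have := E (false, x); rewrite !inE.
Qed.

(** Before the contractions the circles are those of W(b)a on one line and those
    of W(a)c on the other. *)
Lemma big_circles_init :
  \big[op/idx]_(C in circles oa (ia set0)) h C =
  op (\big[op/idx]_(C in circles (pm_arc b) (pm_arc a)) h (pair false @: C))
     (\big[op/idx]_(C in circles (pm_arc a) (pm_arc c)) h (pair true @: C)).
Proof.
have mem_pair e e' x (C : {set 'I_n.*2}) :
    ((e', x) \in pair e @: C) = (e == e') && (x \in C).
  apply/imsetP/andP => [[y yC [-> ->]]|[/eqP<- xC]]; first by rewrite eqxx.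
  by exists x.
have -> : circles oa (ia set0) =
    [set pair false @: C | C : {set 'I_n.*2} in circles (pm_arc b) (pm_arc a)] :|:
    [set pair true @: C | C : {set 'I_n.*2} in circles (pm_arc a) (pm_arc c)].
  apply/setP => C; rewrite in_setU; apply/circlesP/orP.
    case=> -[[] x] ->; [right|left]; apply/imsetP.
      exists (circle (pm_arc a) (pm_arc c) x); first exact: mem_circles.
      apply/setP => -[e y]; rewrite mem_pair !mem_circle same_circle_init /=.
      by rewrite same_circleC.
    exists (circle (pm_arc b) (pm_arc a) x); first exact: mem_circles.
    by apply/setP => -[e y]; rewrite mem_pair !mem_circle same_circle_init /=.
  case=> /imsetP[_ /circlesP[x ->] ->].
    exists (false, x); apply/setP => -[e y].
    by rewrite mem_pair !mem_circle same_circle_init /=.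
  exists (true, x); apply/setP => -[e y].
  by rewrite mem_pair !mem_circle same_circle_init /= same_circleC.
set A := [set pair false @: C | C : {set _} in _].
set B := [set pair true @: C | C : {set _} in _].
rewrite (eq_bigl [predU A & B]) => [|C]; last by rewrite !inE.
rewrite bigU /=; last first.
  rewrite disjoints_subset; apply/subsetP => C /imsetP[_ /circlesP[x ->] ->].
  rewrite inE; apply/imsetP => -[C' _ /setP/(_ (false, x))].
  by rewrite !mem_pair mem_circle same_circle_refl.
congr (op _ _); rewrite big_imset //= => C C' _ _ /setP E; apply/setP => x.
  by have := E (false, x); rewrite !mem_pair.
by have := E (true, x); rewrite !mem_pair.
Qed.

End Big.

Definition double_label (l : {ffun 'I_n.*2 -> bool}) : {ffun point -> bool} :=
  [ffun z => l z.2].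
Definition join_label (l1 l2 : {ffun 'I_n.*2 -> bool}) : {ffun point -> bool} :=
  [ffun z => if z.1 then l2 z.2 else l1 z.2].

Lemma double_labelling l :
  is_labelling oa (ia setT) (double_label l) = is_labelling (pm_arc b) (pm_arc c) l.
Proof.
apply/is_labellingP/is_labellingP => lab.
  move=> x y xy; have := lab (false, x) (false, y); rewrite same_circle_fin !ffunE.
  exact.
by move=> z z'; rewrite same_circle_fin !ffunE => /lab.
Qed.

Lemma join_labelling l1 l2 : is_labelling (pm_arc b) (pm_arc a) l1 ->
  is_labelling (pm_arc a) (pm_arc c) l2 -> is_labelling oa (ia set0) (join_label l1 l2).
Proof.
move=> /is_labellingP lab1; rewrite is_labellingC => /is_labellingP lab2.
apply/is_labellingP => -[e x] [e' y]; rewrite same_circle_init !ffunE /=.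
by case/andP=> /eqP <-; case: e => /= [/lab2|/lab1].
Qed.

Lemma labelled_double l (C : {set 'I_n.*2}) :
  labelled_X (double_label l) (snd @^-1: C) = labelled_X l C.
Proof.
apply/existsP/existsP => [[[e x]]|[x]]; rewrite ?inE ?ffunE => xC.
  by exists x.
by exists (false, x); rewrite inE ffunE.
Qed.

Lemma labelled_pair l1 l2 e (C : {set 'I_n.*2}) :
  labelled_X (join_label l1 l2) (pair e @: C) = labelled_X (if e then l2 else l1) C.
Proof.
apply/existsP/existsP => [[z /andP[/imsetP[x xC ->]]]|[x /andP[xC lx]]].
  by rewrite ffunE => lx; exists x; rewrite xC; case: e lx.
by exists (e, x); rewrite imset_f // ffunE /=; case: e lx.
Qed.

Lemma double_join l : double_label l = join_label l l.
Proof. by apply/ffunP => -[[] x]; rewrite !ffunE. Qed.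

Lemma circle_count_init l1 l2 v :
  circle_count oa (ia set0) (join_label l1 l2) v =
  (circle_count (pm_arc b) (pm_arc a) l1 v + circle_count (pm_arc a) (pm_arc c) l2 v)%N.
Proof.
rewrite /circle_count big_circles_init /=.
by congr (_ + _)%N; apply: eq_bigr => C _; rewrite labelled_pair.
Qed.

Lemma circle_count_fin l v :
  circle_count oa (ia setT) (double_label l) v = circle_count (pm_arc b) (pm_arc c) l v.
Proof.
rewrite /circle_count big_circles_fin /=.
by apply: eq_bigr => C _; rewrite labelled_double.
Qed.

Lemma ev_init l1 l2 t1 t2 :
  ev oa (ia set0) (join_label l1 l2) (join_label t1 t2) =
  ev (pm_arc b) (pm_arc a) l1 t1 * ev (pm_arc a) (pm_arc c) l2 t2.
Proof.
rewrite /ev big_circles_init /=.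
by congr (_ * _); apply: eq_bigr => C _; rewrite !labelled_pair.
Qed.

Lemma ev_fin l t :
  ev oa (ia setT) (double_label l) (double_label t) = ev (pm_arc b) (pm_arc c) l t.
Proof.
rewrite /ev big_circles_fin /=.
by apply: eq_bigr => C _; rewrite !labelled_double.
Qed.

Lemma tensor_degree_init l1 l2 :
  tensor_degree oa (ia set0) (join_label l1 l2) =
  tensor_degree (pm_arc b) (pm_arc a) l1 + tensor_degree (pm_arc a) (pm_arc c) l2.
Proof.
rewrite /tensor_degree big_circles_init /=.
by congr (_ + _); apply: eq_bigr => C _; rewrite labelled_pair.
Qed.

Lemma tensor_degree_fin l :
  tensor_degree oa (ia setT) (double_label l) = tensor_degree (pm_arc b) (pm_arc c) l.
Proof.
rewrite /tensor_degree big_circles_fin /=.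
by apply: eq_bigr => C _; rewrite labelled_double.
Qed.

End Ends.

Lemma poly_mulrn_eq0 (f : poly) k : (f *+ k == 0) = (k == 0%N) || (f == 0).
Proof. by rewrite -mulr_natl mulf_eq0 -polyC_natr polyC_eq0 pnatr_eq0. Qed.

Section Evaluation.
Variables (T : finType) (o i : T -> T).
Hypotheses (oK : involutive o) (iK : involutive i).
Implicit Types (l sg : {ffun T -> bool}).

Let flip x sg : {ffun T -> bool} := [ffun y => sg y (+) same_circle o i x y].

Lemma flipK x : involutive (flip x).
Proof. by move=> sg; apply/ffunP => y; rewrite !ffunE -addbA addbb addbF. Qed.

Lemma flip_labelling x sg : is_labelling o i (flip x sg) = is_labelling o i sg.
Proof.
have s := same_circle_sym oK iK.
have half sg' : is_labelling o i sg' -> is_labelling o i (flip x sg').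
  move=> /is_labellingP lab; apply/is_labellingP => y z yz; rewrite !ffunE (lab y z) //.
  congr (_ (+) _); apply/idP/idP => h; apply: (same_circle_trans h) => //.
  by rewrite s.
by apply/idP/idP => /half; rewrite ?flipK.
Qed.

(** Changing the root on the circle of [x] changes the sign of the tensors with
    label X on this circle.  It makes the values of different tensors
    orthogonal. *)
Lemma ev_flip x l sg : is_labelling o i l -> is_labelling o i sg ->
  ev o i l (flip x sg) = (-1) ^+ l x * ev o i l sg.
Proof.
move=> lab slab; rewrite /ev.
have labE y m : is_labelling o i m -> labelled_X m (circle o i y) = m y.
  exact: labelled_X_circle.
rewrite (bigD1 (circle o i x)) ?mem_circles //=.
rewrite [in RHS](bigD1 (circle o i x)) ?mem_circles //= mulrA; congr (_ * _).
  rewrite !labE ?flip_labelling // ffunE same_circle_refl addbT /wt /sroot.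
  by case: (l x); case: (sg x); rewrite ?expr1 ?expr0 ?mul1r ?mulN1r ?opprK.
apply: eq_bigr => _ /andP[/circlesP[y ->] yx].
rewrite !labE ?flip_labelling // ffunE.
have [xy|] := boolP (same_circle o i x y); last by rewrite addbF.
case/negP: yx; apply/eqP/setP => z; rewrite !mem_circle.
have s := same_circle_sym oK iK.
by apply/idP/idP; apply: same_circle_trans; rewrite // s.
Qed.

Lemma ev_orthogonal l l' : is_labelling o i l -> is_labelling o i l' -> l != l' ->
  \sum_(sg | is_labelling o i sg) ev o i l sg * ev o i l' sg = 0.
Proof.
move=> lab lab' ll'.
(* Flipping the root on a circle where the labels differ reverses the sign of
   the sum. *)
have [x lx] : exists x, l x != l' x.
  by apply/existsP; apply: contraNT ll' => /existsPn E; apply/eqP/ffunP => x;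
     apply/eqP; rewrite -[_ == _]negbK E.
set S := (X in X = _).
have E : S = - S.
  rewrite {1}/S (reindex_inj (can_inj (flipK x))) /= /S -sumrN.
  apply: eq_big => [sg|sg]; rewrite flip_labelling // => slab.
  rewrite !ev_flip // mulrACA -signr_addb.
  by rewrite -negb_eqb lx expr1 mulN1r.
have : S *+ 2 = 0 by rewrite mulr2n {1}E addNr.
by move/eqP; rewrite poly_mulrn_eq0 /= => /eqP.
Qed.

(** The squared value does not depend on the signs of the roots, so the sum of the
    squared values over all choices is a non-zero multiple of it. *)
Lemma ev_sq l sg : ev o i l sg ^+ 2 = ev o i l [ffun=> false] ^+ 2.
Proof.
rewrite -!prodrXl; apply: eq_bigr => C _; rewrite /wt /sroot.
by case: (labelled_X l C); case: (labelled_X sg C); case: (labelled_X _ C);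
   rewrite ?sqrrN.
Qed.

Lemma ev_neq0 l sg : ev o i l sg != 0.
Proof.
apply/prodf_neq0 => C _; rewrite /wt /sroot.
by case: (labelled_X l C); case: (labelled_X sg C);
   rewrite ?oppr_eq0 ?polyX_eq0 ?oner_neq0.
Qed.

(** By [ev_orthogonal], pairing a chain with the values of a tensor isolates the
    coefficient of this tensor up to a non-zero factor. *)
Lemma chain_ev_inj (f : dchain T) : (forall l, ~~ is_labelling o i l -> f l = 0) ->
  (forall sg, is_labelling o i sg -> chain_ev o i f sg = 0) -> forall l, f l = 0.
Proof.
move=> f0 fev l0; have [lab0|/f0->//] := boolP (is_labelling o i l0).
have : \sum_(sg | is_labelling o i sg) chain_ev o i f sg * ev o i l0 sg = 0.
  by apply: big1 => sg /fev ->; rewrite mul0r.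
under eq_bigr => sg _ do rewrite mulr_suml.
rewrite exchange_big (bigD1 l0) //= [X in _ + X]big1 ?addr0; last first.
  move=> l ll0; have [lab|/f0->] := boolP (is_labelling o i l); last first.
    by apply: big1 => sg _; rewrite !mul0r.
  under eq_bigr => sg _ do rewrite -mulrA.
  by rewrite -mulr_sumr ev_orthogonal // mulr0.
under eq_bigr => sg _ do rewrite -mulrA -expr2 ev_sq.
rewrite sumr_const => /eqP; rewrite poly_mulrn_eq0 => /orP[|].
  move=> /eqP/card0_eq/(_ [ffun=> false]); rewrite unfold_in => /negP[].
  by apply/forallP => x; rewrite !ffunE.
by rewrite mulf_eq0 expf_eq0 /= (negPf (ev_neq0 _ _)) orbF => /eqP.
Qed.

End Evaluation.
(** * Associativity and units *)

Section Product.
Variables (n : nat).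
Local Notation point := (bool * 'I_n.*2)%type.
Implicit Types (a b c d : pmatching n) (l t : {ffun 'I_n.*2 -> bool}).

(** The deformation of [mul_coef]. *)
Definition dmul_coef b a c l1 l2 l : poly :=
  dcontract b a c set0 (left_ends a) [ffun L => (L == join_label l1 l2)%:R] (double_label l).

Lemma dmul_coef0 b a c l1 l2 l : (dmul_coef b a c l1 l2 l).[0] = mul_coef b a c l1 l2 l.
Proof.
apply: dcontract0 => L; rewrite !ffunE -/(join_label l1 l2).
by case: (L == _); rewrite hornerE.
Qed.

Lemma dcontract_labelling b a c D s (f : dchain point) :
  stable a D -> exhausts a D s ->
  (forall L, f L != 0 -> is_labelling (outer_arc b c) (inner_arc a D) L) ->
  forall L, dcontract b a c D s f L != 0 ->
    is_labelling (outer_arc b c) (inner_arc a setT) L.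
Proof.
elim: s D f => [|x s IHs] D f stD /=; first by move=> /eqP->.
case/andP => xD ex flab l.
apply: (IHs _ _ _ ex); first exact: stable_contract.
by move=> l'; apply: dsaddle_labelling.
Qed.

Notation lab a b := (is_labelling (pm_arc a) (pm_arc b)).
Notation evp a b := (ev (pm_arc a) (pm_arc b)).
Notation count a b := (circle_count (pm_arc a) (pm_arc b)).

Lemma join_chain_labelling b a c l1 l2 : lab b a l1 -> lab a c l2 ->
  forall L, [ffun L : {ffun point -> bool} => (L == join_label l1 l2)%:R : poly] L != 0 ->
  is_labelling (outer_arc b c) (inner_arc a set0) L.
Proof.
move=> lab1 lab2 L; rewrite ffunE; have [->|] := eqVneq L (join_label l1 l2).
  by rewrite join_labelling.
by rewrite eqxx.
Qed.

(** [t] takes equal values at the two ends of each arc of [a]; together with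
    being constant on the circles of W(b)c this says that it is constant on the
    circles of W(b)a and of W(a)c, by [arc_const_labelling]. *)
Definition arc_const a t := all (fun x => t x == t (pm_arc a x)) (left_ends a).

Definition arc_count a t (v : bool) : nat := \sum_(x <- left_ends a) (t x == v).

Lemma arc_const_labelling a b c t : arc_const a t ->
  lab b c t -> lab b a t * lab a c t.
Proof.
move=> /allP ca slab.
have E x : t (pm_arc a x) = t x.
  have [lt|] := boolP (x < pm_arc a x)%N.
    by apply/esym/eqP/ca; rewrite mem_left_ends.
  rewrite -leqNgt leq_eqVlt val_eqE (negPf (pm_arc_neq a x)) /= => lt.
  by rewrite -[in RHS](pm_arcK a x); apply/eqP/ca; rewrite mem_left_ends pm_arcK.
by split; apply/forallP => x; have /forallP/(_ x)/andP[sb sc] := slab;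
  rewrite ?E ?eqxx ?sb ?sc.
Qed.

Lemma dmul_coef_ev_ex b a c l1 l2 t : lab b a l1 -> lab a c l2 -> lab b c t ->
  exists S : bool -> nat,
    (arc_const a t -> forall v, ((S v).*2 + (count b a t v + count a c t v) =
        arc_count a t v + count b c t v)%N)
    /\ \sum_(l | lab b c l) dmul_coef b a c l1 l2 l * evp b c l t =
       (if arc_const a t then split_weight S else 0) * (evp b a l1 t * evp a c l2 t).
Proof.
move=> lab1 lab2 slab.
have slabD : is_labelling (outer_arc b c) (inner_arc a setT) (double_label t).
  by rewrite double_labelling.
have [S []] := dcontract_ev (@stable0 _ a) (exhausts_left_ends a)
   (join_chain_labelling lab1 lab2) slabD.
have cE : all (fun x => double_label t (false, x) == double_label t (false, pm_arc a x)) (left_ends a)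
    = arc_const a t.
  by apply: eq_all => x; rewrite !ffunE.
rewrite cE => SE SW; exists S; split.
  move=> ca v; rewrite -(circle_count_fin b a c t v) -circle_count_init -double_join.
  by rewrite (SE ca v); congr (_ + _)%N; apply: eq_bigr => x _; rewrite ffunE.
transitivity (chain_ev (outer_arc b c) (inner_arc a setT)
   (dcontract b a c set0 (left_ends a) [ffun L => (L == join_label l1 l2)%:R]) (double_label t)).
  rewrite /chain_ev.
  rewrite (bigID (is_labelling (outer_arc b c) (inner_arc a setT))) /=.
  rewrite [X in _ = _ + X]big1 ?addr0; last first.
    move=> L nlab; apply/eqP; rewrite mulf_eq0; apply/orP; left.
    apply: contraNT nlab; apply: dcontract_labelling.
    - exact: stable0.
    - exact: exhausts_left_ends.
    - exact: join_chain_labelling.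
  rewrite (reindex_onto (@double_label n) (fun L => [ffun x => L (false, x)])) /=; last first.
    move=> L /is_labellingP Llab; apply/ffunP => -[e x]; rewrite !ffunE /=.
    by apply: Llab; rewrite same_circle_fin same_circle_refl.
  apply: eq_big => [l|l _].
    rewrite double_labelling andbC; have -> : [ffun x => double_label l (false, x)] = l.
      by apply/ffunP => x; rewrite !ffunE.
    by rewrite eqxx.
  by congr (_ * _); exact/esym/ev_fin.
rewrite SW; congr (_ * _); rewrite /chain_ev (bigD1 (join_label l1 l2)) //=.
rewrite big1 => [|L /negPf LN]; last by rewrite ffunE LN mul0r.
rewrite addr0 ffunE eqxx (mul1r (ev _ _ _ _)) double_join.
exact: ev_init.
Qed.

Lemma split_weightM S S' :
  split_weight S * split_weight S' = split_weight (fun v => S v + S' v)%N.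
Proof. by rewrite /split_weight -big_split; apply: eq_bigr => v _; rewrite exprD. Qed.

(** The number of splittings with root [v], computed from numbers of circles: it
    solves the equation of [splitsE]. *)
Definition splits b a c t v :=
  (arc_count a t v + count b c t v - (count b a t v + count a c t v))./2.

Definition weight b a c t : poly :=
  if arc_const a t then split_weight (splits b a c t) else 0.

Lemma splitsE b a c t v : arc_const a t -> lab b c t ->
  ((splits b a c t v).*2 + (count b a t v + count a c t v) =
        arc_count a t v + count b c t v)%N.
Proof.
move=> ca slab; have [lab1 lab2] := arc_const_labelling ca slab.
have [S [/(_ ca v) E _]] := dmul_coef_ev_ex lab1 lab2 slab.
by rewrite /splits -E addnK doubleK.
Qed.

(** The deformed product is pointwise up to the weight, which is the same for
    all tensors. *)
Lemma dmul_coef_ev b a c l1 l2 t : lab b a l1 -> lab a c l2 -> lab b c t ->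
  \sum_(l | lab b c l) dmul_coef b a c l1 l2 l * evp b c l t =
  weight b a c t * (evp b a l1 t * evp a c l2 t).
Proof.
move=> lab1 lab2 slab; have [S [SE ->]] := dmul_coef_ev_ex lab1 lab2 slab.
congr (_ * _); rewrite /weight; case: ifP => // ca.
rewrite /split_weight; apply: eq_bigr => v _.
by rewrite /splits -(SE ca) addnK doubleK.
Qed.

Lemma weightE b a c t : arc_const a t ->
  weight b a c t = split_weight (splits b a c t).
Proof. by rewrite /weight => ->. Qed.

Lemma weight0 b a c t : ~~ arc_const a t -> weight b a c t = 0.
Proof. by rewrite /weight => /negPf->. Qed.

(** Twice the exponent of each factor is a sum of numbers of circles and of arcs.
    On both sides the circles of the intermediate diagram cancel and the same
    terms remain: the arcs of a and c, and the circles of W(b)d minus those of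
    W(b)a, W(a)c and W(c)d. *)
Lemma weight_cocycle b a c d t : lab b d t ->
  weight b c d t * weight b a c t = weight a c d t * weight b a d t.
Proof.
move=> slab; have [ca|nca] := boolP (arc_const a t); last first.
  by rewrite !(weight0 _ _ nca); exact: etrans (mulr0 _) (esym (mulr0 _)).
have [cc|ncc] := boolP (arc_const c t); last first.
  by rewrite !(weight0 _ _ ncc); exact: etrans (mul0r _) (esym (mul0r _)).
have [bc cd] := arc_const_labelling cc slab; have [ba ad] := arc_const_labelling ca slab.
rewrite (weightE b d cc) (weightE b c ca) (weightE a d cc) (weightE b d ca).
apply: etrans (split_weightM _ _) (etrans _ (esym (split_weightM _ _))).
apply: eq_bigr => v _; congr (_ ^+ _).
have := splitsE v cc slab; have := splitsE v ca bc.
have := splitsE v cc ad; have := splitsE v ca slab.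
move: (splits _ _ _ _ _) (splits _ _ _ _ _) (splits _ _ _ _ _) (splits _ _ _ _ _).
move=> s1 s2 s3 s4; clear; lia.
Qed.

Lemma dchain_eq a b (f g : dchain 'I_n.*2) :
  (forall t, lab a b t -> \sum_(l | lab a b l) f l * evp a b l t =
                          \sum_(l | lab a b l) g l * evp a b l t) ->
  forall l, lab a b l -> f l = g l.
Proof.
move=> E l labl; apply/eqP; rewrite -subr_eq0; apply/eqP.
pose h : dchain 'I_n.*2 := [ffun l => if lab a b l then f l - g l else 0].
suff /(_ l) : forall l, h l = 0 by rewrite ffunE labl.
apply: (chain_ev_inj (@pm_arcK _ a) (@pm_arcK _ b)) => [l' nlab|t slab].
  by rewrite ffunE (negPf nlab).
rewrite /chain_ev (bigID (lab a b)) /= [X in _ + X]big1 ?addr0; last first.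
  by move=> l' nlab; rewrite ffunE (negPf nlab) mul0r.
under eq_bigr => l' labl' do rewrite ffunE labl' mulrBl.
by rewrite sumrB E // subrr.
Qed.

(** Both sides have the same values, the product of the three values times the
    two sides of [weight_cocycle]. *)
Lemma dmul_coefA b a c d l1 l2 l3 l4 :
  lab b a l1 -> lab a c l2 -> lab c d l3 -> lab b d l4 ->
  \sum_(l | lab b c l) dmul_coef b a c l1 l2 l * dmul_coef b c d l l3 l4 =
  \sum_(l | lab a d l) dmul_coef a c d l2 l3 l * dmul_coef b a d l1 l l4.
Proof.
move=> lab1 lab2 lab3 lab4; move: lab4.
pose f : dchain 'I_n.*2 :=
  [ffun l4 => \sum_(l | lab b c l) dmul_coef b a c l1 l2 l * dmul_coef b c d l l3 l4].
pose g : dchain 'I_n.*2 :=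
  [ffun l4 => \sum_(l | lab a d l) dmul_coef a c d l2 l3 l * dmul_coef b a d l1 l l4].
suff : forall l4, lab b d l4 -> f l4 = g l4 by move=> E /E; rewrite !ffunE.
apply: dchain_eq => t slab.
under eq_bigr => l labl do rewrite ffunE mulr_suml.
under [in RHS]eq_bigr => l labl do rewrite ffunE mulr_suml.
rewrite exchange_big /= [in RHS]exchange_big /=.
transitivity (\sum_(l | lab b c l) dmul_coef b a c l1 l2 l *
   \sum_(l' | lab b d l') dmul_coef b c d l l3 l' * evp b d l' t).
  by apply: eq_bigr => l _; rewrite mulr_sumr; apply: eq_bigr => l' _; rewrite mulrA.
transitivity (\sum_(l | lab a d l) dmul_coef a c d l2 l3 l *
   \sum_(l' | lab b d l') dmul_coef b a d l1 l l' * evp b d l' t); last first.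
  by apply: eq_bigr => l _; rewrite mulr_sumr; apply: eq_bigr => l' _; rewrite mulrA.
have R1 (D W e e' : poly) : D * (W * (e * e')) = W * e' * (D * e) by ring.
have R2 (D W e e' : poly) : D * (W * (e * e')) = W * e * (D * e') by ring.
transitivity (weight b c d t * weight b a c t *
   (evp b a l1 t * evp a c l2 t * evp c d l3 t)).
  under eq_bigr => l labl do rewrite (dmul_coef_ev labl lab3 slab) R1.
  rewrite -mulr_sumr; have [cc|ncc] := boolP (arc_const c t); last first.
    rewrite (weight0 _ _ ncc) -mulrA.
    exact: etrans (mul0r _) (esym (etrans (congr1 ( *%R^~ _) (mul0r _)) (mul0r _))).
  have [bc cd] := arc_const_labelling cc slab.
  rewrite (dmul_coef_ev lab1 lab2 bc).
  have R3 (W V x y z : poly) : W * z * (V * (x * y)) = W * V * (x * y * z) by ring.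
  exact: R3.
under eq_bigr => l labl do rewrite (dmul_coef_ev lab1 labl slab) R2.
rewrite -mulr_sumr (weight_cocycle a c slab); have [ca|nca] := boolP (arc_const a t); last first.
  rewrite (weight0 _ _ nca) -[X in _ = X]mulrA.
  exact: etrans (congr1 ( *%R^~ _) (mulr0 _)) (etrans (mul0r _) (esym (mul0r _))).
have [ba ad] := arc_const_labelling ca slab.
rewrite (dmul_coef_ev lab2 lab3 ad).
have R3 (W V x y z : poly) : W * V * (x * y * z) = V * x * (W * (y * z)) by ring.
exact: R3.
Qed.

Lemma evp_unlabelled a b t : evp a b [ffun=> false] t = 1.
Proof.
rewrite /ev big1 // => C _; rewrite /wt /labelled_X; case: existsP => //.
by case=> x; rewrite ffunE andbF.
Qed.

(** The circles of W(a)a are the arcs of a. *)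
Lemma count_diag a t v : arc_const a t -> count a a t v = arc_count a t v.
Proof.
move=> ca; rewrite /circle_count /arc_count.
have -> : circles (pm_arc a) (pm_arc a) =
   [set circle (pm_arc a) (pm_arc a) x | x in left_ends a].
  apply/setP => C; apply/circlesP/imsetP => [[x ->]|[x _ ->]]; last by exists x.
  have [lt|] := boolP (x < pm_arc a x)%N; first by exists x; rewrite ?mem_left_ends.
  rewrite -leqNgt leq_eqVlt val_eqE (negPf (pm_arc_neq a x)) /= => lt.
  exists (pm_arc a x); first by rewrite mem_left_ends pm_arcK.
  apply/eqP; rewrite /circle eqclassP.
  - exact: same_circle_o.
  - exact: same_circle_refl.
  - by apply: same_circle_sym; apply: pm_arcK.
  - exact: same_circle_trans.
rewrite big_imset /=; last first.
  move=> x y; rewrite !mem_left_ends => ltx lty /setP/(_ x).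
  rewrite !mem_circle !same_circle_pm !inE eqxx /= => /esym/orP[/eqP//|/eqP E].
  by move: ltx lty; rewrite E pm_arcK => h1 h2; have := ltn_trans h1 h2; rewrite ltnn.
have slab : lab a a t.
  apply/forallP => x; rewrite andbb.
  have [lt|] := boolP (x < pm_arc a x)%N.
    by rewrite eq_sym; apply: (allP ca); rewrite mem_left_ends.
  rewrite -leqNgt leq_eqVlt val_eqE (negPf (pm_arc_neq a x)) /= => lt.
  by rewrite -[X in _ == t X](pm_arcK a x); apply: (allP ca); rewrite mem_left_ends pm_arcK.
rewrite -big_uniq /=; last by rewrite filter_uniq ?enum_uniq.
by apply: eq_bigr => x _; rewrite labelled_X_circle.
Qed.

Lemma labelling_arc_const a b t : lab a b t -> arc_const a t.
Proof. by move=> /forallP slab; apply/allP => x _; have /andP[/eqP->] := slab x. Qed.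

(** Contracting W(a)a with W(a)c only merges circles: the weight is 1 because, by
    [count_diag], the number of splittings is 0. *)
Lemma weight_unitl a c t : lab a c t -> weight a a c t = 1.
Proof.
move=> slab; have ca := labelling_arc_const slab.
rewrite /weight ca /split_weight big1 // => v _.
by rewrite /splits count_diag // subnn expr0.
Qed.

Lemma weight_unitr a b t : lab b a t -> weight b a a t = 1.
Proof.
rewrite is_labellingC => slab; have ca := labelling_arc_const slab.
rewrite /weight ca /split_weight big1 // => v _.
by rewrite /splits count_diag // [X in (_ - X)%N]addnC subnn expr0.
Qed.

Lemma ev_basis a b l t : lab a b l ->
  \sum_(l' | lab a b l') (l' == l)%:R * evp a b l' t = evp a b l t.
Proof.
move=> labl; rewrite (bigD1 l) //= eqxx mul1r big1 ?addr0 // => l' /andP[_ /negPf->].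
by rewrite mul0r.
Qed.

Lemma dmul_coef1l a c l2 l : lab a c l2 -> lab a c l ->
  dmul_coef a a c [ffun=> false] l2 l = (l == l2)%:R.
Proof.
move=> lab2 labl.
have lab1 : lab a a [ffun=> false] by apply/forallP => x; rewrite !ffunE.
pose f : dchain 'I_n.*2 := [ffun l => dmul_coef a a c [ffun=> false] l2 l].
pose g : dchain 'I_n.*2 := [ffun l => (l == l2)%:R].
suff : f l = g l by rewrite !ffunE.
apply: (dchain_eq (a := a) (b := c)) => // t slab.
under eq_bigr => l' _ do rewrite ffunE.
under [in RHS]eq_bigr => l' _ do rewrite ffunE.
by rewrite dmul_coef_ev // ev_basis // weight_unitl // evp_unlabelled !mul1r.
Qed.

Lemma dmul_coef1r b a l1 l : lab b a l1 -> lab b a l ->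
  dmul_coef b a a l1 [ffun=> false] l = (l == l1)%:R.
Proof.
move=> lab1 labl.
have lab2 : lab a a [ffun=> false] by apply/forallP => x; rewrite !ffunE.
pose f : dchain 'I_n.*2 := [ffun l => dmul_coef b a a l1 [ffun=> false] l].
pose g : dchain 'I_n.*2 := [ffun l => (l == l1)%:R].
suff : f l = g l by rewrite !ffunE.
apply: (dchain_eq (a := b) (b := a)) => // t slab.
under eq_bigr => l' _ do rewrite ffunE.
under [in RHS]eq_bigr => l' _ do rewrite ffunE.
by rewrite dmul_coef_ev // ev_basis // weight_unitr // evp_unlabelled mulr1 mul1r.
Qed.

Lemma mul_coefA b a c d l1 l2 l3 l4 :
  lab b a l1 -> lab a c l2 -> lab c d l3 -> lab b d l4 ->
  \sum_(l | lab b c l) mul_coef b a c l1 l2 l * mul_coef b c d l l3 l4 =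
  \sum_(l | lab a d l) mul_coef a c d l2 l3 l * mul_coef b a d l1 l l4.
Proof.
move=> lab1 lab2 lab3 lab4.
under eq_bigr => l _ do rewrite -!dmul_coef0 -hornerM.
under [in RHS]eq_bigr => l _ do rewrite -!dmul_coef0 -hornerM.
by rewrite -!horner_sum dmul_coefA.
Qed.

Lemma mul_coef1l a c l2 l : lab a c l2 -> lab a c l ->
  mul_coef a a c [ffun=> false] l2 l = (l == l2)%:R.
Proof.
by move=> lab2 labl; rewrite -dmul_coef0 dmul_coef1l //; case: (_ == _); rewrite hornerE.
Qed.

Lemma mul_coef1r b a l1 l : lab b a l1 -> lab b a l ->
  mul_coef b a a l1 [ffun=> false] l = (l == l1)%:R.
Proof.
by move=> lab1 labl; rewrite -dmul_coef0 dmul_coef1r //; case: (_ == _); rewrite hornerE.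
Qed.

End Product.
(** * Degree and ideal under a saddle *)

Section SaddleDegree.
Variables (T : finType) (o i i' : T -> T) (col : T -> bool) (p p' q q' : T).
Hypothesis site : saddle_site o i i' col p p' q q'.
Implicit Types l : {ffun T -> bool}.
Let oK := site_oK site.
Let iK := site_iK site.
Let i'K := site_iK' site.

Lemma saddle_coef_neq0 l l' : saddle_coef o i i' p p' q l l' != 0 ->
  [/\ is_labelling o i' l',
      forall x, same_circle o i p x || same_circle o i p' x || (l' x == l x)
    & if same_circle o i p p'
      then if l p then l' p && l' q else l' p (+) l' q
      else ~~ (l p && l p') && (l' p == l p || l p')].
Proof.
rewrite /saddle_coef; case: ifP => [/andP[lab' /forallP E]|_]; last by rewrite eqxx.
move=> nz; split=> //; move: nz; case: ifP => _; rewrite /frob_comul /frob_mul.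
  by case: (l p); case: (l' p); case: (l' q).
by case: (l p); case: (l p'); case: (l' p).
Qed.

Lemma labelled_away l l' (C : {set T}) :
  (forall x, same_circle o i p x || same_circle o i p' x || (l' x == l x)) ->
  (forall x, x \in C -> ~~ same_circle o i p x && ~~ same_circle o i p' x) ->
  labelled_X l' C = labelled_X l C.
Proof.
move=> E CP; apply: eq_existsb => x; apply: andb_id2l => /CP/andP[px px'].
by have := E x; rewrite (negPf px) (negPf px') => /eqP.
Qed.

(** With 1 in degree -1 and X in degree 1, multiplication and comultiplication are
    homogeneous of degree 1, and the circles away from the saddle keep their
    labels. *)
Lemma saddle_degree l l' : is_labelling o i l ->
  saddle_coef o i i' p p' q l l' != 0 ->
  tensor_degree o i' l' = tensor_degree o i l + 1.
Proof.
move=> lab /saddle_coef_neq0[lab' E F]; rewrite /tensor_degree /circles.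
have r := same_circle_refl o; have s := same_circle_sym oK iK.
have s' := same_circle_sym oK i'K; have t := @same_circle_trans T o.
move: F; have [pp'|npp'] := boolP (same_circle o i p p') => F.
  have npq := split_npq site pp'.
  rewrite (big_split_classes (r i') s' (@t i') npq).
  rewrite (big_merged_classes (r i') s' (@t i') npq (saddle_split site pp')) /=.
  rewrite (eq_bigr (fun C => if labelled_X l C then 1 else -1)) => [|C]; last first.
    case/andP=> CP /andP[pC qC]; rewrite (@labelled_away l l') // => x xC.
    rewrite (split_circle_p' site pp') andbb (split_circle_p site pp') negb_or.
    move/circlesP: CP xC pC qC => [y ->]; rewrite !mem_circle => yx yp yq.
    by apply/andP; split; [apply: contra yp | apply: contra yq] => h;
      apply: (same_circle_trans yx); rewrite s'.
  rewrite !labelled_X_circle //; move: F.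
  move: (\sum_(_ in _ | _) _) => Z.
  by case: (l p); case: (l' p); case: (l' q) => //= _; ring.
rewrite (big_split_classes (r i) s (@t i) npp').
rewrite (big_merged_classes (r i) s (@t i) npp' (saddle_merge site npp')) /=.
rewrite (eq_bigr (fun C => if labelled_X l C then 1 else -1)) => [|C]; last first.
  case/andP=> CP /andP[pC qC]; rewrite (@labelled_away l l') // => x xC.
  move/circlesP: CP xC pC qC => [y ->]; rewrite !mem_circle => yx yp yq.
  by apply/andP; split; [apply: contra yp | apply: contra yq] => h;
    apply: (same_circle_trans yx); rewrite s.
rewrite !labelled_X_circle //; move: F.
move: (\sum_(_ in _ | _) _) => Z.
by case: (l p); case: (l p'); case: (l' p) => //= _; ring.
Qed.

Section Platforms.
Variables (U : finType) (pr : T -> U) (k1 k2 : pred U).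

(** The projection [pr] sends a point of the cobordism to its position on the
    line.  Circles are tested on their projections, so that both copies of a
    platform point count as one point and the same condition makes sense at
    every stage of the contraction. *)
Definition meets_twice (k : pred U) (C : {set T}) : bool :=
  [exists x in C, exists y in C, [&& k (pr x), k (pr y) & pr x != pr y]].
Definition meets (C : {set T}) : bool := [exists x in C, k1 (pr x) || k2 (pr x)].

(** Some circle is of type III, or else it meets a platform and is labelled X.
    For a tensor of the ring this is membership in the ideal, by
    [ideal_tensorE]. *)
Definition degenerate (j : T -> T) l : bool :=
  [exists x, let C := circle o j x in
    [|| meets_twice k1 C, meets_twice k2 C | meets C && l x]].

Lemma meets_twiceP (k : pred U) (C : {set T}) : reflect
  (exists x y, [/\ x \in C, y \in C, k (pr x), k (pr y) & pr x != pr y])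
  (meets_twice k C).
Proof.
apply: (iffP existsP) => [[x /andP[xC /existsP[y /andP[yC /and3P[kx ky xy]]]]]|].
  by exists x, y.
case=> x [y [xC yC kx ky xy]]; exists x; rewrite xC; apply/existsP; exists y.
by rewrite yC kx ky.
Qed.

Lemma meetsP (C : {set T}) : reflect (exists2 x, x \in C & k1 (pr x) || k2 (pr x)) (meets C).
Proof. exact: exists_inP. Qed.

(** A merging can only enlarge the offending circle, and a non-zero coefficient
    keeps its label X.  If the circle splits and is labelled X, both parts are labelled X and one of them meets a platform.  If it is
    labelled 1, then one part is labelled X; two platform points either lie on the
    same part, or on both parts, and then the part labelled X meets a
    platform. *)
Lemma saddle_degenerate l l' : is_labelling o i l ->
  saddle_coef o i i' p p' q l l' != 0 -> degenerate i l -> degenerate i' l'.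
Proof.
move=> lab /saddle_coef_neq0[lab' E F] /existsP[z /= bz].
have s := same_circle_sym oK iK; have s' := same_circle_sym oK i'K.
have mono (C C' : {set T}) : C \subset C' ->
   [/\ meets_twice k1 C -> meets_twice k1 C', meets_twice k2 C -> meets_twice k2 C' &
       meets C -> meets C'].
  move=> /subsetP CC; split; first 2 last.
  - by case/meetsP=> x /CC xC kx; apply/meetsP; exists x.
  - case/meets_twiceP=> x [y [/CC xC /CC yC kx ky xy]].
    by apply/meets_twiceP; exists x, y.
  - case/meets_twiceP=> x [y [/CC xC /CC yC kx ky xy]].
    by apply/meets_twiceP; exists x, y.
have keep w : circle o i z \subset circle o i' w -> (l z -> l' w) -> degenerate i' l'.
  move=> /mono[m1 m2 m3] lw; apply/existsP; exists w => /=.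
  case/or3P: bz => [/m1->//|/m2->|/andP[/m3-> /lw->]]; by rewrite ?orbT.
move: F; have [pp'|npp'] := boolP (same_circle o i p p') => F; last first.
  apply: (keep z).
    by apply/subsetP => y; rewrite !mem_circle (saddle_merge site npp') => ->.
  have := E z; rewrite -(merge_circle_p site npp').
  have [pz _ lz|] := boolP (same_circle o i' p z).
    rewrite (labelling_circle lab' pz); case/andP: F => _ /eqP->.
    move: pz; rewrite (merge_circle_p site npp').
    by case/orP=> /(labelling_circle lab) <-; rewrite lz ?orbT.
  by move=> _ /eqP->.
have [pz|npz] := boolP (same_circle o i p z); last first.
  apply: (keep z).
    apply/subsetP => y; rewrite !mem_circle (saddle_split site pp') => /or3P[//||].
      case/andP=> zp _; case/negP: npz.
      by rewrite (split_circle_p site pp') s' zp.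
    case/andP=> zq _; case/negP: npz.
    by rewrite (split_circle_p site pp') [X in _ || X]s' zq orbT.
  by have := E z; rewrite (split_circle_p' site pp') (negPf npz) => /eqP->.
have lz : l z = l p := labelling_circle lab pz.
have cz : circle o i z = circle o i' p :|: circle o i' q.
  apply/setP => y; rewrite in_setU !mem_circle -(split_circle_p site pp').
  by apply/idP/idP; apply: same_circle_trans; rewrite // s.
have mU (C C' : {set T}) : meets (C :|: C') -> meets C || meets C'.
  case/meetsP => x; rewrite in_setU => /orP[] xC kx; apply/orP; [left|right];
  by apply/meetsP; exists x.
have in_p : meets (circle o i' p) -> l' p -> degenerate i' l'.
  by move=> m lp; apply/existsP; exists p; rewrite /= m lp !orbT.
have in_q : meets (circle o i' q) -> l' q -> degenerate i' l'.
  by move=> m lq; apply/existsP; exists q; rewrite /= m lq !orbT.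
have m12 : meets (circle o i z).
  case/or3P: bz => [||/andP[//]] /meets_twiceP[x [y [xC _ kx _ _]]];
  by apply/meetsP; exists x; rewrite ?kx ?orbT.
case lpE : (l p) F => F.
  case/andP: F => lp' lq'; move: m12; rewrite cz => /mU/orP[/in_p|/in_q]; exact.
have tw : meets_twice k1 (circle o i z) || meets_twice k2 (circle o i z).
  by move: bz; rewrite lz lpE andbF orbF.
have [k kk tk] : exists2 k, subpred k (predU k1 k2) &
   (meets_twice k (circle o i z) /\
    forall C, meets_twice k C -> meets_twice k1 C || meets_twice k2 C).
  case/orP: tw => tw; [exists k1|exists k2].
  - by move=> x /= ->.
  - by split=> // C ->.
  - by move=> x /= ->; rewrite orbT.
  - by split=> // C ->; rewrite orbT.
case: tk => /meets_twiceP[x [y]]; rewrite cz !in_setU => -[xC yC kx ky xy] tk.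
have at_circle w : meets_twice k (circle o i' w) -> degenerate i' l'.
  move/tk => h; apply/existsP; exists w => /=; case/orP: h => ->; by rewrite ?orbT.
have both : meets (circle o i' p) -> meets (circle o i' q) -> degenerate i' l'.
  move=> mp mq; case lp' : (l' p) F in_p => /=; first by move=> _ /(_ mp isT).
  by move=> lq' _; apply: in_q.
case/orP: xC => xC; case/orP: yC => yC.
- by apply: (at_circle p); apply/meets_twiceP; exists x, y.
- by apply: both; apply/meetsP; [exists x | exists y]; rewrite //; apply: kk.
- by apply: both; apply/meetsP; [exists y | exists x]; rewrite //; apply: kk.
- by apply: (at_circle q); apply/meets_twiceP; exists x, y.
Qed.

End Platforms.
End SaddleDegree.
(** * Products of tensors *)

Section Contraction.
Variables (n : nat) (b a c : pmatching n).
Local Notation point := (bool * 'I_n.*2)%type.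
Let oa := outer_arc b c.
Let ia := inner_arc a.
Let lab D := is_labelling oa (ia D).

(** A property that every saddle preserves holds for all tensors that occur in a
    product. *)
Lemma contract_invariant (Q : {set 'I_n.*2} -> {ffun point -> bool} -> Prop) :
  (forall D x L L', stable a D -> x \notin D ->
     lab D L -> Q D L ->
     saddle_coef oa (ia D) (ia (D :|: [set x; pm_arc a x]))
        (false, x) (true, x) (false, pm_arc a x) L L' != 0 ->
     Q (D :|: [set x; pm_arc a x]) L') ->
  forall D s (f : chain point), stable a D -> exhausts a D s ->
    (forall L, f L != 0 -> lab D L /\ Q D L) ->
    forall L, contract b a c D s f L != 0 -> Q setT L.
Proof.
move=> Qstep D s; elim: s D => [|x s IHs] D f stD /=.
  by move=> /eqP-> flab L /flab[].
case/andP => xD ex flab; apply: IHs => //; first exact: stable_contract.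
move=> L'; rewrite ffunE => nz.
have [L /andP[fL sL]] : exists L, (f L != 0) && (saddle_coef oa (ia D)
    (ia (D :|: [set x; pm_arc a x])) (false, x) (true, x) (false, pm_arc a x) L L' != 0).
  apply/existsP; apply: contraNT nz => /existsPn E; rewrite big1 // => L _.
  by apply/eqP; rewrite mulf_eq0; have := E L; rewrite negb_and !negbK.
have [labL QL] := flab L fL; split; last exact: Qstep sL.
by have [] := saddle_coef_neq0 sL.
Qed.

Variables (l1 l2 l : {ffun 'I_n.*2 -> bool}).
Hypotheses (lab1 : is_labelling (pm_arc b) (pm_arc a) l1)
           (lab2 : is_labelling (pm_arc a) (pm_arc c) l2).

Lemma mul_coef_invariant (Q : {set 'I_n.*2} -> {ffun point -> bool} -> Prop) :
  (forall D x L L', stable a D -> x \notin D ->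
     lab D L -> Q D L ->
     saddle_coef oa (ia D) (ia (D :|: [set x; pm_arc a x]))
        (false, x) (true, x) (false, pm_arc a x) L L' != 0 ->
     Q (D :|: [set x; pm_arc a x]) L') ->
  Q set0 (join_label l1 l2) -> mul_coef b a c l1 l2 l != 0 ->
  Q setT (double_label l).
Proof.
move=> Qstep Q0; apply: (contract_invariant Qstep).
- exact: stable0.
- exact: exhausts_left_ends.
move=> L; rewrite ffunE -/(join_label l1 l2).
have [-> _|_] := eqVneq L (join_label l1 l2); last by rewrite eqxx.
by split=> //; apply: join_labelling.
Qed.

(** The [n] saddles raise the degree by [n].  The invariant is doubled since
    each contraction adds two points to [D]. *)
Lemma mul_coef_degree : mul_coef b a c l1 l2 l != 0 ->
  tensor_degree (pm_arc b) (pm_arc c) l =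
  tensor_degree (pm_arc b) (pm_arc a) l1 + tensor_degree (pm_arc a) (pm_arc c) l2
  + n%:Z.
Proof.
set d := tensor_degree _ _ l1 + _.
pose Q (D : {set 'I_n.*2}) L := tensor_degree oa (ia D) L *+ 2 = d *+ 2 + #|D|%:Z.
have Qstep D x L L' : stable a D -> x \notin D -> lab D L -> Q D L ->
     saddle_coef oa (ia D) (ia (D :|: [set x; pm_arc a x]))
        (false, x) (true, x) (false, pm_arc a x) L L' != 0 ->
     Q (D :|: [set x; pm_arc a x]) L'.
  move=> stD xD labL QL /(saddle_degree (contract_site b c stD xD) labL) E.
  rewrite /Q E mulrnDl QL cardsU cards2 eq_sym pm_arc_neq.
  have -> : D :&: [set x; pm_arc a x] = set0.
    apply/setP => y; rewrite !inE; apply/negP => /andP[yD /orP[]/eqP yE].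
      by rewrite yE (negPf xD) in yD.
    by rewrite yE stD (negPf xD) in yD.
  by rewrite cards0 subn0; move: #|D| (d *+ 2) => u v; clear; lia.
move=> /(mul_coef_invariant Qstep); rewrite /Q cards0 addr0 cardsT card_ord.
rewrite tensor_degree_init tensor_degree_fin -/d => /(_ erefl).
move: (tensor_degree _ _ _) => x; clear Qstep Q; move: d => y; clear; lia.
Qed.

Let degen k (o : point -> point) := degenerate o snd (left_platform (n:=n) k) (right_platform (n:=n) k).
Definition degen_label k (e f : pmatching n) m :=
  degenerate (pm_arc e) id (left_platform (n:=n) k) (right_platform (n:=n) k)
     (pm_arc f) m.

(** A map that preserves circles, positions and labels X preserves degeneracy.  It
    compares the two ends of the contraction with the diagrams of the factors and
    of the product. *)
Lemma degenerate_transfer (T T' : finType) (o i : T -> T) (o' i' : T' -> T')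
    (pr : T -> 'I_n.*2) (pr' : T' -> 'I_n.*2) (k1 k2 : pred 'I_n.*2)
    (l0 : {ffun T -> bool}) (l0' : {ffun T' -> bool})
    (h : T -> T') :
  (forall x y, same_circle o i x y -> same_circle o' i' (h x) (h y)) ->
  (forall x, pr' (h x) = pr x) -> (forall x, l0 x -> l0' (h x)) ->
  degenerate o pr k1 k2 i l0 -> degenerate o' pr' k1 k2 i' l0'.
Proof.
move=> hsc hpr hl /existsP[x /= dx]; apply/existsP; exists (h x) => /=.
case/or3P: dx => [/meets_twiceP|/meets_twiceP|/andP[/meetsP[y + ky] /hl->]].
- case=> y [z [xy xz ky kz yz]]; apply/orP; left; apply/meets_twiceP.
  by exists (h y), (h z); move: xy xz; rewrite !mem_circle !hpr => /hsc-> /hsc->.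
- case=> y [z [xy xz ky kz yz]]; apply/orP; right; apply/orP; left; apply/meets_twiceP.
  by exists (h y), (h z); move: xy xz; rewrite !mem_circle !hpr => /hsc-> /hsc->.
rewrite mem_circle andbT => /hsc xy; apply/orP; right; apply/orP; right.
by apply/meetsP; exists (h y); rewrite ?mem_circle ?hpr.
Qed.

Lemma mul_coef_degenerate k : mul_coef b a c l1 l2 l != 0 ->
  degen_label k b a l1 || degen_label k a c l2 -> degen_label k b c l.
Proof.
move=> nz bad12.
suff : degen k oa (ia setT) (double_label l).
  apply: (degenerate_transfer (h := snd)) => // [z z'|z]; last by rewrite ffunE.
  by rewrite same_circle_fin.
apply: (mul_coef_invariant (Q := fun D L => degen k oa (ia D) L) _ _ nz).
  move=> D x L L' stD xD labL bad; move/(saddle_degenerate (contract_site b c stD xD)).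
  by apply.
case/orP: bad12.
  apply: (degenerate_transfer (h := pair false)) => // [x y|x].
    by rewrite same_circle_init.
  by rewrite ffunE.
apply: (degenerate_transfer (h := pair true)) => // [x y|x].
  by rewrite same_circle_init /= same_circleC.
by rewrite ffunE.
Qed.

End Contraction.

Section Tensors.
Variable n : nat.
Implicit Types (a b c : pmatching n) (t u v w : tensor n).

Lemma tensorP t : pm_k (tsrc t) = pm_k (ttgt t).
Proof. by have /andP[/eqP] := valP t. Qed.

Lemma tensor_labelling t : is_labelling (pm_arc (tsrc t)) (pm_arc (ttgt t)) (tlab t).
Proof. by have /andP[] := valP t. Qed.

Lemma tensor_eq t u : tsrc t = tsrc u -> ttgt t = ttgt u -> tlab t = tlab u -> t = u.
Proof.
move=> E1 E2 E3; apply: val_inj; case: t u E1 E2 E3 => [[[x y] z] p] [[[x' y'] z'] p'].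
by rewrite /tsrc /ttgt /tlab /= => -> -> ->.
Qed.

(** The tensors of F(W(b)c) are the labellings of its circles, as soon as b and c
    belong to the same k. *)
Lemma big_tensor b c (F : {ffun 'I_n.*2 -> bool} -> int) : pm_k b = pm_k c ->
  \sum_(w : tensor n | (tsrc w == b) && (ttgt w == c)) F (tlab w) =
  \sum_(l | is_labelling (pm_arc b) (pm_arc c) l) F l.
Proof.
move=> kE; pose h' l := insubd (idem_tensor b) (b, c, l).
have valh l : is_labelling (pm_arc b) (pm_arc c) l -> val (h' l) = (b, c, l).
  by move=> lab; rewrite val_insubd /is_tensor /= kE eqxx lab.
rewrite [RHS](reindex_onto (fun w => tlab w) h') => [|l lab]; last first.
  by have := valh l lab; rewrite /tlab; case: (h' l) => v p /= ->.
apply: eq_bigl => w; apply/andP/andP => [[/eqP wb /eqP wc]|[lab /eqP E]].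
  have lab : is_labelling (pm_arc b) (pm_arc c) (tlab w).
    by rewrite -wb -wc; exact: tensor_labelling.
  split=> //; apply/eqP/val_inj; rewrite valh // -wb -wc.
  by rewrite /tsrc /ttgt /tlab; case: (w) => [[[]]].
by rewrite /tsrc /ttgt -E valh //= !eqxx.
Qed.

Definition composable u v t :=
  [&& tsrc u == tsrc t, tsrc v == ttgt u & ttgt v == ttgt t].
(** The structure constants of the product on all tensors, zero when the
    diagrams do not match. *)
Definition tmul u v t : int :=
  if composable u v t
  then mul_coef (tsrc u) (ttgt u) (ttgt v) (tlab u) (tlab v) (tlab t) else 0.

Lemma Atilde_mulE (x y : Atilde n) t :
  Atilde_mul x y t = \sum_u \sum_v x u * y v * tmul u v t.
Proof.
rewrite ffunE big_mkcond; apply: eq_bigr => u _.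
case ut: (tsrc u == tsrc t).
  rewrite big_mkcond; apply: eq_bigr => v _.
  by rewrite /tmul /composable ut /=; case: ifP; rewrite // mulr0.
by rewrite big1 // => v _; rewrite /tmul /composable ut mulr0.
Qed.

Lemma tmul_neq0 u v t : tmul u v t != 0 ->
  [/\ tsrc u = tsrc t, tsrc v = ttgt u, ttgt v = ttgt t
    & mul_coef (tsrc u) (ttgt u) (ttgt v) (tlab u) (tlab v) (tlab t) != 0].
Proof.
by rewrite /tmul; case: ifP => [/and3P[/eqP-> /eqP-> /eqP->]|]; rewrite ?eqxx.
Qed.

Lemma tmulA u v w t :
  \sum_z tmul u v z * tmul z w t = \sum_z tmul v w z * tmul u z t.
Proof.
have [/and4P[/eqP vu /eqP wv /eqP ut /eqP wt]|N] :=
  boolP [&& tsrc v == ttgt u, tsrc w == ttgt v, tsrc u == tsrc t & ttgt w == ttgt t];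
  last first.
  rewrite !big1 // => z _; apply/eqP; rewrite mulf_eq0; apply/norP => -[].
    move=> /tmul_neq0[E1 E2 E3 _] /tmul_neq0[F1 F2 F3 _]; case/negP: N.
    by rewrite E1 E2 E3 F1 F2 F3 !eqxx.
  move=> /tmul_neq0[E1 E2 E3 _] /tmul_neq0[F1 F2 F3 _]; case/negP: N.
  by rewrite E1 E2 E3 F1 F2 F3 !eqxx.
pose b := tsrc u; pose a := ttgt u; pose c := ttgt v; pose d := ttgt w.
have kba : pm_k b = pm_k a := tensorP u.
have kac : pm_k a = pm_k c by have := tensorP v; rewrite vu.
have kcd : pm_k c = pm_k d by have := tensorP w; rewrite wv.
have labu : is_labelling (pm_arc b) (pm_arc a) (tlab u) := tensor_labelling u.
have labv : is_labelling (pm_arc a) (pm_arc c) (tlab v).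
  by have := tensor_labelling v; rewrite vu.
have labw : is_labelling (pm_arc c) (pm_arc d) (tlab w).
  by have := tensor_labelling w; rewrite wv.
have labt : is_labelling (pm_arc b) (pm_arc d) (tlab t).
  by have := tensor_labelling t; rewrite -ut -wt.
transitivity (\sum_(z : tensor n | (tsrc z == b) && (ttgt z == c))
   mul_coef b a c (tlab u) (tlab v) (tlab z) * mul_coef b c d (tlab z) (tlab w) (tlab t)).
  rewrite [RHS]big_mkcond; apply: eq_bigr => z _.
  rewrite /tmul /composable vu eqxx wt eqxx andbT /= eq_sym -/b [c == _]eq_sym.
  case: eqP => [zb|]; last by rewrite mul0r.
  case: eqP => [zc|]; last by rewrite mul0r.
  by rewrite zb zc wv /b /c /d ut wt !eqxx.
rewrite (big_tensor (fun l => mul_coef b a c (tlab u) (tlab v) l *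
   mul_coef b c d l (tlab w) (tlab t))) ?kba // (mul_coefA labu labv labw labt).
rewrite -(big_tensor (fun l => mul_coef a c d (tlab v) (tlab w) l *
   mul_coef b a d (tlab u) l (tlab t))) ?kac //.
rewrite big_mkcond; apply: eq_bigr => z _.
rewrite /tmul /composable vu wv ut eqxx /= eqxx /= [a == _]eq_sym [d == _]eq_sym.
rewrite -/a -/c -/d.
case: eqP => [za|]; last by rewrite mul0r.
case: eqP => [zd|]; last by rewrite mul0r.
by rewrite zd /b /d wt ut eqxx.
Qed.

Lemma tmul_degree u v t : tmul u v t != 0 -> tdeg t = tdeg u + tdeg v.
Proof.
case/tmul_neq0 => ut vu vt nz; rewrite /tdeg -ut -vt vu.
have lu := tensor_labelling u; have lv := tensor_labelling v; rewrite vu in lv.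
rewrite (mul_coef_degree lu lv nz).
by rewrite addrACA addrA.
Qed.

Lemma ideal_tensorE t :
  ideal_tensor t = degen_label (pm_k (tsrc t)) (tsrc t) (ttgt t) (tlab t).
Proof.
set k : nat := pm_k _.
have m2 (P : pred 'I_n.*2) (C : {set 'I_n.*2}) :
    (1 < #|[set x in C | P x]|)%N = meets_twice id P C.
  apply/card_gt1P/meets_twiceP => -[x [y]].
    by rewrite !inE => -[/andP[xC Px] /andP[yC Py] xy]; exists x, y.
  by case=> xC yC Px Py xy; exists x, y; rewrite !inE xC yC.
have mE (C : {set 'I_n.*2}) : type_I k C =
    ~~ meets id (left_platform (n:=n) k) (right_platform (n:=n) k) C.
  rewrite /type_I /meets negb_exists; apply: eq_forallb => x.
  by rewrite negb_and negb_or implybE.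
have labt := tensor_labelling t.
rewrite /ideal_tensor -/k /tensor_circles; apply/orP/existsP.
  case=> /existsP[C /andP[/circlesP[x ->]]].
    by rewrite /type_III !m2 => /orP[]h; exists x; rewrite /= h ?orbT.
  rewrite labelled_X_circle // /type_II mE negbK => /andP[/andP[h _] lx].
  by exists x; rewrite /= h lx !orbT.
case=> x /=; set C := circle _ _ _.
have CC : C \in circles (pm_arc (tsrc t)) (pm_arc (ttgt t)) by exact: mem_circles.
rewrite orbA -!m2 -/(type_III k C) => /orP[h|/andP[h lx]].
  by left; apply/existsP; exists C; rewrite CC.
have [h3|h3] := boolP (type_III k C); first by left; apply/existsP; exists C; rewrite CC.
right; apply/existsP; exists C.
by rewrite CC /type_II h3 mE negbK h labelled_X_circle.
Qed.

Lemma tmul_ideal u v t : tmul u v t != 0 -> ideal_tensor u || ideal_tensor v ->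
  ideal_tensor t.
Proof.
case/tmul_neq0 => ut vu vt nz; rewrite !ideal_tensorE.
have lu := tensor_labelling u; have lv := tensor_labelling v; rewrite vu in lv.
rewrite -ut -vt vu -(tensorP u); exact: mul_coef_degenerate.
Qed.

Lemma idem_tensorE a : (tsrc (idem_tensor a) = a) * (ttgt (idem_tensor a) = a)
  * (tlab (idem_tensor a) = [ffun=> false]).
Proof. by []. Qed.

Lemma tmul1l a v t : tmul (idem_tensor a) v t = ((a == tsrc t) && (v == t))%:R.
Proof.
rewrite /tmul /composable !idem_tensorE.
case: (eqVneq v t) => [->|vt].
  rewrite andbT eqxx andbT eq_sym andbb; case: eqP => // ta.
  have := tensor_labelling t; rewrite ta => labt.
  by rewrite mul_coef1l // eqxx.
rewrite andbF; case: and3P => // -[/eqP ta /eqP va /eqP E].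
have labt := tensor_labelling t; have labv := tensor_labelling v.
rewrite va in labv; rewrite -ta -E in labt; rewrite mul_coef1l //.
case: eqP => // lE; case/eqP: vt; apply: tensor_eq => //.
by rewrite va ta.
Qed.

Lemma tmul1r a u t : tmul u (idem_tensor a) t = ((a == ttgt t) && (u == t))%:R.
Proof.
rewrite /tmul /composable !idem_tensorE.
case: (eqVneq u t) => [->|ut].
  rewrite andbT eqxx /= andbb; case: eqP => // ->.
  have labt := tensor_labelling t.
  by rewrite mul_coef1r // eqxx.
rewrite andbF; case: and3P => // -[/eqP E /eqP ua /eqP ta].
have labt := tensor_labelling t; have labu := tensor_labelling u.
rewrite -ua in labu; rewrite -ta -E in labt; rewrite -ua mul_coef1r //.
case: eqP => // lE; case/eqP: ut; apply: tensor_eq => //.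
by rewrite -ua.
Qed.

Lemma circle_card2 b c x :
  (1 < #|circle (pm_arc b) (pm_arc c) x|)%N.
Proof.
apply/card_gt1P; exists x, (pm_arc b x).
by rewrite !mem_circle same_circle_refl same_circle_o eq_sym pm_arc_neq.
Qed.

(** Twice the degree is a sum over the circles, since every one of the 2n points
    lies on exactly one circle: a circle with m points contributes m + 2 or m - 2,
    which is never negative. *)
Lemma tdeg_double t : tdeg t *+ 2 = \sum_(C in tensor_circles t)
  (#|C|%:Z + (if labelled_X (tlab t) C then 2%:Z else - 2%:Z)).
Proof.
rewrite big_split /= /tdeg mulrnDl [LHS]addrC; congr (_ + _).
  have /card_partition : partition (tensor_circles t) [set: 'I_n.*2].
    apply: equivalence_partitionP => x y z _ _ _; split; first exact: same_circle_refl.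
    move=> xy; apply/idP/idP; apply: same_circle_trans => //.
    by rewrite same_circle_sym //; apply: pm_arcK.
  rewrite cardsT card_ord => E; transitivity (n.*2)%:Z; first by rewrite mulr2n -PoszD addnn.
  apply: etrans (congr1 Posz E) _; exact: (big_morph Posz PoszD).
by rewrite /tensor_degree -sumrMnl; apply: eq_bigr => C _; case: ifP.
Qed.

Lemma tdeg_ge0 t : 0 <= tdeg t.
Proof.
suff : 0 <= tdeg t *+ 2 by rewrite pmulrn_lge0.
rewrite tdeg_double; apply: sumr_ge0 => C /circlesP[x ->].
by move: #|_| (circle_card2 (tsrc t) (ttgt t) x) => k; case: ifP => _; clear; lia.
Qed.

(** All circles have two points and label 1, so the two matchings have the same
    arcs. *)
Lemma tdeg_eq0 t : tdeg t = 0 -> t = idem_tensor (tsrc t).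
Proof.
move=> d0; have : tdeg t *+ 2 == 0 by rewrite d0.
rewrite tdeg_double psumr_eq0 => [/allP C0|C /circlesP[x ->]]; last first.
  by move: #|_| (circle_card2 (tsrc t) (ttgt t) x) => k; case: ifP => _; clear; lia.
have labt := tensor_labelling t.
have C1 x : #|circle (pm_arc (tsrc t)) (pm_arc (ttgt t)) x| = 2 /\ tlab t x = false.
  set C := circle _ _ _; have := C0 C (mem_index_enum _).
  rewrite mem_circles /= labelled_X_circle //.
  move: (circle_card2 (tsrc t) (ttgt t) x); rewrite -/C; move: #|C| => k.
  by case: (tlab t x) => h /eqP E; [exfalso | split=> //]; clear -h E; lia.
have E x : pm_arc (ttgt t) x = pm_arc (tsrc t) x.
  have [c2 _] := C1 x; set b := tsrc t in c2 *; set c := ttgt t in c2 *.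
  have sub : [set x; pm_arc b x] \subset circle (pm_arc b) (pm_arc c) x.
    apply/subsetP => y; rewrite !inE => /orP[]/eqP->.
      exact: same_circle_refl.
    exact: same_circle_o.
  have /eqP cE : [set x; pm_arc b x] == circle (pm_arc b) (pm_arc c) x.
    by rewrite eqEcard sub c2 cards2 eq_sym pm_arc_neq.
  have : pm_arc c x \in circle (pm_arc b) (pm_arc c) x.
    by rewrite mem_circle same_circle_i.
  by rewrite -cE !inE (negPf (pm_arc_neq _ _)) => /eqP.
have st : ttgt t = tsrc t.
  apply: val_inj; move: (tensorP t) E; rewrite /pm_k /pm_arc.
  case: (tsrc t) (ttgt t) => [[k f] p] [[k' f'] p'] /= kE fE.
  by rewrite kE; congr (_, _); apply/ffunP.
apply: tensor_eq; rewrite // !idem_tensorE; apply/ffunP => x.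
by rewrite ffunE; have [] := C1 x.
Qed.

Lemma idem_not_ideal a : ~~ ideal_tensor (idem_tensor a).
Proof.
rewrite ideal_tensorE !idem_tensorE; apply/existsPn => x /=.
have free k : (k = pm_k a :> nat) -> forall y, ~~ (left_platform k y && left_platform k (pm_arc a y))
    && ~~ (right_platform k y && right_platform k (pm_arc a y)).
  by move=> -> y; have /andP[_ /forallP/(_ y)] := valP a.
have tw (P : pred 'I_n.*2) : (forall y, ~~ (P y && P (pm_arc a y))) ->
    ~~ meets_twice id P (circle (pm_arc a) (pm_arc a) x).
  move=> PP; apply/meets_twiceP => -[y [z []]].
  rewrite !mem_circle !same_circle_pm !inE.
  move=> /orP[]/eqP-> /orP[]/eqP->; rewrite ?eqxx // => Py Pz _.
    by have := PP x; rewrite Py Pz.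
  by have := PP x; rewrite Py Pz.
rewrite ffunE andbF orbF negb_or !tw // => y; by have /andP[] := free _ erefl y.
Qed.

End Tensors.
(** * The quotient ring *)

Section ArcRing.
Variable n : nat.

(** The tensors outside the ideal, a basis of the quotient. *)
Definition qtensor := {t : tensor n | ~~ ideal_tensor t}.
HB.instance Definition _ := SubFinite.on qtensor.

Definition arc_ring := {ffun qtensor -> int}.
HB.instance Definition _ := GRing.Zmodule.on arc_ring.
Implicit Types (x y z : arc_ring) (s u v w : qtensor).

Definition qidem (a : pmatching n) : qtensor :=
  exist (fun t : tensor n => ~~ ideal_tensor t) _ (idem_not_ideal a).

Lemma qtensor_ideal s : ideal_tensor (val s) = false.
Proof. exact: negbTE (valP s). Qed.

Lemma val_qidem a : val (qidem a) = idem_tensor a. Proof. by []. Qed.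

Lemma big_qtensor (F : tensor n -> int) : (forall t, ideal_tensor t -> F t = 0) ->
  \sum_t F t = \sum_(s : qtensor) F (val s).
Proof.
move=> F0; rewrite (bigID (fun t => ideal_tensor t)) /= big1 // add0r.
pose f : qtensor -> tensor n := val; pose g : tensor n -> option qtensor := insub.
rewrite (reindex_omap f g) => [|t tN]; last by rewrite /g insubT.
by apply: eq_bigl => s; rewrite /f /g valK eqxx (valP s).
Qed.

Definition arc_mul x y : arc_ring :=
  [ffun s => \sum_(u : qtensor) \sum_(v : qtensor) x u * y v * tmul (val u) (val v) (val s)].
Definition arc_one : arc_ring := [ffun s => (s == qidem (tsrc (val s)))%:R].

(** The intermediate tensors of the ideal contribute nothing to a product outside
    the ideal, so [tmulA] can be restricted. *)
Lemma qtmulA u v w s :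
  \sum_(t : qtensor) tmul (val u) (val v) (val t) * tmul (val t) (val w) (val s) =
  \sum_(t : qtensor) tmul (val v) (val w) (val t) * tmul (val u) (val t) (val s).
Proof.
rewrite -(big_qtensor (F := fun t => tmul (val u) (val v) t * tmul t (val w) (val s))).
  rewrite -(big_qtensor (F := fun t => tmul (val v) (val w) t * tmul (val u) t (val s))).
    exact: tmulA.
  move=> t It; have [->|] := eqVneq (tmul (val u) t (val s)) 0; first by rewrite mulr0.
  by move=> /tmul_ideal; rewrite It orbT !qtensor_ideal => /(_ isT).
move=> t It; have [->|] := eqVneq (tmul t (val w) (val s)) 0; first by rewrite mulr0.
by move=> /tmul_ideal; rewrite It !qtensor_ideal => /(_ isT).
Qed.

Lemma arc_mulA : associative arc_mul.
Proof.
move=> x y z; apply/ffunP => s; rewrite !ffunE.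
transitivity (\sum_u \sum_v \sum_w x u * y v * z w *
   \sum_(t : qtensor) tmul (val v) (val w) (val t) * tmul (val u) (val t) (val s)).
  apply: eq_bigr => u _.
  under eq_bigr => t _ do rewrite ffunE mulr_sumr mulr_suml.
  rewrite exchange_big /=; apply: eq_bigr => v _.
  under eq_bigr => t _ do rewrite mulr_sumr mulr_suml.
  rewrite exchange_big /=; apply: eq_bigr => w _.
  rewrite mulr_sumr; apply: eq_bigr => t _; ring.
under eq_bigr => u _ do under eq_bigr => v _ do under eq_bigr => w _ do rewrite -qtmulA.
transitivity (\sum_(t : qtensor) \sum_w \sum_u \sum_v
   x u * y v * tmul (val u) (val v) (val t) * z w * tmul (val t) (val w) (val s)); last first.
  apply: eq_bigr => t _; apply: eq_bigr => w _; rewrite ffunE !mulr_suml.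
  by apply: eq_bigr => u _; rewrite !mulr_suml.
under [in RHS]eq_bigr => t _ do rewrite exchange_big /=.
rewrite [RHS]exchange_big /=; apply: eq_bigr => u _.
under [in RHS]eq_bigr => t _ do rewrite exchange_big /=.
rewrite [RHS]exchange_big /=; apply: eq_bigr => v _.
rewrite [RHS]exchange_big /=; apply: eq_bigr => w _.
rewrite mulr_sumr; apply: eq_bigr => t _; ring.
Qed.

Lemma arc_mul1l : left_id arc_one arc_mul.
Proof.
move=> y; apply/ffunP => s; rewrite ffunE exchange_big /= (bigD1 s) //=.
rewrite [X in _ + X]big1 ?addr0 => [|v vs]; last first.
  apply: big1 => u _; rewrite ffunE; case: eqP => [->|_]; last by rewrite !mul0r.
  by rewrite tmul1l (inj_eq val_inj) (negPf vs) andbF mulr0.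
rewrite (bigD1 (qidem (tsrc (val s)))) //= big1 ?addr0 => [|u us].
  by rewrite ffunE tmul1l /= !eqxx mul1r mulr1.
rewrite ffunE; case: eqP => [uE|_]; last by rewrite !mul0r.
rewrite [in tmul _ _ _]uE tmul1l; case: eqP => [E|_]; last by rewrite mulr0.
by case/eqP: us; rewrite uE -E.
Qed.

Lemma arc_mul1r : right_id arc_one arc_mul.
Proof.
move=> y; apply/ffunP => s; rewrite ffunE (bigD1 s) //=.
rewrite [X in _ + X]big1 ?addr0 => [|v vs]; last first.
  apply: big1 => u _; rewrite ffunE; case: eqP => [->|_]; last by rewrite mulr0 !mul0r.
  by rewrite tmul1r (inj_eq val_inj) (negPf vs) andbF mulr0.
rewrite (bigD1 (qidem (ttgt (val s)))) //= big1 ?addr0 => [|u us].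
  by rewrite ffunE tmul1r /= !eqxx !mulr1.
rewrite ffunE; case: eqP => [uE|_]; last by rewrite mulr0 !mul0r.
rewrite [in tmul _ _ _]uE tmul1r; case: eqP => [E|_]; last by rewrite mulr0.
by case/eqP: us; rewrite uE -E.
Qed.

Lemma arc_mulDl : left_distributive arc_mul +%R.
Proof.
move=> x y z; apply/ffunP => s; rewrite !ffunE -big_split; apply: eq_bigr => u _ /=.
by rewrite -big_split; apply: eq_bigr => v _ /=; rewrite ffunE !mulrDl.
Qed.

Lemma arc_mulDr : right_distributive arc_mul +%R.
Proof.
move=> x y z; apply/ffunP => s; rewrite !ffunE -big_split; apply: eq_bigr => u _ /=.
by rewrite -big_split; apply: eq_bigr => v _ /=; rewrite ffunE mulrDr !mulrDl.
Qed.

HB.instance Definition _ := GRing.Zmodule_isPzRing.Build arc_ring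
  arc_mulA arc_mul1l arc_mul1r arc_mulDl arc_mulDr.

Definition arc_deg (j : int) x : Prop := forall s, x s != 0 -> tdeg (val s) = j.

Lemma arc_grading : is_grading arc_deg.
Proof.
split=> [j|x|js h ujs hD h0 j jjs].
- split=> [s|x y xj yj s]; rewrite !ffunE ?eqxx // => nz.
  have [x0|] := eqVneq (x s) 0; last exact: xj.
  by apply: yj; move: nz; rewrite x0 sub0r oppr_eq0.
- exists (undup [seq tdeg (val s) | s <- enum {: qtensor}]).
  exists (fun j => [ffun s => if tdeg (val s) == j then x s else 0]); split.
  + exact: undup_uniq.
  + by move=> j s; rewrite ffunE; case: (tdeg (val s) =P j); rewrite ?eqxx.
  + apply/ffunP => s; rewrite sum_ffunE (bigD1_seq (tdeg (val s))) ?undup_uniq //=.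
      rewrite ffunE eqxx big1 ?addr0 // => j /negPf jN.
      by rewrite ffunE eq_sym jN.
    by rewrite mem_undup; apply: map_f; rewrite mem_enum.
apply/ffunP => s; apply/eqP; rewrite ffunE; apply/negPn/negP => nz.
have E : tdeg (val s) = j := hD j s nz.
have := congr1 (fun f : arc_ring => f s) h0; rewrite /= sum_ffunE ffunE.
rewrite (bigD1_seq j) //= big1 ?addr0 => [/eqP|k kj]; first by rewrite (negPf nz).
apply/eqP; apply: contraNT kj => /(hD k s) <-; by rewrite E.
Qed.

Lemma arc_deg1 : arc_deg 0 1.
Proof.
move=> s; rewrite ffunE; have [-> _|] := eqVneq s; last by rewrite eqxx.
exact: tdeg_idem.
Qed.

Lemma arc_degM i j x y : arc_deg i x -> arc_deg j y -> arc_deg (i + j) (x * y).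
Proof.
move=> xi yj s; rewrite ffunE => nz.
have [u /existsP[v /and3P[xu yv uv]]] : exists u, [exists v,
    [&& x u != 0, y v != 0 & tmul (val u) (val v) (val s) != 0]].
  apply/existsP; apply: contraNT nz => /existsPn E.
  apply/eqP; apply: big1 => u _; apply: big1 => v _; apply/eqP.
  have := E u; rewrite negb_exists => /forallP/(_ v).
  by rewrite !mulf_eq0 !negb_and !negbK orbA.
by rewrite (tmul_degree uv) (xi u) // (yj v).
Qed.

Definition arc_gring : gring := GRingPack arc_grading arc_deg1 arc_degM.

(** The projection to the quotient forgets the coefficients at the tensors of the
    ideal. *)
Definition arc_res (x : Atilde n) : arc_gring := [ffun s : qtensor => x (val s)].

Lemma arc_res_additive : zmod_morphism arc_res.
Proof. by move=> x y; apply/ffunP => s; rewrite !ffunE. Qed.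

HB.instance Definition _ :=
  GRing.isZmodMorphism.Build (Atilde n) arc_gring arc_res arc_res_additive.

Definition arc_ext x : Atilde n := [ffun t => oapp x 0 (insub t)].

Lemma arc_extK x : arc_res (arc_ext x) = x.
Proof. by apply/ffunP => s; rewrite !ffunE valK. Qed.

Lemma arc_res_surj (y : arc_gring) : exists x : Atilde n, arc_res x = y.
Proof. by exists (arc_ext y); exact: arc_extK. Qed.

Lemma arc_res_ker (x : Atilde n) : arc_res x = 0 <-> Atilde_ideal x.
Proof.
split=> [x0 t xt|Ix].
  apply: contraNT xt => tN; pose s : qtensor := exist _ t tN.
  have := congr1 (fun f : arc_ring => f s) x0.
  by rewrite /= !ffunE => ->.
apply/ffunP => s; rewrite !ffunE; apply/eqP/negPn/negP => /Ix.
by rewrite qtensor_ideal.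
Qed.

Lemma arc_res_one : arc_res (Atilde_one n) = 1.
Proof.
apply/ffunP => s; rewrite [RHS]ffunE [LHS]ffunE sum_ffunE -val_eqE val_qidem.
rewrite (bigD1 (tsrc (val s))) //= big1 => [|a aN].
  by rewrite addr0 ffunE.
by rewrite ffunE; case: (val s =P idem_tensor a) => // E; case/eqP: aN; rewrite E.
Qed.

Lemma arc_res_mul (x y : Atilde n) : arc_res (Atilde_mul x y) = arc_res x * arc_res y.
Proof.
apply/ffunP => s; rewrite [LHS]ffunE Atilde_mulE [RHS]ffunE.
rewrite (big_qtensor (F := fun t => \sum_t' x t * y t' * tmul t t' (val s))).
  apply: eq_bigr => u _.
  rewrite (big_qtensor (F := fun t => x (val u) * y t * tmul (val u) t (val s))).
    by apply: eq_bigr => v _; rewrite !ffunE.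
  move=> t It; have [->|/tmul_ideal] := eqVneq (tmul (val u) t (val s)) 0.
    by rewrite mulr0.
  by rewrite It orbT !qtensor_ideal => /(_ isT).
move=> t It; apply: big1 => t' _.
have [->|/tmul_ideal] := eqVneq (tmul t t' (val s)) 0; first by rewrite mulr0.
by rewrite It !qtensor_ideal => /(_ isT).
Qed.

Lemma arc_res_deg j (y : arc_gring) :
  rdeg j y <-> exists x : Atilde n, Atilde_deg j x /\ arc_res x = y.
Proof.
split=> [yj|[x [xj <-]] s]; last by rewrite ffunE => /xj.
exists (arc_ext y); split; last exact: arc_extK.
move=> t; rewrite ffunE; case: insubP => [s _ <-|_] //=.
exact: yj.
Qed.

Definition arc_quotient_model : arc_quotient n :=
  @ArcQuotient n arc_gring arc_res arc_res_surj arc_res_ker arc_res_one arc_res_mul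
    arc_res_deg.

End ArcRing.
(** * Matchings and Dyck words *)

Section Signs.
Variable n : nat.
Implicit Types (a b : pmatching n).

Lemma pm_free a x : ~~ (left_platform (pm_k a) x && left_platform (pm_k a) (pm_arc a x))
    && ~~ (right_platform (pm_k a) x && right_platform (pm_k a) (pm_arc a x)).
Proof. by have /andP[_ /forallP/(_ x)] := valP a. Qed.

Lemma left_platform_opens a x : left_platform (pm_k a) x -> (x < pm_arc a x)%N.
Proof.
move=> Lx; have := pm_free a x; rewrite Lx /= => /andP[nL _].
rewrite ltn_neqAle eq_sym val_eqE pm_arc_neq /= leqNgt; apply: contra nL.
by move=> lt; exact: ltn_trans lt Lx.
Qed.

Lemma right_platform_closes a x : right_platform (pm_k a) x -> (pm_arc a x < x)%N.
Proof.
move=> Rx; have := pm_free a x; rewrite Rx /= => /andP[_ nR].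
rewrite ltn_neqAle val_eqE pm_arc_neq /= leqNgt; apply: contra nR.
by move=> lt; apply: leq_trans Rx (ltnW lt).
Qed.

(** Whether a free point is the left end of its arc.  The free end of an arc to the
    left platform is a right end, hence the sign agrees with the factor v_(-1)
    of p_a there, and with the term v_1 (x) v_(-1) at the arcs between free points. *)
Definition signs a : {ffun 'I_n -> bool} :=
  [ffun i => (free_point (pm_k a) i < pm_arc a (free_point (pm_k a) i))%N].

Definition extend (s : {ffun 'I_n -> bool}) (j : nat) : bool := oapp s false (insub j).

Lemma extendE s (i : 'I_n) : extend s i = s i.
Proof. by rewrite /extend valK. Qed.

(** The bracket word of a matching, with [true] as opening bracket: n - k opening
    brackets for the left platform, the signs of the free points, and k closing
    brackets for the right platform. *)
Definition word (k : nat) (s : {ffun 'I_n -> bool}) (x : nat) : bool :=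
  if (x < n - k)%N then true
  else if (x < n.*2 - k)%N then extend s (x - (n - k)) else false.

Lemma word_signs a (x : 'I_n.*2) : word (pm_k a) (signs a) x = (x < pm_arc a x)%N.
Proof.
rewrite /word; case: ltnP => xl; first by rewrite left_platform_opens.
case: ltnP => xr; last first.
  by have lt := right_platform_closes xr; apply/esym/negbTE; rewrite -leqNgt ltnW.
have kn : (pm_k a <= n)%N by have := ltn_ord (pm_k a); rewrite ltnS.
have jn : (x - (n - pm_k a) < n)%N by clear -xr xl kn; lia.
have := extendE (signs a) (Ordinal jn); rewrite /= => ->; rewrite ffunE.
have -> : free_point (pm_k a) (Ordinal jn) = x; last by [].
by apply: val_inj => /=; clear -xl; lia.
Qed.

Lemma sum_bool_arcs a : (\sum_(x < n.*2) (x < pm_arc a x) = n)%N.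
Proof.
have E : (\sum_(x < n.*2) (x < pm_arc a x) = \sum_(x < n.*2) (pm_arc a x < x))%N.
  rewrite (reindex_inj (@pm_arc_inj _ a)); apply: eq_bigr => x _.
  by rewrite pm_arcK.
apply: double_inj; rewrite -addnn {2}E -big_split /=.
rewrite (eq_bigr (fun=> 1%N)) ?sum1_card ?card_ord // => x _.
by have := pm_arc_neq a x; rewrite -val_eqE neq_ltn; case: ltngtP.
Qed.

Lemma sum_word (k : nat) s : (k <= n)%N ->
  (\sum_(x < n.*2) word k s x = (n - k) + \sum_(i < n) s i)%N.
Proof.
move=> kn.
have -> : (\sum_(x < n.*2) word k s x = \sum_(0 <= x < n.*2) word k s x)%N.
  by rewrite big_mkord.
rewrite (big_cat_nat (n := (n - k)%N)) /=; [|by []|by clear -kn; lia].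
rewrite (big_cat_nat (m := (n - k)%N) (n := (n.*2 - k)%N)) /=; [|clear -kn; lia|clear; lia].
have -> : (\sum_(0 <= x < n - k) word k s x = n - k)%N.
  rewrite big_nat (eq_bigr (fun=> 1%N)) => [|x /andP[_ xl]]; last by rewrite /word xl.
  by rewrite -big_nat sum_nat_const_nat subn0 muln1.
have -> : (\sum_(n.*2 - k <= x < n.*2) word k s x = 0)%N.
  rewrite big_nat big1 // => x /andP[xl _]; rewrite /word ltnNge (leq_trans _ xl).
    by rewrite ltnNge xl.
  by clear -kn; lia.
rewrite addn0; congr (_ + _)%N.
have -> : (n.*2 - k = (n - k) + n)%N by clear -kn; lia.
rewrite -{1}[(n - k)%N]add0n big_addn addKn big_mkord; apply: eq_bigr => i _.
rewrite /word addnC ltnNge leq_addr /=.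
have -> : (n - k + i < n.*2 - k)%N by have := ltn_ord i; clear -kn; lia.
by rewrite addKn extendE.
Qed.

(** Half of the 2n points open an arc, among them the n - k points of the left
    platform.  So the signs determine k. *)
Lemma sum_signs a : (\sum_(i < n) signs a i = pm_k a)%N.
Proof.
have kn : (pm_k a <= n)%N by have := ltn_ord (pm_k a); rewrite ltnS.
have := sum_word (signs a) kn.
rewrite (eq_bigr (fun x : 'I_n.*2 => nat_of_bool (x < pm_arc a x)%N)) => [|x _].
  by rewrite sum_bool_arcs => E; clear -E kn; lia.
by rewrite word_signs.
Qed.

(** By descending induction on the opening point: if the arc of one matching were
    shorter, its end would close, in the other matching, an arc
    that opens strictly between, where the two matchings agree. *)
Lemma arcs_of_openings a b : (forall x : 'I_n.*2, (x < pm_arc a x) = (x < pm_arc b x))%N ->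
  forall x, pm_arc a x = pm_arc b x.
Proof.
move=> oab.
have key : forall (f g : pmatching n) (x : 'I_n.*2),
    (forall y : 'I_n.*2, (y < pm_arc f y) = (y < pm_arc g y))%N ->
    (forall z : 'I_n.*2, (x < z)%N -> (z < pm_arc f z)%N -> pm_arc f z = pm_arc g z) ->
    (x < pm_arc f x)%N -> ~~ (pm_arc f x < pm_arc g x)%N.
  move=> f g x ofg IH xo; apply/negP => lt.
  set y := pm_arc f x in xo lt.
  have yo : (pm_arc g y < y)%N.
    rewrite ltn_neqAle val_eqE pm_arc_neq /= leqNgt -ofg /y pm_arcK -leqNgt.
    exact: ltnW.
  have /andP[zx _] : (x < pm_arc g y < pm_arc g x)%N.
    by apply: pm_arc_between; rewrite xo.
  have := IH _ zx; rewrite ofg pm_arcK => /(_ yo) /(congr1 (pm_arc f)).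
  rewrite pm_arcK -/y => E; move: zx; rewrite E.
  by rewrite /y pm_arcK ltnn.
have op (x : 'I_n.*2) : (x < pm_arc a x)%N -> pm_arc a x = pm_arc b x.
  have [m] := ubnP (n.*2 - x); elim: m x => // m IHm x xm xo.
  have IH (z : 'I_n.*2) : (x < z)%N -> (z < pm_arc a z)%N -> pm_arc a z = pm_arc b z.
    by move=> xz; apply: IHm; have := ltn_ord z; clear -xm xz; lia.
  apply/eqP; rewrite -val_eqE eqn_leq; apply/andP; split; rewrite leqNgt.
    apply: (key b a) => // [z xz zo|]; last by rewrite -oab.
    by apply/esym/IH; rewrite // oab.
  exact: key.
move=> x; have [xo|] := boolP (x < pm_arc a x)%N; first exact: op.
rewrite -leqNgt leq_eqVlt val_eqE (negPf (pm_arc_neq a x)) /= => xc.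
have E : pm_arc a (pm_arc a x) = pm_arc b (pm_arc a x) by apply: op; rewrite pm_arcK.
by apply: (@pm_arc_inj _ b); rewrite -E !pm_arcK.
Qed.

Lemma signs_inj : injective signs.
Proof.
move=> a b sab; have kab : pm_k a = pm_k b.
  by apply: val_inj; rewrite /= -!sum_signs sab.
have oab (x : 'I_n.*2) : (x < pm_arc a x)%N = (x < pm_arc b x)%N.
  by rewrite -!word_signs sab kab.
have := arcs_of_openings oab; move: kab; clear.
case: a b => [[k f] p] [[k' f'] p']; rewrite /pm_k /pm_arc /= => kE E.
by apply: val_inj => /=; rewrite kE; congr (_, _); apply/ffunP.
Qed.

Section Dyck.
Variables (w : nat -> bool) (N : nat).
Definition height (x : nat) : int := \sum_(y < x) (if w y then 1%:Z else - 1%:Z).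
Hypotheses (hN : height N = 0) (h_ge0 : forall x, (x <= N)%N -> 0 <= height x).

Lemma heightS x : height x.+1 = height x + (if w x then 1%:Z else - 1%:Z).
Proof. by rewrite /height big_ord_recr. Qed.

(** The closing bracket [y] of [x] is the first position after which the height
    returns to its value before [x]. *)
Definition matched (x y : nat) : Prop :=
  [/\ (x < y)%N, height y.+1 = height x
    & forall z, (x < z <= y)%N -> height x < height z].

Lemma matched_opens x y : matched x y -> w x.
Proof.
case=> xy _ /(_ x.+1); rewrite ltnSn xy heightS => /(_ isT).
by case: (w x) => //; clear; lia.
Qed.

Lemma matched_closes x y : matched x y -> ~~ w y.
Proof.
case=> xy hy /(_ y); rewrite xy leqnn -hy heightS => /(_ isT).
by case: (w y) => //; clear; lia.
Qed.

Lemma matched_right x y y' : matched x y -> matched x y' -> y = y'.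
Proof.
wlog yy' : y y' / (y < y')%N => [W m m'|].
  by case: (ltngtP y y') => // lt; [exact: W | apply/esym/W].
case=> xy hy _ [xy' hy' m']; have := m' y.+1; rewrite hy ltxx => W.
by have := W (introT andP (conj (ltnW xy : (x < y.+1)%N) yy')).
Qed.

Lemma matched_left x x' y : matched x y -> matched x' y -> x = x'.
Proof.
wlog xx' : x x' / (x < x')%N => [W m m'|].
  by case: (ltngtP x x') => // lt; [exact: W | apply/esym/W].
case=> xy hy m [xy' hy' _]; have := m x'; rewrite -hy hy' ltxx => W.
by have := W (introT andP (conj xx' (ltnW xy'))).
Qed.

(** The height ends at 0 and is non-negative before, so it eventually comes
    back. *)
Lemma exists_closing x : (x < N)%N -> w x -> exists2 y, (y < N)%N & matched x y.
Proof.
move=> xN wx.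
have ex : exists y, (x <= y)%N && (height y.+1 <= height x).
  exists N.-1; have N0 : (0 < N)%N by exact: leq_ltn_trans xN.
  rewrite prednK // hN h_ge0 ?(ltnW xN) // andbT; clear -xN; lia.
have := ex_minnP ex; case=> y /andP[xy hy] ymin.
have yN : (y < N)%N.
  have N0 : (0 < N)%N by exact: leq_ltn_trans xN.
  have := ymin N.-1; rewrite prednK // hN h_ge0 ?(ltnW xN) // andbT => W.
  have : (y <= N.-1)%N by apply: W; clear -xN; lia.
  by clear -N0; lia.
have above z : (x < z <= y)%N -> height x < height z.
  case: z => // z /andP[xz zy]; rewrite ltNge; apply/negP => hz.
  by have := ymin z; rewrite hz andbT => /(_ xz); clear -zy; lia.
have xy' : (x < y)%N.
  rewrite ltn_neqAle xy andbT; apply/eqP => E; move: hy; rewrite -E heightS wx.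
  by clear; lia.
exists y => //; split=> //; apply/eqP; rewrite eq_le hy /=.
have := above y; rewrite xy' leqnn => /(_ isT); rewrite heightS.
by case: (w y); clear; lia.
Qed.

Lemma exists_opening y : (y < N)%N -> ~~ w y -> exists2 x, (x < N)%N & matched x y.
Proof.
move=> yN wy.
have ex : exists x, (x <= y)%N && (height x <= height y.+1).
  by exists 0%N; rewrite /= {1}/height big_ord0 h_ge0.
have bound x : (x <= y)%N && (height x <= height y.+1) -> (x <= y)%N by case/andP.
have := ex_maxnP ex bound; case=> x /andP[xy hx] xmax.
have above z : (x < z <= y)%N -> height y.+1 < height z.
  case/andP=> xz zy; rewrite ltNge; apply/negP => hz.
  by have := xmax z; rewrite hz zy => /(_ isT); clear -xz; lia.
have xy' : (x < y)%N.
  rewrite ltn_neqAle xy andbT; apply/eqP => E; move: hx; rewrite E heightS (negPf wy).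
  by clear; lia.
have E : height y.+1 = height x.
  apply/eqP; rewrite eq_le hx andbT.
  have := above x.+1; rewrite ltnSn xy' (heightS x) => /(_ isT).
  by move: (height y.+1) => h; case: (w x); clear; lia.
exists x; first exact: ltn_trans xy' yN.
by split=> // z /above; rewrite E.
Qed.

Lemma dyck_matching : exists f : {ffun 'I_N -> 'I_N},
  [/\ forall x, (f x != x) && (f (f x) == x),
      forall x y : 'I_N, ~~ [&& x < y, y < f x & f x < f y]%N
    & forall x : 'I_N, (x < f x)%N = w x].
Proof.
have partner (x : 'I_N) : exists y : 'I_N, matched x y \/ matched y x.
  have [wx|wx] := boolP (w x).
    by have [y yN m] := exists_closing (ltn_ord x) wx; exists (Ordinal yN); left.
  by have [y yN m] := exists_opening (ltn_ord x) wx; exists (Ordinal yN); right.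
have [f fP] := choice partner.
have fu (x y : 'I_N) : matched x y \/ matched y x -> f x = y.
  move=> xy; apply: val_inj; case: (fP x) xy => m [m'|m'].
  - exact: matched_right m m'.
  - by have := matched_opens m; rewrite (negPf (matched_closes m')).
  - by have := matched_opens m'; rewrite (negPf (matched_closes m)).
  - exact: matched_left m m'.
have op (x : 'I_N) : (x < f x)%N = w x.
  case: (fP x) => m; first by rewrite (matched_opens m); case: m.
  rewrite (negPf (matched_closes m)); apply/negbTE; rewrite -leqNgt ltnW //.
  by case: m.
exists [ffun x => f x]; split=> [x|x y|x]; rewrite !ffunE //.
  apply/andP; split.
    by apply/eqP => E; case: (fP x) => -[]; rewrite E ltnn.
  by apply/eqP/fu; case: (fP x); [right|left].
apply/negP => /and3P[xy yfx fxfy].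
have mx : matched x (f x).
  case: (fP x) => // -[lt _ _]; have := ltn_trans (ltn_trans lt xy) yfx.
  by rewrite ltnn.
have my : matched y (f y).
  case: (fP y) => // -[lt _ _]; have := ltn_trans (ltn_trans lt yfx) fxfy.
  by rewrite ltnn.
case: mx my => _ hx mx [_ _ my].
have h1 : height x < height y by apply: mx; rewrite xy ltnW.
have h2 : height y < height (f x).+1 by apply: my; rewrite ltnS ltnW.
by have := lt_trans h1 h2; rewrite hx ltxx.
Qed.

End Dyck.
End Signs.

Section Realise.
Variables (n : nat) (s : {ffun 'I_n -> bool}).
Let k : nat := \sum_(i < n) s i.

Lemma sum_signs_le : (k <= n)%N.
Proof.
rewrite -[X in (_ <= X)%N](card_ord n) -sum1_card; apply: leq_sum => i _.
exact: leq_b1.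
Qed.

Let w := word k s.
Let kn := sum_signs_le.

Lemma height_left x : (x <= n - k)%N -> height w x = x%:Z.
Proof.
elim: x => [|x IHx] xk; first by rewrite /height big_ord0.
by rewrite heightS IHx 1?ltnW // /w /word xk; clear; lia.
Qed.

Lemma height_mid j : (j <= n)%N -> height w (n - k + j) =
  (n - k)%N%:Z + (\sum_(i < j) extend s i)%N%:Z - (\sum_(i < j) ~~ extend s i)%N%:Z.
Proof.
elim: j => [|j IHj] jn; first by rewrite addn0 height_left // !big_ord0 addr0 subr0.
rewrite addnS heightS IHj 1?ltnW // !big_ord_recr /= !PoszD.
have -> : w (n - k + j) = extend s j.
  rewrite /w /word ltnNge leq_addr /=.
  have -> : (n - k + j < n.*2 - k)%N by clear -jn kn; lia.
  by rewrite addKn.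
by case: (extend s j); clear; lia.
Qed.

Lemma sum_extend : (\sum_(i < n) extend s i = k)%N.
Proof. by apply: eq_bigr => i _; rewrite extendE. Qed.

Lemma sum_extendN : (\sum_(i < n) ~~ extend s i = n - k)%N.
Proof.
have : (\sum_(i < n) extend s i + \sum_(i < n) ~~ extend s i = n)%N.
  rewrite -big_split /= (eq_bigr (fun=> 1%N)) ?sum1_card ?card_ord // => i _.
  by case: (extend s i).
by rewrite sum_extend => E; apply: (@addnI k); rewrite E subnKC.
Qed.

Lemma height_right j : (j <= k)%N -> height w (n.*2 - k + j) = k%:Z - j%:Z.
Proof.
elim: j => [|j IHj] jk.
  have -> : (n.*2 - k + 0 = n - k + n)%N by clear -kn; lia.
  by rewrite height_mid // sum_extend sum_extendN; clear; lia.
rewrite addnS heightS IHj 1?ltnW //.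
have -> : w (n.*2 - k + j) = false.
  rewrite /w /word; have -> : (n.*2 - k + j < n - k)%N = false by clear -kn; lia.
  by have -> : (n.*2 - k + j < n.*2 - k)%N = false by clear; lia.
by clear; lia.
Qed.

Lemma height_end : height w n.*2 = 0.
Proof.
have -> : n.*2 = (n.*2 - k + k)%N by clear -kn; lia.
by rewrite height_right // subrr.
Qed.

(** The word rises along the left platform, ends by falling to 0 along the right
    one, and in between falls at most n - k times, the number of signs [false]. *)
Lemma height_ge0 x : (x <= n.*2)%N -> 0 <= height w x.
Proof.
move=> xn; have [xk|xk] := leqP x (n - k); first by rewrite height_left.
have [xk'|xk'] := leqP x (n.*2 - k); last first.
  have -> : x = (n.*2 - k + (x - (n.*2 - k)))%N by clear -xk'; lia.
  by rewrite height_right; clear -xk' xn kn; lia.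
have -> : x = (n - k + (x - (n - k)))%N by clear -xk; lia.
have jn : (x - (n - k) <= n)%N by clear -xk' kn; lia.
rewrite height_mid //; move: (x - (n - k))%N jn => j jn.
have : (\sum_(i < j) ~~ extend s i <= n - k)%N.
  rewrite -sum_extendN (big_ord_widen _ (fun i => ~~ extend s i : nat) jn).
  by rewrite big_mkcond; apply: leq_sum => i _; case: ifP.
move: (\sum_(i < j) extend s i)%N (\sum_(i < j) ~~ extend s i)%N => u v.
by clear; lia.
Qed.

(** The word of [s] for the [k] counting its signs [true] is a Dyck word; its
    matching has no arc within a platform, since a platform consists of equal
    brackets. *)
Lemma signs_surj : exists a : pmatching n, signs a = s.
Proof.
have [f [f1 f2 f3]] := dyck_matching height_end height_ge0.
have k' : (k < n.+1)%N by rewrite ltnS.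
have fN x : (f x < x)%N = ~~ w x.
  rewrite -f3 -leqNgt ltn_neqAle; case/andP: (f1 x) => fx _.
  by rewrite val_eqE fx.
have fK x : f (f x) = x by case/andP: (f1 x) => _ /eqP.
have pm : is_pmatching (Ordinal k', f).
  rewrite /is_pmatching /=; apply/andP; split.
    apply/andP; split; first by apply/forallP => x; exact: f1.
    by apply/forallP => x; apply/forallP => y; exact: f2.
  have L (x : 'I_n.*2) : left_platform k x -> w x by rewrite /left_platform /w /word => ->.
  have R (x : 'I_n.*2) : right_platform k x -> ~~ w x.
    rewrite /right_platform /w /word => xk; rewrite ltnNge.
    have -> : (n - k <= x)%N by clear -xk kn; lia.
    by rewrite /= ltnNge xk.
  have op x : w (f x) = ~~ w x by rewrite -f3 fK fN.
  apply/forallP => x; apply/andP; split; apply/negP => /andP[].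
    by move=> /L wx /L; rewrite op wx.
  by move=> /R wx /R; rewrite op wx.
exists (PMatching pm); apply/ffunP => i; rewrite ffunE.
rewrite -[LHS]/(free_point (Ordinal k') i < f (free_point (Ordinal k') i))%N f3.
rewrite /w /word /= ltnNge leq_addr /=.
have -> : (n - k + i < n.*2 - k)%N by have := ltn_ord i; clear -kn; lia.
by rewrite addKn extendE.
Qed.

End Realise.

Lemma signs_bij n : bijective (@signs n).
Proof.
have [g gK] := choice (@signs_surj n).
by exists g => // a; apply: (@signs_inj n); rewrite gK.
Qed.

Lemma card_pmatching n : #|{: pmatching n}| = (2 ^ n)%N.
Proof.
by rewrite (bij_eq_card (signs_bij n)) card_ffun card_bool card_ord.
Qed.

(** * The vectors p_a form a basis *)

(** The lexicographic order on binary sequences, as the order of the numbers that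
    they denote; the digits of smaller index weigh more. *)
Fixpoint binary (f : nat -> bool) (m : nat) : nat :=
  if m is m'.+1 then ((binary f m').*2 + f m')%N else 0%N.

Lemma binary_lt (f g : nat -> bool) i m : (i < m)%N ->
  (forall j, (j < i)%N -> f j = g j) -> ~~ f i -> g i -> (binary f m < binary g m)%N.
Proof.
move=> im fg fi gi.
have E j : (j <= i)%N -> binary f j = binary g j.
  by elim: j => //= j IHj ji; rewrite IHj 1?ltnW // fg.
elim: m im => // m IHm; rewrite ltnS leq_eqVlt => /orP[/eqP<-|/IHm lt] /=.
  by rewrite E // (negPf fi) gi; clear; lia.
by move: lt; case: (f m); case: (g m); clear; lia.
Qed.

Section Triangular.
Variables (S I : finType) (R : comNzRingType) (v : I -> {ffun S -> R^o}).
Variables (lead : I -> S) (rk : S -> nat).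
Hypothesis lead_bij : bijective lead.
Hypothesis v_lead : forall i, v i (lead i) = 1.
Hypothesis v_lower : forall i s, v i s != 0 -> s = lead i \/ (rk s < rk (lead i))%N.

(** Induction on a bound [m] for the ranks in the support: the vectors whose
    leading rank is [m] cancel the top coefficients of [x]. *)
Lemma triangular_span m (x : {ffun S -> R^o}) :
  (forall s, x s != 0 -> (rk s < m)%N) -> exists c : {ffun I -> R}, x = \sum_i c i *: v i.
Proof.
elim: m x => [|m IHm] x xm.
  exists 0; rewrite big1 => [|i _]; last by rewrite ffunE scale0r.
  by apply/ffunP => s; rewrite ffunE; apply/eqP/negPn/negP => /xm.
pose d : {ffun I -> R} := [ffun i => if rk (lead i) == m then x (lead i) else 0].
have [s|c E] := IHm (x - \sum_i d i *: v i); last first.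
  exists (c + d); rewrite -[LHS](subrK (\sum_i d i *: v i)) E -big_split /=.
  apply: eq_bigr => i _; rewrite -scalerDl; congr (_ *: _).
  by rewrite [RHS]ffunE.
have [g leadK gK] := lead_bij.
rewrite !ffunE sum_ffunE; under eq_bigr => i _ do rewrite ffunE.
rewrite ltnNge => nz; apply/negP => ms; move/negP: nz; apply; apply/eqP.
have [sm|sm] := eqVneq (rk s) m.
  have vs : v (g s) s = 1 by rewrite -[X in v _ X](gK s) v_lead.
  rewrite (bigD1 (g s)) //= ffunE gK sm eqxx vs.
  rewrite big1 ?addr0 => [|i ig]; first by rewrite -[_ *: _]/(x s * 1) mulr1 subrr.
  have [->|/v_lower[sE|lt]] := eqVneq (v i s) 0; first exact: mulr0.
    by case/eqP: ig; rewrite sE leadK.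
  by rewrite ffunE gtn_eqF ?scale0r // -sm.
have x0 : x s = 0.
  by apply/eqP/negPn/negP => /xm; rewrite ltnS leq_eqVlt (negPf sm) /= ltnNge ms.
rewrite x0 sub0r big1 ?oppr0 // => i _.
have [->|/v_lower[sE|lt]] := eqVneq (v i s) 0; first exact: mulr0.
  by rewrite ffunE -sE (negPf sm) scale0r.
by rewrite ffunE gtn_eqF ?scale0r //; exact: leq_ltn_trans ms lt.
Qed.

(** At the leading position of a vector of maximal rank among those with non-zero
    coefficient, all other vectors vanish. *)
Lemma triangular_free (c : {ffun I -> R}) : \sum_i c i *: v i = 0 -> c = 0.
Proof.
move=> c0; apply/ffunP => i; rewrite ffunE; apply/eqP/negPn/negP => ci.
have [j cj jmax] := arg_maxnP (fun i => rk (lead i)) (ci : (fun i => c i != 0) i).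
case/negP: cj; have := congr1 (fun f : {ffun S -> R^o} => f (lead j)) c0.
rewrite /= sum_ffunE ffunE (bigD1 j) //= ffunE v_lead big1 => [|l lj].
  by rewrite addr0 -[_ *: _]/(c j * 1) mulr1 => ->.
rewrite ffunE; have [->|cl] := eqVneq (c l) 0; first exact: scale0r.
have [->|/v_lower[/(bij_inj lead_bij) E|lt]] := eqVneq (v l (lead j)) 0.
- exact: mulr0.
- by case/eqP: lj.
- by have := leq_ltn_trans (jmax l cl) lt; rewrite ltnn.
Qed.

Lemma triangular_basis : is_basis v.
Proof.
move=> x; have [|c cE] := @triangular_span (\max_s rk s).+1 x.
  by move=> s _; rewrite ltnS leq_bigmax.
exists c; split=> // d dE; apply/eqP; rewrite -subr_eq0; apply/eqP.
apply: triangular_free; under eq_bigr => i _ do rewrite ffunE ffunE scalerBl.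
by rewrite sumrB -cE -dE subrr.
Qed.

End Triangular.

Section PVectors.
Variable n : nat.
Implicit Types a : pmatching n.

Lemma p_vec_signs a : p_vec a (signs a) = 1.
Proof.
rewrite /p_vec ffunE; set fp := free_point _.
rewrite [X in _ * X]big1 => [|i Ri]; last first.
  by rewrite ffunE -/fp; have := right_platform_closes Ri; rewrite pm_arcK => ->.
rewrite [X in _ * X * _]big1 => [|i Li]; last first.
  rewrite ffunE -/fp; have := left_platform_opens Li; rewrite pm_arcK => lt.
  by rewrite ltnNge (ltnW lt).
rewrite !mulr1; apply: big1 => i _; apply: big1 => j /andP[ij /eqP aij].
have fij : (fp i < fp j)%N by rewrite /= ltn_add2l.
have aji : pm_arc a (fp j) = fp i by rewrite -aij pm_arcK.
by rewrite !ffunE -/fp aij aji fij ltnNge (ltnW fij).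
Qed.

Lemma prod_neq0 (R : comNzRingType) (I : finType) (Q : pred I) (F : I -> R) i :
  \prod_(j | Q j) F j != 0 -> Q i -> F i != 0.
Proof.
by move=> nz Qi; apply: contraNneq nz => Fi; rewrite (bigD1 i) //= Fi mul0r.
Qed.

(** At the first place where a sequence [s] in the support of p_a differs from the
    signs of a, the point must open an arc: a closing point is determined by its
    opening end, which is earlier or on the platform.  So [s] has there the smaller
    sign. *)
Lemma p_vec_lower a s : p_vec a s != 0 ->
  s = signs a \/ (binary (extend s) n < binary (extend (signs a)) n)%N.
Proof.
rewrite /p_vec ffunE; set fp := free_point _ => nz.
have [|ne] := eqVneq s (signs a); [by left | right].
have [i0 si0] : exists i, s i != signs a i.
  by apply/existsP; apply: contraNT ne => /existsPn E; apply/eqP/ffunP => i;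
     apply/eqP; rewrite -[_ == _]negbK E.
have [i si imin] := @arg_minnP _ i0 (fun i => s i != signs a i) (@nat_of_ord n) si0.
have eqlt (j : 'I_n) : (j < i)%N -> s j = signs a j.
  by move=> ji; apply/eqP/negPn/negP => /imin; rewrite leqNgt ji.
move: nz; set X := \prod_(i0 < n) _; set Y := \prod_(i0 < n | _) _; set Z := \prod_(i0 < n | _) _.
move=> nz.
have Xnz : X != 0 by apply: contraNneq nz => ->; rewrite !mul0r.
have Ynz : Y != 0 by apply: contraNneq nz => ->; rewrite mulr0 mul0r.
have open : signs a i.
  apply/negPn/negP => nsa; have ns : s i.
    by move: si nsa; case: (s i); case: (signs a i).
  have cl : (pm_arc a (fp i) < fp i)%N.
    move: nsa; rewrite ffunE -/fp -leqNgt leq_eqVlt val_eqE.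
    by rewrite (negPf (pm_arc_neq _ _)).
  have [L|nL] := boolP (left_platform (pm_k a) (pm_arc a (fp i))).
    by have := prod_neq0 Ynz L; rewrite ns eqxx.
  have ltj : (pm_arc a (fp i) - (n - pm_k a) < n)%N.
    move: nL cl; rewrite /left_platform -leqNgt /=; have := ltn_ord i; clear; lia.
  pose j := Ordinal ltj.
  have fj : fp j = pm_arc a (fp i).
    by apply: val_inj; rewrite /= subnKC // leqNgt.
  have ji : (j < i)%N by move: cl; rewrite -fj /= ltn_add2l.
  have sj : signs a j by rewrite ffunE -/fp fj pm_arcK.
  have aji : pm_arc a (fp j) == fp i by rewrite fj pm_arcK.
  have := prod_neq0 Xnz (erefl : xpredT j).
  move=> /(@prod_neq0 _ _ _ _ i) /(_ _); rewrite ji aji (eqlt j ji) sj ns eqxx.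
  by move=> /(_ isT).
apply: (binary_lt (i := i)) => //; last by rewrite extendE.
  move=> m mi; have mn := ltn_trans mi (ltn_ord i).
  have := eqlt (Ordinal mn) mi; by rewrite -!extendE.
by rewrite extendE; move: si; rewrite open; case: (s i).
Qed.

Lemma p_vec_basis : is_basis (@p_vec n).
Proof.
exact: (triangular_basis (signs_bij n) p_vec_signs p_vec_lower).
Qed.

End PVectors.
(** * Graded rings whose part of degree 0 is a product of copies of Z *)

Section Grading.
Variables (M : zmodType) (D : int -> M -> Prop).
Hypothesis gr : is_grading D.

Lemma deg0 j : D j 0. Proof. by case: gr => /(_ j)[]. Qed.
Lemma degB j x y : D j x -> D j y -> D j (x - y).
Proof. by case: gr => /(_ j)[_ h] _ _; exact: h. Qed.
Lemma degN j x : D j x -> D j (- x).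
Proof. by move=> xj; rewrite -sub0r; apply: degB => //; apply: deg0. Qed.
Lemma degD j x y : D j x -> D j y -> D j (x + y).
Proof. by move=> xj yj; rewrite -[y]opprK; apply: degB => //; apply: degN. Qed.
Lemma deg_sum j (I : Type) (r : seq I) (P : pred I) (F : I -> M) :
  (forall i, P i -> D j (F i)) -> D j (\sum_(i <- r | P i) F i).
Proof. by move=> h; apply: big_ind => //; [exact: deg0 | exact: degD]. Qed.
Lemma degMn j x k : D j x -> D j (x *+ k).
Proof. by move=> xj; elim: k => [|k IHk]; [exact: deg0 | rewrite mulrS; apply: degD]. Qed.
Lemma degMz j x (c : int) : D j x -> D j (x *~ c).
Proof.
by move=> xj; case: c => k; rewrite ?NegzE ?mulrNz -?pmulrn; [|apply: degN]; apply: degMn.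
Qed.

(** In a decomposition of a homogeneous element only the component of its own
    degree survives. *)
Lemma grading_component d w (s : seq int) (k : int -> M) :
  D d w -> uniq s -> (forall j, D j (k j)) -> w = \sum_(j <- s) k j ->
  w = if d \in s then k d else 0.
Proof.
move=> wd us kD wE; have [_ _ indep] := gr.
pose k' j := (if j \in s then k j else 0) - (if j == d then w else 0).
have k'D j : D j (k' j).
  apply: degB; first by case: ifP => _ //; apply: deg0.
  by case: eqP => [->|_] //; apply: deg0.
have : k' d = 0; last first.
  by rewrite /k' eqxx => /eqP; rewrite subr_eq0 => /eqP.
have [u [uu du su]] : exists u, [/\ uniq u, d \in u & {subset s <= u}].
  exists (undup (d :: s)); split; first exact: undup_uniq.
    by rewrite mem_undup mem_head.
  by move=> j js; rewrite mem_undup inE js orbT.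
apply: (indep u k') => //.
rewrite sumrB [X in _ - X](bigD1_seq d) //= eqxx.
rewrite [X in _ - (_ + X)]big1 => [|j /negPf->//]; rewrite addr0.
apply/eqP; rewrite subr_eq0 wE -big_mkcond /=; apply/eqP.
rewrite -big_filter; apply: perm_big; apply: uniq_perm => //.
  by rewrite filter_uniq.
by move=> j; rewrite mem_filter; apply/andP/idP => [[]//|js]; split=> //; apply: su.
Qed.

End Grading.

(** A preimage can be replaced by its component of the right degree. *)
Lemma gproj_lift_degree (A : gring) (M N : gmod A) (g : {linear M -> N}) d z :
  ghom g -> mdeg d (g z) -> exists z', mdeg d z' /\ g z' = g z.
Proof.
move=> gg gz; have [_ spanM _] := mdeg_grading M.
have [s [h [us hD zE]]] := spanM z.
have E := grading_component (mdeg_grading N) gz us (fun j => gg j _ (hD j)).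
rewrite E; last by rewrite zE raddf_sum.
case: ifP => _; first by exists (h d).
by exists 0; rewrite raddf0; split=> //; apply: (deg0 (mdeg_grading M)).
Qed.

(** Non-negatively graded rings whose part of degree 0 is the product of the rings
    Z e_a.  The classification of projectives uses nothing else about the arc
    rings. *)
Record basic_gring (A : gring) (B : finType) (e : B -> A) : Prop := BasicGring {
  bg_neg : forall j (y : A), j < 0 -> rdeg j y -> y = 0;
  bg_deg : forall a, rdeg 0 (e a);
  bg_mul : forall a b, e a * e b = if a == b then e a else 0;
  bg_sum : \sum_a e a = 1;
  bg_zero : forall y : A, rdeg 0 y -> exists c : B -> int, y = \sum_a e a *~ c a;
  bg_free : forall a c, e a *~ c = 0 -> c = 0 }.

Section BasicRing.
Variables (A : gring) (B : finType) (e : B -> A).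
Hypothesis bas : basic_gring e.
Let grA := rdeg_grading A.

Lemma idem_sq a : e a * e a = e a.
Proof. by rewrite (bg_mul bas) eqxx. Qed.

Lemma idem_neq0 a : e a != 0.
Proof.
apply/eqP => ea; suff : 1 = 0 :> int by [].
by apply: (bg_free bas (a := a)); rewrite mulr1z.
Qed.

(** The integer coefficient of e_a in y, defined by e_a y e_a = c e_a.  Such c
    exists for y of degree 0; the value 0 in the other cases is a default. *)
Definition cf (a : B) (y : A) : int :=
  if pselect (exists c, e a * y * e a = e a *~ c) is left E then projT1 (cid E) else 0.

Lemma cf_unique a y c : e a * y * e a = e a *~ c -> cf a y = c.
Proof.
move=> yc; rewrite /cf; case: pselect => [E|[]]; last by exists c.
case: cid => c' /= yc'; apply/eqP; rewrite -subr_eq0; apply/eqP.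
by apply: (bg_free bas (a := a)); rewrite mulrzBr -yc' -yc subrr.
Qed.

Lemma idem_mulr a y : rdeg 0 y -> y * e a = e a *~ cf a y.
Proof.
move=> /(bg_zero bas)[c yE].
have E : y * e a = e a *~ c a.
  rewrite yE mulr_suml (bigD1 a) //= big1 => [|b ba].
    by rewrite addr0 mulrzAl idem_sq.
  by rewrite mulrzAl (bg_mul bas) (negPf ba) mul0rz.
rewrite E; congr (_ *~ _); apply/esym/cf_unique.
by rewrite -mulrA E mulrzAr idem_sq.
Qed.

Lemma idem_mull a y : rdeg 0 y -> e a * y = e a *~ cf a y.
Proof.
move=> /(bg_zero bas)[c yE].
have E : e a * y = e a *~ c a.
  rewrite yE mulr_sumr (bigD1 a) //= big1 => [|b ba].
    by rewrite addr0 mulrzAr idem_sq.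
  by rewrite mulrzAr (bg_mul bas) eq_sym (negPf ba) mul0rz.
by rewrite E; congr (_ *~ _); apply/esym/cf_unique; rewrite E mulrzAl idem_sq.
Qed.

Lemma cf_idem a c : cf a (e a *~ c) = c.
Proof. by apply: cf_unique; rewrite mulrzAr mulrzAl !idem_sq. Qed.

Lemma cf0 a : cf a 0 = 0.
Proof. by apply: cf_unique; rewrite mulr0 mul0r mulr0z. Qed.

Lemma cfD a y z : rdeg 0 y -> rdeg 0 z -> cf a (y + z) = cf a y + cf a z.
Proof.
move=> y0 z0; apply: cf_unique; rewrite mulrDr mulrDl !idem_mull //.
by rewrite !mulrzAl !idem_sq mulrzDr.
Qed.

Lemma cfN a y : rdeg 0 y -> cf a (- y) = - cf a y.
Proof.
move=> y0; apply: cf_unique; rewrite mulrN mulNr idem_mull // mulrzAl idem_sq.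
by rewrite mulrNz.
Qed.

Lemma cfM a y z : rdeg 0 y -> rdeg 0 z -> cf a (y * z) = cf a y * cf a z.
Proof.
move=> y0 z0; apply: cf_unique; rewrite mulrA idem_mull // -mulrA idem_mulr //.
by rewrite mulrzAl mulrzAr idem_sq -mulrzA mulrC.
Qed.

Lemma cfMz a y c : rdeg 0 y -> cf a (y *~ c) = cf a y * c.
Proof.
by move=> y0; apply: cf_unique; rewrite mulrzAr mulrzAl idem_mull // mulrzAl idem_sq -mulrzA.
Qed.

Lemma cf_sum a (I : Type) (r : seq I) (P : pred I) (F : I -> A) :
  (forall i, P i -> rdeg 0 (F i)) ->
  cf a (\sum_(i <- r | P i) F i) = \sum_(i <- r | P i) cf a (F i).
Proof.
move=> h; suff [] : rdeg 0 (\sum_(i <- r | P i) F i) /\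
   cf a (\sum_(i <- r | P i) F i) = \sum_(i <- r | P i) cf a (F i) by [].
apply: (big_rec2 (fun y c => rdeg 0 y /\ cf a y = c)).
  by split; [exact: (deg0 grA) | exact: cf0].
move=> i y c Pi [y0 <-]; split; first by apply: (degD grA) => //; exact: h.
by rewrite cfD //; exact: h.
Qed.

Notation type := (B * int)%type.

(** A homomorphism P_a{i} -> P_b{j} -> P_a{i} that factors through a different type
    is 0: if i and j differ, one of the two factors has negative degree, and
    otherwise y has degree 0 and is a multiple of e_a e_b = 0. *)
Lemma types_orth (t u : type) (y z : A) : t != u ->
  rdeg (t.2 - u.2) y -> e t.1 * y = y -> y * e u.1 = y -> rdeg (u.2 - t.2) z ->
  y * z = 0.
Proof.
move=> tu yd ey ye zd; case: (ltgtP t.2 u.2) => tu2.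
- by rewrite (bg_neg bas _ yd) ?mul0r // subr_lt0.
- by rewrite (bg_neg bas _ zd) ?mulr0 // subr_lt0.
have tu1 : t.1 != u.1 by apply: contra tu => /eqP tu1; rewrite -pair_eqE /= tu1 tu2 !eqxx.
move: yd; rewrite tu2 subrr => y0.
suff -> : y = 0 by rewrite mul0r.
by rewrite -ye -ey -mulrA idem_mulr // mulrzAr (bg_mul bas) (negPf tu1) mul0rz.
Qed.

Section Vectors.
Variable P : gmod A.
Let grP := mdeg_grading P.

(** A vector of type [t = (a, i)], homogeneous of degree i and fixed by e_a, is a
    homomorphism P_a{i} -> P; a functional of type [t] is a homomorphism
    P -> P_a{i}, with P_a{i} seen inside the shifted free module of rank 1. *)
Definition homvec (t : type) (x : P) := mdeg t.2 x /\ e t.1 *: x = x.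
Definition homcov (t : type) (phi : {linear P -> A^o}) :=
  (forall d y, mdeg d y -> rdeg (d - t.2) (phi y : A))
  /\ forall y, (phi y : A) * e t.1 = phi y.

Lemma vec_cov t u x phi : homvec t x -> homcov u phi ->
  [/\ rdeg (t.2 - u.2) (phi x : A), e t.1 * (phi x : A) = phi x
    & (phi x : A) * e u.1 = phi x].
Proof.
move=> [xd xe] [pd pe]; split; [exact: pd | | exact: pe].
by rewrite -[in RHS]xe linearZ.
Qed.

Lemma vec_cov_cf t x phi : homvec t x -> homcov t phi ->
  rdeg 0 (phi x : A) /\ (phi x : A) = e t.1 *~ cf t.1 (phi x).
Proof.
move=> xt pt; have [pd ep pe] := vec_cov xt pt; rewrite subrr in pd.
by split=> //; rewrite -[LHS]pe idem_mulr.
Qed.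

Lemma homvec0 t : homvec t 0.
Proof. by split; [exact: (deg0 grP) | rewrite scaler0]. Qed.
Lemma homvecB t x y : homvec t x -> homvec t y -> homvec t (x - y).
Proof.
by move=> [xd xe] [yd ye]; split; [exact: (degB grP) | rewrite scalerBr xe ye].
Qed.
Lemma homvec_sumz t (I : finType) (x : I -> P) (v : I -> int) :
  (forall i, v i != 0 -> homvec t (x i)) -> homvec t (\sum_i x i *~ v i).
Proof.
move=> xt; have xt' i : homvec t (x i *~ v i).
  have [->|vi] := eqVneq (v i) 0; first by rewrite mulr0z; exact: homvec0.
  have [xd xe] := xt i vi; split; first exact: (degMz grP).
  by rewrite -scalerMzr xe.
split; first by apply: (deg_sum grP) => i _; case: (xt' i).
by rewrite scaler_sumr; apply: eq_bigr => i _; case: (xt' i).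
Qed.

End Vectors.
End BasicRing.
(** * Idempotent integer matrices *)

(** Write M = L D R with D diagonal.  Then D (R L) D = D, so d_i (R L)_ii = 1 for
    every non-zero diagonal entry d_i, and M has the unit d_i (R L)_ii as a value
    of its bilinear form. *)
Lemma idempotent_unit_minor N (M : 'M[int]_N) : M *m M = M -> M != 0 ->
  exists (v : 'rV_N) (u : 'cV_N), v *m M *m u = 1%:M.
Proof.
move=> MM M0; have [L Lu [R Ru [d _ ME]]] := int_Smith_normal_form M.
set D := (\matrix_(i, j) _) in ME.
have DD : D *m (R *m L) *m D = D.
  move: MM; rewrite ME => /(congr1 (fun X => invmx L *m X *m invmx R)).
  by rewrite /= !mulmxA !(mulmxK Ru) !(mulVmx Lu) !mul1mx.
have [i di] : exists i : 'I_N, d`_i != 0.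
  apply/existsP; apply: contraNT M0 => /existsPn d0; rewrite ME.
  suff -> : D = 0 by rewrite mulmx0 mul0mx.
  apply/matrixP => i j; rewrite !mxE; have /negPn/eqP -> := d0 i.
  by case: eqP.
have colD j : \sum_k D i k * (R *m L) k j = d`_i * (R *m L) i j.
  rewrite (bigD1 i) //= big1 => [|k ki]; first by rewrite mxE eqxx addr0.
  by rewrite mxE -val_eqE eq_sym /= in ki *; rewrite (negPf ki) mul0r.
have unit_i : d`_i * (R *m L) i i = 1.
  have := congr1 (fun X : 'M_N => X i i) DD; rewrite /= mxE (bigD1 i) //= big1 => [|k ki].
    rewrite addr0 [X in X * _]mxE colD [in RHS]mxE [D i i]mxE eqxx => E.
    by apply: (mulIf di); rewrite mul1r.
  by rewrite [D k i]mxE -val_eqE /= in ki *; rewrite (negPf ki) mulr0.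
exists (row i (invmx L)), (col i L).
have -> : row i (invmx L) *m M = row i (D *m R).
  by rewrite -row_mul ME -!mulmxA (mulmxA (invmx L)) mulVmx // mul1mx.
apply/matrixP => x y; rewrite !ord1 [RHS]mxE eqxx -unit_i -colD.
transitivity ((D *m R *m L) i i); last by rewrite -mulmxA mxE.
by rewrite !mxE; apply: eq_bigr => k _; rewrite !mxE.
Qed.

(** The row kernel of the new matrix contains that of M and in addition [v]. *)
Lemma mxrank_peel (F : fieldType) N (M : 'M[F]_N) (v : 'rV_N) (u : 'cV_N) :
  v *m M *m u = 1%:M -> (\rank (M - M *m u *m (v *m M))%R < \rank M)%N.
Proof.
move=> vMu; set M' := _ - _.
have : (kermx M < kermx M')%MS.
  apply/andP; split.
    apply/sub_kermxP; rewrite /M' mulmxBr !mulmxA mulmx_ker.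
    by rewrite !mul0mx subrr.
  apply/negP => sub.
  have : (v <= kermx M)%MS.
    apply: submx_trans sub; apply/sub_kermxP.
    by rewrite /M' mulmxBr !mulmxA vMu mul1mx subrr.
  move/sub_kermxP => vM; move: vMu; rewrite vM mul0mx => /matrixP/(_ 0 0).
  by rewrite !mxE => /eqP; rewrite eq_sym oner_eq0.
move/rank_ltmx; rewrite !mxrank_ker.
have := rank_leq_row M; have := rank_leq_row M'.
move: (\rank M) (\rank M') => r r'; clear; lia.
Qed.
(** * Frames and the splitting of a summand *)

Section MkLinear.
Variables (R : pzRingType) (U V : lmodType R) (f : U -> V).
Hypothesis lin : linear f.
(** Bundles a proof of linearity made inside another proof. *)
Definition mklin : {linear U -> V} :=
  HB.pack f (GRing.isLinear.Build R U V *:%R f lin).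
Lemma mklinE x : mklin x = f x. Proof. by []. Qed.
End MkLinear.

(** A finite index type for a list, recursive so that it decomposes along [cons]
    by computation. *)
Fixpoint idx (T : Type) (s : seq T) : finType :=
  if s is _ :: s' then (unit + idx s')%type else void.

Fixpoint item (T : Type) (s : seq T) : idx s -> T :=
  match s return idx s -> T with
  | [::] => fun x => match x with end
  | t :: s' => fun x => match x with inl _ => t | inr y => item y end
  end.

Lemma big_idx (M : zmodType) (T : Type) (s : seq T) (F : T -> M) :
  \sum_(j : idx s) F (item j) = \sum_(t <- s) F t.
Proof.
elim: s => [|t s IHs]; first by rewrite big_nil; apply: big_pred0 => -[].
rewrite big_cons -IHs big_sumType /=; congr (_ + _).
by rewrite (big_pred1 tt) // => -[].
Qed.

Section Frames.
Variables (A : gring) (B : finType) (e : B -> A).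
Hypothesis bas : basic_gring e.
Local Notation type := (B * int)%type.
Let grA := rdeg_grading A.

Section FramesIn.
Variable P : gmod A.
Let grP := mdeg_grading P.

(** Vectors and functionals of matching types; a frame is a pair of homomorphisms
    between P and the sum of the modules P_a{i} for the types (a, i). *)
Definition frame (J : Type) (tau : J -> type) (x : J -> P) (phi : J -> {linear P -> A^o}) :=
  forall j, homvec e (tau j) (x j) /\ homcov e (tau j) (phi j).

(** The functionals are dual to the vectors: then the sum of the P_a{i} is a
    retract of P. *)
Definition dual_frame (J : eqType) (tau : J -> type) (x : J -> P)
    (phi : J -> {linear P -> A^o}) :=
  forall j k, phi k (x j) = if j == k then e (tau j).1 else 0.

(** The composition of the two homomorphisms, an endomorphism of P. *)
Definition expand (J : finType) (x : J -> P) (phi : J -> {linear P -> A^o}) (y : P) : P :=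
  \sum_j (phi j y : A) *: x j.

Lemma expand_linear (J : finType) (x : J -> P) phi : linear (expand x phi).
Proof.
move=> c y z; rewrite /expand scaler_sumr -big_split; apply: eq_bigr => j _ /=.
by rewrite linearP scalerDl scalerA.
Qed.

(** Expanding x and discarding the vectors of other types, which do not contribute
    by [types_orth], the pairing becomes a product of matrices over Z. *)
Lemma pairing_split (K : finType) (sg : K -> type) (y : K -> P) psi t x phi :
  frame sg y psi -> homvec e t x -> homcov e t phi -> x = expand y psi x ->
  cf e t.1 (phi x) = \sum_(k | sg k == t) cf e t.1 (psi k x) * cf e t.1 (phi (y k)).
Proof.
move=> fr xt pt xE.
have E : (phi x : A) = \sum_(k | sg k == t) (psi k x : A) * phi (y k).
  rewrite [in LHS]xE raddf_sum [RHS]big_mkcond; apply: eq_bigr => k _ /=.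
  rewrite linearZ; case: eqP => // /eqP kt; have [yk pk] := fr k.
  have [pd ep pe] := vec_cov xt pk; have [pd' _ _] := vec_cov yk pt.
  by apply: (types_orth bas _ pd ep pe pd'); rewrite eq_sym.
have z0 k : sg k == t -> rdeg 0 (psi k x : A) /\ rdeg 0 (phi (y k) : A).
  move=> /eqP kt; have [yk pk] := fr k; rewrite kt in yk pk.
  by have [h _] := vec_cov_cf bas xt pk; have [h' _] := vec_cov_cf bas yk pt.
rewrite E cf_sum // => [|k /z0[h h']].
  by apply: eq_bigr => k /z0[h h']; rewrite (cfM bas).
by rewrite -[0]addr0; apply: rdegM.
Qed.

(** Let U and V be the matrices of the pairings of type t between the two bases.
    The number of vectors of type t is tr(UV) for one basis and tr(VU) for the
    other. *)
Lemma frame_count (J K : finType) (tau : J -> type) (sg : K -> type) x phi y psi t :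
  frame tau x phi -> dual_frame tau x phi -> (forall z, z = expand x phi z) ->
  frame sg y psi -> dual_frame sg y psi -> (forall z, z = expand y psi z) ->
  #|[pred j | tau j == t]| = #|[pred k | sg k == t]|.
Proof.
move=> fx ox sx fy oy sy.
have gen (I L : finType) (ta : I -> type) (si : L -> type) x' phi' y' psi' :
    frame ta x' phi' -> dual_frame ta x' phi' ->
    frame si y' psi' -> (forall z, z = expand y' psi' z) ->
    #|[pred j | ta j == t]|%:Z = \sum_(j | ta j == t) \sum_(k | si k == t)
       cf e t.1 (psi' k (x' j)) * cf e t.1 (phi' j (y' k)).
  move=> fx' ox' fy' sy'; rewrite -sum1_card (big_morph Posz PoszD (erefl _)).
  apply: eq_bigr => j /eqP jt; have [xj pj] := fx' j; rewrite jt in xj pj.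
  rewrite -(pairing_split fy' xj pj (sy' _)) ox' eqxx jt.
  by rewrite -[e t.1]mulr1z (cf_idem bas).
have /eqP := gen _ _ _ _ _ _ _ _ fx ox fy sy; rewrite exchange_big /=.
under eq_bigr => k _ do under eq_bigr => j _ do rewrite mulrC.
by rewrite -(gen _ _ _ _ _ _ _ _ fy oy fx sx) eqz_nat => /eqP.
Qed.

(** The expansion is an idempotent that fixes the vectors and the functionals. *)
Definition retraction (J : finType) (x : J -> P) (phi : J -> {linear P -> A^o}) :=
  (forall j, expand x phi (x j) = x j) /\
  (forall k y, phi k (expand x phi y) = phi k y).

Section Gram.
Variables (N : nat) (tau : 'I_N -> type) (x : 'I_N -> P) (phi : 'I_N -> {linear P -> A^o}).
Hypotheses (fr : frame tau x phi) (re : retraction x phi).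

(** The integer matrix of the pairings between vectors and functionals of equal
    types; [block] is its part for one type. *)
Definition gram : 'M[int]_N :=
  \matrix_(j, k) if tau j == tau k then cf e (tau j).1 (phi k (x j)) else 0.

Definition block t : 'M[int]_N :=
  \matrix_(j, k) if (tau j == t) && (tau k == t) then gram j k else 0.

Lemma pair_gram j k : tau j = tau k -> (phi k (x j) : A) = e (tau j).1 *~ gram j k.
Proof.
move=> jk; have [xj _] := fr j; have [_ pk] := fr k; rewrite -jk in pk.
by rewrite mxE jk eqxx -jk; have [_ ->] := vec_cov_cf bas xj pk; rewrite (cf_idem bas).
Qed.

Lemma block_idem t : block t *m block t = block t.
Proof.
apply/matrixP => j k; rewrite !mxE.
case jt: (tau j == t); last by apply: big1 => l _; rewrite !mxE jt mul0r.
case kt: (tau k == t); last by apply: big1 => l _; rewrite !mxE kt andbF mulr0.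
rewrite /= (eqP jt) (eqP kt) eqxx.
have [xj _] := fr j; have [_ pk] := fr k; rewrite (eqP jt) in xj; rewrite (eqP kt) in pk.
have xE : x j = expand x phi (x j) by have [-> _] := re.
rewrite (pairing_split fr xj pk xE) [RHS]big_mkcond; apply: eq_bigr => l _.
rewrite !mxE jt kt andbT /=; case: ifP => lt; last by rewrite mul0r.
by rewrite (eqP jt) (eqP lt) (eqP kt) eqxx.
Qed.

(** Let x_j be a non-zero vector of minimal degree.  It is a combination of the x_k
    with coefficients phi_k(x_j); these vanish by degree if x_k has larger
    degree, by orthogonality of the idempotents if it has the same degree and
    another type, and by assumption if it has the same type. *)
Lemma gram0 : gram = 0 -> forall j, x j = 0.
Proof.
move=> g0; suff gen d j : (forall k, x k != 0 -> d <= (tau k).2) -> (tau j).2 = d -> x j = 0.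
  move=> j; apply/eqP/negPn/negP => xj0.
  case: (@Order.TotalTheory.arg_minP _ int _ j (fun k => x k != 0) (fun k => (tau k).2) xj0).
  by move=> k xk kmin; case/eqP: xk; exact: (gen (tau k).2).
move=> dmin jd; have [<- _] := re; rewrite /expand; apply: big1 => k _.
have [->|xk] := eqVneq (x k) 0; first by rewrite scaler0.
have [xj _] := fr j; have [_ pk] := fr k.
have [pd ep pe] := vec_cov xj pk; rewrite jd in pd.
suff -> : (phi k (x j) : A) = 0 by rewrite scale0r.
have := dmin _ xk; rewrite le_eqVlt => /orP[/eqP dk|dk]; last first.
  by apply: (bg_neg bas _ pd); rewrite subr_lt0.
have [jk|jk] := eqVneq (tau j) (tau k); first by rewrite pair_gram // g0 mxE mulr0z.
have jk1 : (tau j).1 != (tau k).1.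
  by apply: contra jk => /eqP jk1; rewrite -pair_eqE /= jk1 jd dk !eqxx.
rewrite dk subrr in pd; rewrite -ep -pe (idem_mulr bas) //.
by rewrite mulrzAr (bg_mul bas) (negPf jk1) mul0rz.
Qed.

End Gram.

Section Peel.
Variables (N : nat) (tau : 'I_N -> type) (x : 'I_N -> P) (phi : 'I_N -> {linear P -> A^o}).
Hypotheses (fr : frame tau x phi) (re : retraction x phi).
Let C := gram tau x phi.
Let Ct t := block tau x phi t.

Variables (t : type) (v : 'rV[int]_N) (u : 'cV[int]_N).
Hypothesis vCu : v *m Ct t *m u = 1%:M.

Let v' : 'rV[int]_N := \row_j if tau j == t then v 0 j else 0.
Let u' : 'cV[int]_N := \col_j if tau j == t then u j 0 else 0.

Lemma peel_gram : v' *m C *m u' = 1%:M.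
Proof.
rewrite -vCu; apply/matrixP => a b; rewrite !ord1 !mxE; apply: eq_bigr => k _.
rewrite !mxE; case kt: (tau k == t); last first.
  rewrite mulr0 big1 ?mul0r // => j _; by rewrite mxE kt andbF mulr0.
congr (_ * _); apply: eq_bigr => j _; rewrite !mxE kt andbT.
by case: ifP => jt; rewrite ?mul0r ?mulr0.
Qed.

(** The combination m of the vectors of type t with the coefficients v, and the
    combination g of the functionals of type t with the coefficients u: by the
    hypothesis on v and u, g(m) = e_a. *)
Definition peel_vec : P := \sum_j x j *~ v' 0 j.

Definition peel_fun (y : P) : A^o := \sum_k phi k y *~ u' k 0.

Lemma peel_linear : linear peel_fun.
Proof.
move=> c y z; rewrite /peel_fun scaler_sumr -big_split; apply: eq_bigr => j _ /=.
by rewrite linearP mulrzDl -scalerMzr.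
Qed.

Let m := peel_vec.
Let g : {linear P -> A^o} := mklin peel_linear.

Lemma peel_homvec : homvec e t m.
Proof.
apply: homvec_sumz => j; rewrite mxE; case: (tau j =P t) => [<- _|]; last by rewrite eqxx.
by have [] := fr j.
Qed.

Lemma peel_homcov : homcov e t g.
Proof.
have ut k : (tau k == t) || (u' k 0 == 0) by rewrite mxE; case: (tau k =P t) => //= _; rewrite eqxx.
split=> [d y yd|y]; rewrite mklinE /peel_fun.
  apply: (deg_sum grA) => k _; have /orP[/eqP kt|/eqP->] := ut k; last first.
    by rewrite mulr0z; exact: (deg0 grA).
  by apply: (degMz grA); have [_ [pd _]] := fr k; rewrite -kt; exact: pd.
rewrite mulr_suml; apply: eq_bigr => k _.
have /orP[/eqP kt|/eqP->] := ut k; last by rewrite !mulr0z mul0r.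
by have [_ [_ pe]] := fr k; rewrite mulrzAl -kt pe.
Qed.

(** Multiplying by the truth value of [tau j == t] makes this an identity of
    matrices, in which the rows of other types are 0. *)
Lemma peel_g_x j : cf e t.1 (g (x j)) *+ (tau j == t) = (C *m u') j 0.
Proof.
rewrite mxE; case jt: (tau j == t); last first.
  rewrite big1 // => k _; rewrite !mxE.
  case: (eqVneq (tau k) t) => [->|_]; last by rewrite mulr0.
  by rewrite jt mul0r.
have [xj _] := fr j; rewrite (eqP jt) in xj.
rewrite mulr1n mklinE /peel_fun cf_sum // => [|k _].
  apply: eq_bigr => k _; rewrite !mxE (eqP jt) (eq_sym t).
  case: (eqVneq (tau k) t) => [kt|_]; last by rewrite mulr0z mulr0 (cf0 bas).
  have [_ pk] := fr k; rewrite kt in pk.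
  by have [h _] := vec_cov_cf bas xj pk; rewrite (cfMz bas).
rewrite mxE; case: (eqVneq (tau k) t) => [kt|_]; last first.
  by rewrite mulr0z; exact: (deg0 grA).
have [_ pk] := fr k; rewrite kt in pk.
by have [h _] := vec_cov_cf bas xj pk; exact: (degMz grA).
Qed.

Lemma peel_phi_m k : cf e t.1 (phi k m) *+ (tau k == t) = (v' *m C) 0 k.
Proof.
rewrite mxE; case kt: (tau k == t); last first.
  rewrite big1 // => j _; rewrite !mxE.
  case: (eqVneq (tau j) t) => [->|_]; last by rewrite mul0r.
  by rewrite eq_sym kt mulr0.
have [_ pk] := fr k; rewrite (eqP kt) in pk.
rewrite mulr1n /m /peel_vec raddf_sum cf_sum // => [|j _].
  apply: eq_bigr => j _; rewrite raddfMz !mxE (eqP kt).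
  case: (eqVneq (tau j) t) => [jt|_]; last by rewrite mulr0z mul0r (cf0 bas).
  have [xj _] := fr j; rewrite jt in xj.
  by have [h _] := vec_cov_cf bas xj pk; rewrite (cfMz bas) // mulrC jt.
rewrite raddfMz mxE; case: (eqVneq (tau j) t) => [jt|_]; last first.
  by rewrite mulr0z; exact: (deg0 grA).
have [xj _] := fr j; rewrite jt in xj.
by have [h _] := vec_cov_cf bas xj pk; exact: (degMz grA).
Qed.

Lemma peel_unit : (g m : A) = e t.1.
Proof.
have [_ ->] := vec_cov_cf bas peel_homvec peel_homcov.
suff -> : cf e t.1 (g m) = 1 by rewrite mulr1z.
have := congr1 (fun X : 'M_1 => X 0 0) peel_gram; rewrite /= mxE [RHS]mxE eqxx /= mulr1n => <-.
have ut k : (tau k == t) || (u' k 0 == 0).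
  by rewrite mxE; case: (tau k =P t) => //= _; rewrite eqxx.
have m0 k : tau k == t -> rdeg 0 (phi k m : A).
  move=> /eqP kt; have [_ pk] := fr k; rewrite kt in pk.
  by have [] := vec_cov_cf bas peel_homvec pk.
rewrite /peel_fun cf_sum // => [|k _]; last first.
  have /orP[kt|/eqP u0] := ut k; first exact/(degMz grA)/m0.
  by rewrite u0 mulr0z; exact: (deg0 grA).
apply: eq_bigr => k _; have /orP[kt|/eqP->] := ut k.
  by rewrite -peel_phi_m kt mulr1n (cfMz bas) //; exact: m0.
by rewrite mulr0z mulr0 (cf0 bas).
Qed.

Let rho (y : P) : P := y - (g y : A) *: m.

Lemma rho_linear : linear rho.
Proof.
move=> c y z; rewrite /rho.
have -> : (g (c *: y + z) : A) = c * (g y : A) + (g z : A) by rewrite linearP.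
by rewrite scalerDl -scalerA scalerBr opprD addrACA.
Qed.

Lemma g_lin_m y c : (g (y - c *: m) : A) = (g y : A) - c * e t.1.
Proof.
rewrite linearB; congr (_ - _).
exact: etrans (linearZ_LR g c m) (congr1 (fun z : A => c * z) peel_unit).
Qed.

Lemma g_rho y : (g (rho y) : A) = 0.
Proof.
by rewrite /rho g_lin_m; have [_ ->] := peel_homcov; rewrite subrr.
Qed.

(** The vectors and functionals are projected along m to the kernel of g. *)
Definition peeled_vec j : P := rho (x j).

Lemma peeled_linear k : linear (fun y => phi k (rho y) : A^o).
Proof. by move=> c y z; rewrite rho_linear linearP. Qed.

Definition peeled_cov k : {linear P -> A^o} := mklin (@peeled_linear k).

Lemma peeled_covE k y : (peeled_cov k y : A) = (phi k y : A) - (g y : A) * phi k m.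
Proof. by rewrite mklinE /rho linearB linearZ. Qed.

Let theta := expand x phi.
Let theta_lin : {linear P -> P} := mklin (expand_linear x phi).

Lemma theta_m : theta m = m.
Proof.
rewrite -[theta m]/(theta_lin m) /m /peel_vec raddf_sum; apply: eq_bigr => j _.
by rewrite raddfMz; congr (_ *~ _); have [h _] := re; exact: h.
Qed.

Lemma g_theta y : (g (theta y) : A) = g y.
Proof.
change (peel_fun (theta y) = peel_fun y); rewrite /peel_fun.
by apply: eq_bigr => k _; congr (_ *~ _); have [_ ->] := re.
Qed.

(** The new expansion is the old one minus its component along m. *)
Lemma peeled_expand y : expand peeled_vec peeled_cov y = theta y - (g y : A) *: m.
Proof.
have -> : expand peeled_vec peeled_cov y = rho (theta (rho y)).
  rewrite -[RHS]/(mklin rho_linear (theta (rho y))).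
  by rewrite /theta /expand raddf_sum; apply: eq_bigr => k _; symmetry;
    exact: (linearZ_LR (mklin rho_linear)).
have E : theta (rho y) = theta y - (g y : A) *: m.
  rewrite -[LHS]/(theta_lin _) /rho linearB linearZ /=; congr (_ - _ *: _).
  exact: theta_m.
rewrite E {1}/rho g_lin_m g_theta; have [_ ->] := peel_homcov.
by rewrite subrr scale0r subr0.
Qed.

Lemma peeled_frame : frame tau peeled_vec peeled_cov.
Proof.
move=> j; have [xj pj] := fr j; have hm := peel_homvec; have hg := peel_homcov.
split.
  apply: homvecB => //; have [pd ep pe] := vec_cov xj hg; have [md me] := hm.
  split; last by rewrite scalerA ep.
  by have := mdegZ pd md; rewrite subrK.
split=> [d y yd|y].
  rewrite peeled_covE; apply: (degB grA); first by have [h _] := pj; exact: h.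
  have [h _] := hg; have := rdegM (h _ _ yd).
  have [pd _ _] := vec_cov hm pj => /(_ _ _ pd).
  by rewrite addrA subrK.
rewrite peeled_covE mulrBl; have [_ ->] := pj; congr (_ - _).
by rewrite -mulrA; have [_ ->] := pj.
Qed.

Lemma peeled_retraction : retraction peeled_vec peeled_cov.
Proof.
split=> [j|k y]; rewrite peeled_expand.
  rewrite /peeled_vec -[theta (rho _)]/(theta_lin (rho (x j))) g_rho scale0r subr0.
  rewrite /rho linearB linearZ /=; congr (_ - _ *: _); last exact: theta_m.
  by have [h _] := re; exact: h.
rewrite !peeled_covE g_lin_m g_theta; have [_ ->] := peel_homcov.
rewrite subrr mul0r subr0 linearB linearZ /=; congr (_ - _).
by have [_ h] := re; exact: h.
Qed.

Lemma peeled_gram :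
  gram tau peeled_vec peeled_cov = C - C *m u' *m (v' *m C).
Proof.
apply/matrixP => j k; rewrite mxE [RHS]mxE [X in _ = _ + X]mxE.
rewrite [X in _ = _ - X]mxE big_ord1 -peel_g_x -peel_phi_m.
rewrite [C j k]mxE; have [xj pj] := fr j; have [xk pk] := fr k.
have hm := peel_homvec; have hg := peel_homcov.
case: (eqVneq (tau j) (tau k)) => [jk|jk]; last first.
  case: (eqVneq (tau j) t) => [jt|_]; last by rewrite mulr0n mul0r subrr.
  by rewrite -jt [tau k == _]eq_sym (negPf jk) mulr0n mulr0 subrr.
rewrite -jk in pk; have [p0 pE] := vec_cov_cf bas xj pk.
have [gd eg ge] := vec_cov xj hg; have [pd _ _] := vec_cov hm pk.
have g0 : rdeg 0 ((g (x j) : A) * phi k m).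
  by have := rdegM gd pd; rewrite addrA subrK subrr.
rewrite /peeled_vec peeled_covE -[g (rho _)]/(g (rho (x j)) : A) g_rho mul0r subr0.
rewrite -[rho (x j)]/(x j - (g (x j) : A) *: m) linearB linearZ /=.
rewrite -[_ *: (phi k m)]/((g (x j) : A) * phi k m : A).
rewrite (cfD bas) ?(cfN bas) //; last exact: (degN grA).
congr (_ - _); case: (eqVneq (tau j) t) => [jt|jt].
  rewrite -jk jt eqxx !mulr1n (cfM bas) //.
    by move: gd; rewrite jt subrr.
  by move: pd; rewrite jt subrr.
by rewrite mulr0n mul0r (types_orth bas jt gd eg ge pd) (cf0 bas).
Qed.

(** The Gram matrix changes by the rank-one term of [mxrank_peel]; ranks are taken
    over the rationals. *)
Lemma peeled_rank :
  (\rank (map_mx intr (gram tau peeled_vec peeled_cov) : 'M[rat]_N) <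
   \rank (map_mx intr C : 'M[rat]_N))%N.
Proof.
rewrite peeled_gram map_mxB !map_mxM; apply: mxrank_peel.
by rewrite -!map_mxM peel_gram map_mx1.
Qed.

End Peel.
End FramesIn.
End Frames.
(** * Modules with a homogeneous basis *)

Section Modules.
Variables (A : gring) (B : finType) (e : B -> A).
Hypothesis bas : basic_gring e.
Local Notation type := (B * int)%type.
Let grA := rdeg_grading A.
Implicit Types P Q R : gmod A.

Lemma peel_step P N (tau : 'I_N -> type) (x : 'I_N -> P) phi :
  frame e tau x phi -> retraction x phi -> gram e tau x phi != 0 ->
  exists (t : type) (m : P) (g : {linear P -> A^o}) (x2 : 'I_N -> P)
         (phi2 : 'I_N -> {linear P -> A^o}),
  [/\ homvec e t m /\ homcov e t g, (g m : A) = e t.1,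
      frame e tau x2 phi2 /\ retraction x2 phi2,
      forall y, expand x phi y = (g y : A) *: m + expand x2 phi2 y
    & [/\ forall y, (g (expand x2 phi2 y) : A) = 0, expand x2 phi2 m = 0
      & (\rank (map_mx intr (gram e tau x2 phi2) : 'M[rat]_N) <
         \rank (map_mx intr (gram e tau x phi) : 'M[rat]_N))%N]].
Proof.
move=> fr re g0.
have [j [k jk]] : exists j k, gram e tau x phi j k != 0.
  apply: contrapT => no; case/eqP: g0; apply/matrixP => j k; rewrite [RHS]mxE.
  by apply/eqP/negPn/negP => jk; apply: no; exists j, k.
have tjk : tau k == tau j.
  by move: jk; rewrite mxE; case: (eqVneq (tau j) (tau k)); rewrite ?eqxx.
have b0 : block e tau x phi (tau j) != 0.
  by apply: contraNneq jk => /matrixP/(_ j k); rewrite [LHS]mxE [RHS]mxE eqxx tjk /= => ->.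
have [v [u vCu]] := idempotent_unit_minor (block_idem bas fr re (tau j)) b0.
exists (tau j), (peel_vec tau x (tau j) v), (mklin (peel_linear tau phi (tau j) u)).
exists (peeled_vec tau x phi (tau j) v u), (peeled_cov tau x phi (tau j) v u).
have hm := peel_homvec fr (tau j) v; have hg := peel_homcov fr (tau j) u.
have gm := peel_unit bas fr vCu; have PE := peeled_expand bas fr re vCu.
split.
- by [].
- exact: gm.
- by split; [exact: (peeled_frame fr) | exact: (peeled_retraction bas fr re vCu)].
- by move=> y; rewrite PE addrC subrK.
split.
- move=> y; rewrite PE (g_lin_m bas fr vCu) (g_theta tau re).
  by have [_ ->] := hg; rewrite subrr.
- by rewrite PE (theta_m tau re) gm; have [_ ->] := hm; rewrite subrr.
- exact: (peeled_rank bas fr vCu).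
Qed.

(** Induction on the rank of the Gram matrix.  When it is 0, the vectors are 0 by
    [gram0]. *)
Lemma orthonormalize P N (tau : 'I_N -> type) (x : 'I_N -> P) phi :
  frame e tau x phi -> retraction x phi ->
  exists (s : seq type) (z : idx s -> P) (psi : idx s -> {linear P -> A^o}),
    [/\ frame e (item (s := s)) z psi, dual_frame e (item (s := s)) z psi
      & forall y, expand z psi y = expand x phi y].
Proof.
move: {2}_.+1 (ltnSn (\rank (map_mx intr (gram e tau x phi) : 'M[rat]_N))) => r.
elim: r x phi => // r IHr x phi rk fr re.
have [g0|g0] := eqVneq (gram e tau x phi) 0.
  have x0 := gram0 bas fr re g0.
  exists [::], (fun j : void => match j with end), (fun j : void => match j with end).
  split=> [[]|[]|y]; rewrite /expand big_pred0 => [|[]].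
  by apply/esym/big1 => j _; rewrite x0 scaler0.
have [t [m [g [x2 [phi2 [[hm hg] gm [fr2 re2] E [g2 m2 rk2]]]]]]] := peel_step fr re g0.
have [s [z [psi [fz oz Ez]]]] := IHr x2 phi2 (leq_trans rk2 rk) fr2 re2.
have zE j : expand z psi (z j) = z j.
  rewrite /expand (bigD1 j) //= big1 => [|k kj]; last first.
    by rewrite oz eq_sym (negPf kj) scale0r.
  by rewrite oz eqxx addr0; have [[_ ->]] := fz j.
exists (t :: s), (fun j => match j with inl _ => m | inr k => z k end).
exists (fun j => match j with inl _ => g | inr k => psi k end); split.
- by case=> [[]|j] //=; exact: fz.
- case=> [[]|j] [[]|k] /=.
  + exact: gm.
  + have : psi k (expand z psi m) = 0 by rewrite Ez m2 raddf0.
    rewrite /expand raddf_sum (bigD1 k) //= big1 => [|l lk]; last first.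
      by rewrite linearZ /= oz (negPf lk); exact: mulr0.
    rewrite addr0 linearZ /= oz eqxx.
    by have [_ [_ pe]] := fz k; move=> h; rewrite -[RHS]h; exact/esym/pe.
  + by rewrite -zE Ez g2.
  + by rewrite oz.
- by move=> y; rewrite E -Ez /expand big_sumType /= (big_pred1 tt) // => -[].
Qed.

(** P is the sum of the modules P_a{i} for the types (a, i) = [tau j]. *)
Definition has_basis P (J : finType) (tau : J -> type) := exists x phi,
  [/\ frame e tau x phi, dual_frame e tau x phi & forall y : P, y = expand x phi y].

(** A retract of a sum of modules P_a{i} is itself such a sum. *)
Lemma has_basis_of_retract P (J : finType) (tau : J -> type) (x : J -> P) phi :
  frame e tau x phi -> (forall y, y = expand x phi y) ->
  exists s : seq type, has_basis P (item (s := s)).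
Proof.
move=> fr sp; pose x' i := x (enum_val (A := predT) i).
pose phi' i := phi (enum_val (A := predT) i).
have E y : expand x' phi' y = y.
  rewrite [RHS]sp /expand; rewrite [RHS](reindex _ (onW_bij _ (enum_val_bij J))).
  by [].
have [s [z [psi [fz oz Ez]]]] := @orthonormalize P _ (fun i => tau (enum_val i)) x' phi'
   (fun i => fr _) (conj (fun j => E _) (fun k y => congr1 _ (E y))).
by exists s, z, psi; split=> // y; rewrite Ez E.
Qed.

Lemma basis_count P (J K : finType) (tau : J -> type) (sg : K -> type) t :
  has_basis P tau -> has_basis P sg ->
  #|[pred j | tau j == t]| = #|[pred k | sg k == t]|.
Proof.
move=> [x [phi [fx ox sx]]] [y [psi [fy oy sy]]].
exact: (frame_count bas t fx ox sx fy oy sy).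
Qed.

Lemma count_item (s : seq type) t :
  #|[pred j : idx s | item j == t]| = count_mem t s.
Proof.
rewrite -sum1_card -sum1_count.
apply/eqP; rewrite -eqz_nat !(big_morph Posz PoszD (erefl _)).
rewrite big_mkcond [X in _ == X]big_mkcond /=; apply/eqP.
exact: (big_idx s (fun u => if u == t then 1%:Z else 0)).
Qed.

Lemma basis_perm P (s s' : seq type) :
  has_basis P (item (s := s)) -> has_basis P (item (s := s')) -> perm_eq s s'.
Proof.
move=> bs bs'; apply/allP => t _ /=; apply/eqP.
by rewrite -!count_item; exact: (basis_count t bs bs').
Qed.

Lemma basis_giso P Q (J : finType) (tau : J -> type) :
  has_basis P tau -> has_basis Q tau -> giso P Q.
Proof.
move=> [x [phi [fx ox sx]]] [y [psi [fy oy sy]]].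
have lin : linear (fun z => \sum_j (phi j z : A) *: y j).
  move=> c u v; rewrite scaler_sumr -big_split; apply: eq_bigr => j _ /=.
  by rewrite linearP scalerDl scalerA.
have lin' : linear (fun z => \sum_j (psi j z : A) *: x j).
  move=> c u v; rewrite scaler_sumr -big_split; apply: eq_bigr => j _ /=.
  by rewrite linearP scalerDl scalerA.
have deg (R S : gmod A) (z : J -> S) (th : J -> {linear R -> A^o}) d u :
    (forall j, homvec e (tau j) (z j)) -> (forall j, homcov e (tau j) (th j)) ->
    mdeg d u -> mdeg d (\sum_j (th j u : A) *: z j).
  move=> hz hth ud; apply: (deg_sum (mdeg_grading S)) => j _.
  have [zd _] := hz j; have [td _] := hth j.
  by have := mdegZ (td _ _ ud) zd; rewrite subrK.
have inv (R S : gmod A) (z : J -> R) (th : J -> {linear R -> A^o}) (w : J -> S)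
   (ze : J -> {linear S -> A^o}) : frame e tau z th -> dual_frame e tau w ze ->
   (forall u, u = expand z th u) ->
   forall u, \sum_j (ze j (\sum_k (th k u : A) *: w k) : A) *: z j = u.
  move=> fz ow sz u; rewrite [RHS]sz; apply: eq_bigr => j _; congr (_ *: _).
  rewrite raddf_sum (bigD1 j) //= big1 => [|k kj]; last first.
    by rewrite linearZ /= ow (negPf kj); exact: mulr0.
  rewrite addr0 linearZ /= ow eqxx; have [_ [_ pe]] := fz j; exact: pe.
have i1 := inv _ _ _ _ _ _ fx oy sx; have i2 := inv _ _ _ _ _ _ fy ox sy.
exists (mklin lin); split; first by exists (mklin lin') => u; [exact: i1 | exact: i2].
move=> d u; split=> [ud|ud].
  by apply: deg => // j; [case: (fy j) | case: (fx j)].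
rewrite -(i1 u); apply: deg => // j; [by case: (fx j) | by case: (fy j)].
Qed.

Lemma basis_giso_trans P Q (J : finType) (tau : J -> type) :
  giso P Q -> has_basis P tau -> has_basis Q tau.
Proof.
move=> [f [[h fK hK] fd]] [x [phi [fx ox sx]]].
have hlin : linear h.
  move=> c u v; apply: (can_inj fK); rewrite linearP !hK.
  by [].
have plin j : linear (fun u => phi j (h u) : A^o).
  by move=> c u v; rewrite hlin linearP.
exists (fun j => f (x j)), (fun j => mklin (plin j)); split.
- move=> j; have [[xd xe] [pd pe]] := fx j; split.
    by split; [exact/fd | rewrite -[LHS](linearZ_LR f) xe].
  split=> [d u ud|u]; last by rewrite mklinE pe.
  by apply: pd; apply/fd; rewrite hK.
- by move=> j k; rewrite mklinE fK ox.
- move=> u; rewrite -{1}(hK u) {1}(sx (h u)) /expand raddf_sum.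
  by apply: eq_bigr => j _; exact: (linearZ_LR f).
Qed.

Lemma giso_sym P Q : giso P Q -> giso Q P.
Proof.
move=> [f [[h fK hK] fd]].
have hlin : linear h.
  by move=> c u v; apply: (can_inj fK); rewrite linearP !hK.
exists (mklin hlin); split; first by exists f.
by move=> d u; rewrite mklinE; rewrite fd hK.
Qed.

Lemma basis_gdsum P Q (J K : finType) (tau : J -> type) (sg : K -> type) :
  has_basis P tau -> has_basis Q sg ->
  has_basis (gdsum P Q) (fun j : J + K => match j with inl j => tau j | inr k => sg k end).
Proof.
move=> [x [phi [fx ox sx]]] [y [psi [fy oy sy]]].
have l1 j : linear (fun u : gdsum P Q => phi j u.1 : A^o) by move=> c u v; rewrite linearP.
have l2 j : linear (fun u : gdsum P Q => psi j u.2 : A^o) by move=> c u v; rewrite linearP.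
exists (fun j => match j with inl j => (x j, 0) | inr k => (0, y k) end).
exists (fun j => match j with inl j => mklin (l1 j) | inr k => mklin (l2 k) end); split.
- case=> j.
    have [[xd xe] [pd pe]] := fx j; split.
      split; first by split=> //=; exact: (deg0 (mdeg_grading Q)).
      by rewrite -[LHS]/(_ *: x j, _ *: 0) /= xe scaler0.
    split=> [d u [ud _]|u]; rewrite mklinE; [exact: pd | exact: pe].
  have [[xd xe] [pd pe]] := fy j; split.
    split; first by split=> //=; exact: (deg0 (mdeg_grading P)).
    by rewrite -[LHS]/(_ *: 0, _ *: y j) /= xe scaler0.
  split=> [d u [_ ud]|u]; rewrite mklinE; [exact: pd | exact: pe].
- case=> j [] k; rewrite mklinE /=.
  + by rewrite ox.
  + by rewrite raddf0.
  + by rewrite raddf0.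
  + by rewrite oy.
- move=> [u v]; rewrite /expand big_sumType /= [LHS]surjective_pairing /=.
  rewrite [u in LHS]sx [v in LHS]sy /expand.
  rewrite [RHS]surjective_pairing; congr (_, _); rewrite /= ?raddfD !raddf_sum /=.
    by rewrite [X in _ = _ + X]big1 ?addr0 // => j _; exact: scaler0.
  by rewrite [X in _ = X + _]big1 ?add0r // => j _; exact: scaler0.
Qed.

(** The vectors and functionals of a basis of P restrict to a frame of the summand
    that expands the identity. *)
Lemma basis_summand P Q R (J : finType) (tau : J -> type) :
  giso P (gdsum Q R) -> has_basis P tau -> exists s : seq type, has_basis Q (item (s := s)).
Proof.
move=> iso /(basis_giso_trans iso)[x [phi [fx ox sx]]].
have l1 j : linear (fun u : Q => phi j (u, 0) : A^o).
  move=> c u v; rewrite -[RHS]linearP; congr (phi j _ : A^o).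
  by rewrite -[RHS]/(c *: u + v, c *: 0 + 0) scaler0 addr0.
apply: (@has_basis_of_retract Q J tau (fun j => (x j).1) (fun j => mklin (l1 j))).
  move=> j; have [[[xd _] xe] [pd pe]] := fx j; split.
    by split=> //; rewrite -{2}xe.
  split=> [d u ud|u]; rewrite mklinE; last exact: pe.
  by apply: pd; split=> //=; exact: (deg0 (mdeg_grading R)).
move=> u; have := congr1 fst (sx (u, 0)); rewrite /expand raddf_sum /= => {1}->.
by apply: eq_bigr => j _.
Qed.

Lemma gdsum_swap P Q : giso (gdsum P Q) (gdsum Q P).
Proof.
have lin : linear (fun u : gdsum P Q => (u.2, u.1) : gdsum Q P) by move=> c u v.
have lin' : linear (fun u : gdsum Q P => (u.2, u.1) : gdsum P Q) by move=> c u v.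
exists (mklin lin); split; first by exists (mklin lin') => -[].
by move=> d [u v]; rewrite mklinE; split=> -[].
Qed.

Lemma basis_gshift P (J : finType) (tau : J -> type) i :
  has_basis P tau -> has_basis (gshift P i) (fun j => ((tau j).1, (tau j).2 + i)).
Proof.
move=> [x [phi [fx ox sx]]]; exists x, phi; split=> // j.
have [[xd xe] [pd pe]] := fx j; split; split=> //=.
  by rewrite /shift_deg addrK.
by move=> d y; rewrite /shift_deg => /pd; rewrite opprD addrAC addrA addrAC -addrA.
Qed.

End Modules.
(** * Finitely generated graded projective modules *)

Section Projectives.
Variables (A : gring) (B : finType) (e : B -> A).
Hypothesis bas : basic_gring e.
Local Notation type := (B * int)%type.
Let grA := rdeg_grading A.
Implicit Types P Q R : gmod A.

(** P_a{i} for [t = (a, i)], over an arbitrary ring of the class considered. *)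
Definition std (t : type) : gmod A := gshift (glideal (bg_deg bas t.1)) t.2.

Definition zero_mod : gmod A := glideal (deg0 grA 0).

Lemma zero_modP : gzero zero_mod.
Proof. by case=> x xP; apply: val_inj; have [y /= ->] := asboolP _ xP; rewrite mulr0. Qed.

Lemma basis_zero P : gzero P -> has_basis e P (fun j : void => match j return type with end).
Proof.
move=> P0; exists (fun j : void => match j with end), (fun j : void => match j with end).
by split=> [[]|[]|y]; rewrite [y]P0 /expand big_pred0 // => -[].
Qed.

Lemma basis_void P (J : finType) (tau : J -> type) : (J -> False) ->
  has_basis e P tau -> gzero P.
Proof.
by move=> J0 [x [phi [_ _ sp]]] y; rewrite [y]sp /expand big_pred0 // => j; case: (J0 j).
Qed.

Lemma basis_nonzero P (J : finType) (tau : J -> type) (j : J) :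
  has_basis e P tau -> ~ gzero P.
Proof.
move=> [x [phi [_ dx _]]] P0; have := dx j j; rewrite eqxx (P0 (x j)) raddf0.
by move=> h; have := idem_neq0 bas (tau j).1; rewrite -h eqxx.
Qed.

Lemma basis_ideal a :
  has_basis e (glideal (bg_deg bas a)) (fun _ : unit => (a, 0)).
Proof.
have eP : (e a : A^o) \in in_left_ideal (e a).
  by apply/asboolP; exists 1; rewrite mul1r.
have vlin : linear (fun x : glideal (bg_deg bas a) => val (x : left_ideal (e a)) : A^o).
  by move=> c x y; rewrite linearP.
have valE (x : left_ideal (e a)) : (val x : A) * e a = val x.
  by case: x => x xP /=; have [y ->] := asboolP _ xP; rewrite -mulrA idem_sq.
exists (fun _ => LeftIdeal eP : glideal _), (fun _ => mklin vlin); split.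
- move=> _; split; split.
  + exact: (bg_deg bas).
  + by apply: val_inj; exact: (idem_sq bas a).
  + by move=> d y yd; rewrite subr0.
  + exact: valE.
- by [].
- move=> x; rewrite /expand (big_pred1 tt) => [|[]//]; apply: val_inj.
  exact/esym/valE.
Qed.

Lemma has_basis_ext P (J : finType) (tau tau' : J -> type) :
  tau =1 tau' -> has_basis e P tau -> has_basis e P tau'.
Proof.
move=> E [x [phi [fx ox sx]]]; exists x, phi; split=> //.
  by move=> j; rewrite -E; exact: fx.
by move=> j k; rewrite ox E.
Qed.

Lemma has_basis_reindex P (J K : finType) (tau : J -> type) (h : K -> J) :
  bijective h -> has_basis e P tau -> has_basis e P (fun k => tau (h k)).
Proof.
move=> hb [x [phi [fx ox sx]]]; exists (fun k => x (h k)), (fun k => phi (h k)); split.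
- by move=> k; exact: fx.
- by move=> j k; rewrite ox (inj_eq (bij_inj hb)).
- by move=> y; rewrite {1}[y]sx /expand (reindex h) //; exact: onW_bij.
Qed.

Lemma basis_std t : has_basis e (std t) (fun _ : unit => t).
Proof.
apply: has_basis_ext (basis_gshift t.2 (basis_ideal t.1)) => _.
by rewrite /= add0r; case: (t).
Qed.

(** The sum of the P_a{i} for a list of data of types (a, i). *)
Fixpoint Fmod (T : Type) (ty : T -> type) (l : seq T) : gmod A :=
  if l is p :: l' then gdsum (std (ty p)) (Fmod ty l') else zero_mod.

Lemma basis_Fmod (T : Type) (ty : T -> type) (l : seq T) :
  has_basis e (Fmod ty l) (fun j => ty (item (s := l) j)).
Proof.
elim: l => [|p l IHl] /=.
  by apply: has_basis_ext (basis_zero zero_modP) => -[].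
apply: has_basis_ext (basis_gdsum (basis_std (ty p)) IHl).
by case.
Qed.

(** A vector of type (a, i) lifts along a surjection: take a preimage of its degree
    and multiply it by e_a. *)
Lemma basis_projective P (J : finType) (tau : J -> type) :
  has_basis e P tau -> gprojective P.
Proof.
move=> [x [phi [fx ox sx]]] M N g f gg gsurj ff.
have lift j : exists m, homvec e (tau j) m /\ g m = f (x j).
  have [[xd xe] _] := fx j; have [z zE] := gsurj (f (x j)).
  have gz : mdeg (tau j).2 (g z) by rewrite zE; exact: ff.
  have [z' [z'd gz']] := gproj_lift_degree gg gz.
  exists (e (tau j).1 *: z'); split; [split|].
  - by have := mdegZ (bg_deg bas (tau j).1) z'd; rewrite add0r.
  - by rewrite scalerA (idem_sq bas).
  - by rewrite [LHS](linearZ_LR g) gz' zE -[LHS](linearZ_LR f) xe.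
have [m mP] := choice lift.
have hlin : linear (fun y => \sum_j (phi j y : A) *: m j).
  move=> c u v; rewrite scaler_sumr -big_split; apply: eq_bigr => j _ /=.
  by rewrite linearP scalerDl scalerA.
exists (mklin hlin); split.
  move=> d y yd; rewrite mklinE; apply: (deg_sum (mdeg_grading M)) => j _.
  have [[md _] _] := mP j; have [_ [pd _]] := fx j.
  by have := mdegZ (pd _ _ yd) md; rewrite subrK.
move=> y; rewrite mklinE [in RHS](sx y) /expand !raddf_sum; apply: eq_bigr => j _.
by rewrite [LHS](linearZ_LR g) [RHS](linearZ_LR f); have [_ ->] := mP j.
Qed.

Lemma basis_fg P (J : finType) (tau : J -> type) :
  has_basis e P tau -> finitely_generated P.
Proof.
move=> [x [phi [fx ox sx]]]; exists #|J|, (fun i => x (enum_val (A := predT) i)) => y.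
exists (fun i => phi (enum_val (A := predT) i) y).
by rewrite {1}[y]sx /expand; rewrite (reindex _ (onW_bij _ (enum_val_bij J))).
Qed.

Lemma basis_fgproj P (J : finType) (tau : J -> type) :
  has_basis e P tau -> fgproj P.
Proof. by move=> bP; split; [exact: basis_fg bP | exact: basis_projective bP]. Qed.

Lemma mem_item (T : eqType) (l : seq T) p : p \in l -> exists j : idx l, item j = p.
Proof.
elim: l => // q l IHl; rewrite inE => /orP[/eqP->|/IHl[j <-]].
  by exists (inl tt).
by exists (inr j).
Qed.

(** The vectors e_a h, with h a homogeneous component of a generator, generate.
    Generation is stated as an induction principle over submodules. *)
Lemma homogeneous_generators P : finitely_generated P ->
  exists l : seq (type * P), (forall p, p \in l -> homvec e p.1 p.2) /\
    forall S : P -> Prop, S 0 -> (forall y z, S y -> S z -> S (y + z)) ->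
      (forall c y, S y -> S (c *: y)) -> (forall p, p \in l -> S p.2) -> forall y, S y.
Proof.
move=> [r [g gP]]; have [_ spanP _] := mdeg_grading P.
have comp i : exists l : seq (type * P), (forall p, p \in l -> homvec e p.1 p.2) /\
    g i = \sum_(p <- l) p.2.
  have [s [h [us hD gE]]] := spanP (g i).
  exists [seq ((a, j), e a *: h j) | j <- s, a <- enum B]; split.
    move=> _ /allpairsP[[j a] [js _ ->]] /=; split.
      by have := mdegZ (bg_deg bas a) (hD j); rewrite add0r.
    by rewrite /= scalerA (idem_sq bas).
  rewrite big_allpairs_dep gE; apply: eq_bigr => j _ /=.
  by rewrite big_enum -scaler_suml (bg_sum bas) scale1r.
have [L LP] := choice comp.
exists (flatten [seq L i | i <- enum 'I_r]); split.
  by move=> p /flatten_mapP[i _ pL]; have [h _] := LP i; exact: h.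
move=> S S0 SD SZ Sl y; have [c ->] := gP y.
have Sg i : S (g i).
  have [_ ->] := LP i; rewrite big_seq; apply: big_ind => // p pL; apply: Sl.
  by apply/flatten_mapP; exists i; rewrite ?mem_enum.
by apply: big_ind => // i _; apply: SZ.
Qed.

(** Projectivity splits the surjection from a sum of modules P_a{i} given by typed
    generators, so P is a retract of that sum. *)
Lemma fgproj_basis P : fgproj P -> exists s : seq type, has_basis e P (item (s := s)).
Proof.
move=> [fg proj]; have [l [lhom lgen]] := homogeneous_generators fg.
pose F := Fmod (fun p : type * P => p.1) l.
have [z [zeta [fz oz sz]]] : has_basis e F (fun j => (item (s := l) j).1).
  exact: basis_Fmod.
have lhom' j : homvec e (item (s := l) j).1 (item (s := l) j).2.
  apply: lhom; elim: (l) j => [[]|q l' IH [[]|j]] /=; first exact: mem_head.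
  by rewrite inE IH orbT.
have glin : linear (fun w : F => \sum_j (zeta j w : A) *: (item (s := l) j).2).
  move=> c u v; rewrite scaler_sumr -big_split; apply: eq_bigr => j _ /=.
  by rewrite linearP scalerDl scalerA.
have gz j : mklin glin (z j) = (item (s := l) j).2.
  rewrite mklinE (bigD1 j) //= big1 => [|k kj]; last first.
    by rewrite oz eq_sym (negPf kj) scale0r.
  by rewrite oz eqxx addr0; have [] := lhom' j.
have gsurj : forall y, exists w, mklin glin w = y.
  apply: lgen => [|y w [u <-] [v <-]|c y [u <-]|p /mem_item[j <-]].
  - by exists 0; rewrite raddf0.
  - by exists (u + v); rewrite raddfD.
  - by exists (c *: u); rewrite [LHS](linearZ_LR (mklin glin)).
  - by exists (z j); rewrite gz.
have gdeg : ghom (mklin glin).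
  move=> d w wd; rewrite mklinE; apply: (deg_sum (mdeg_grading P)) => j _.
  have [xd _] := lhom' j; have [_ [pd _]] := fz j.
  by have := mdegZ (pd _ _ wd) xd; rewrite subrK.
have idlin : linear (fun y : P => y) by move=> c u v.
have [h [hdeg hE]] := proj F P (mklin glin) (mklin idlin) gdeg gsurj (fun j y yj => yj).
have plin j : linear (fun y => zeta j (h y) : A^o) by move=> c u v; rewrite !linearP.
apply: (has_basis_of_retract bas (x := fun j => (item (s := l) j).2)
   (phi := fun j => mklin (plin j)) (tau := fun j => (item (s := l) j).1)).
  move=> j; split; first exact: lhom'.
  have [_ [pd pe]] := fz j; split=> [d y yd|y]; rewrite mklinE; last exact: pe.
  exact/pd/hdeg.
by move=> y; rewrite -[LHS]hE.
Qed.

Lemma giso_std_basis P t : giso P (std t) <-> has_basis e P (fun _ : unit => t).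
Proof.
split=> [iso|bP]; last exact: basis_giso bP (basis_std t).
exact: basis_giso_trans (giso_sym iso) (basis_std t).
Qed.

Lemma giso_trans P Q R : giso P Q -> giso Q R -> giso P R.
Proof.
move=> [f [fb fd]] [g [gb gd]].
have lin : linear (fun x => g (f x)) by move=> c u v; rewrite !linearP.
exists (mklin lin); split; first exact: bij_comp gb fb.
by move=> d x; rewrite fd gd.
Qed.

Lemma basis_gdsum_perm P Q R (s s1 s2 : seq type) : giso P (gdsum Q R) ->
  has_basis e P (item (s := s)) -> has_basis e Q (item (s := s1)) ->
  has_basis e R (item (s := s2)) -> perm_eq s (s1 ++ s2).
Proof.
move=> iso bP bQ bR; apply/allP => t _ /=; rewrite count_cat -!count_item.
rewrite (basis_count bas t (basis_giso_trans iso bP) (basis_gdsum bQ bR)).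
by rewrite -!sum1_card big_sumType.
Qed.

(** Summands have bases, and the sizes of bases add. *)
Lemma indecomposable_basis P (s : seq type) : has_basis e P (item (s := s)) ->
  gindecomposable P <-> size s = 1%N.
Proof.
move=> bP; split=> [[nz ind]|].
  case: s bP => [|t s] bP; first by case: nz; apply: basis_void bP => -[].
  have bF := basis_gdsum (basis_std t) (basis_Fmod id s).
  have iso : giso P (gdsum (std t) (Fmod id s)).
    by apply: basis_giso bP _; apply: has_basis_ext bF; case.
  case: (ind _ _ iso) => z0; first by case: (basis_nonzero tt (basis_std t)).
  case: s z0 {bP bF iso} => // u s z0.
  by case: (basis_nonzero (inl tt : idx (u :: s)) (basis_Fmod id (u :: s))).
case: s bP => [|t [|]] // bP _; split; first exact: basis_nonzero (inl tt) bP.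
move=> M N iso.
have [sM bM] := basis_summand bas iso bP.
have [sN bN] : exists s : seq type, has_basis e N (item (s := s)).
  exact: (basis_summand bas (giso_trans iso (gdsum_swap M N)) bP).
have /perm_size := basis_gdsum_perm iso bP bM bN; rewrite size_cat /= => sz.
case: sM bM sz => [|u sM] bM sz; first by left; apply: basis_void bM => -[].
case: sN bN sz => [|w sN] bN sz; first by right; apply: basis_void bN => -[].
by move: sz; rewrite /= addnS.
Qed.

End Projectives.
(** * Additive maps on Laurent polynomials *)

Local Notation tofrac := (@FracField.tofrac {poly int}).

Section Laurent.
Implicit Types (x y : laurent) (p : {poly int}).

Lemma qfrac_neq0 : qfrac != 0.
Proof. by rewrite /qfrac tofrac_eq0 polyX_eq0. Qed.

Lemma qV_proof : qfrac^-1 \in is_laurent.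
Proof.
apply/asboolP; exists 1%N, 1; by rewrite expr1 mulVf ?qfrac_neq0 // tofrac1.
Qed.

Definition qV : laurent := Laurent qV_proof.

Lemma q_qV : q * qV = 1.
Proof. by apply: val_inj; rewrite rmorphM rmorph1 /= mulfV ?qfrac_neq0. Qed.

(** Multiplication by a power of q is injective. *)
Lemma q_regular m x y : x * q ^+ m = y * q ^+ m -> x = y.
Proof.
move=> E; have qm : q ^+ m * qV ^+ m = 1 by rewrite -exprMn q_qV expr1n.
by rewrite -[x]mulr1 -[y]mulr1 -qm !mulrA E.
Qed.

Definition qpow (i : int) : laurent :=
  match i with Posz n => q ^+ n | Negz n => qV ^+ n.+1 end.

Lemma qpowE (k m : nat) : qpow (k%:Z - m%:Z) * q ^+ m = q ^+ k.
Proof.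
have [mk|km] := leqP m k; first by rewrite subzn //= -exprD subnK.
have -> : k%:Z - m%:Z = Negz (m - k).-1 by rewrite NegzE; clear -km; lia.
rewrite /qpow prednK ?subn_gt0 // -{2}(subnKC (ltnW km)) exprD mulrCA.
by rewrite -exprMn [qV * q]mulrC q_qV expr1n mulr1.
Qed.

Lemma qpowS i : qpow (i + 1) = q * qpow i.
Proof.
have [k [m iE]] : exists k m : nat, i = k%:Z - m%:Z.
  by case: i => r; [exists r, 0%N | exists 0%N, r.+1]; rewrite ?NegzE ?subr0 ?sub0r.
apply: (@q_regular m); rewrite -mulrA iE qpowE -exprS.
have -> : k%:Z - m%:Z + 1 = k.+1%:Z - m%:Z by clear; lia.
exact: qpowE.
Qed.

Lemma laurentP x : exists (m : nat) p, val x * qfrac ^+ m = tofrac p.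
Proof. exact: (asboolP _ (valP x)). Qed.

(** A Laurent polynomial is q^(-m) p with [m = lden x] and [p = lnum x]; the choice
    is immaterial by [lextE]. *)
Definition lden x : nat := projT1 (cid (laurentP x)).
Definition lnum x : {poly int} := projT1 (cid (projT2 (cid (laurentP x)))).

Lemma lnumP x : val x * qfrac ^+ lden x = tofrac (lnum x).
Proof. exact: (projT2 (cid (projT2 (cid (laurentP x))))). Qed.

Lemma qfracX m : qfrac ^+ m = tofrac 'X^m.
Proof. by rewrite /qfrac tofracXn. Qed.

Lemma qpolyE x m p : val x * qfrac ^+ m = tofrac p ->
  x = \sum_(k < size p) qpow (k%:Z - m%:Z) *~ p`_k.
Proof.
move=> xE; apply: (@q_regular m); rewrite mulr_suml.
under eq_bigr => k _ do rewrite mulrzAl qpowE.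
apply: val_inj; rewrite [RHS]raddf_sum.
rewrite rmorphM rmorphXn /= xE -[in LHS](coefK p) poly_def.
rewrite raddf_sum; apply: eq_bigr => k _.
rewrite -[p`_k in LHS]intz scaler_int raddfMz.
apply: etrans (esym (raddfMz (val : laurent -> {fraction {poly int}}) _ _)).
congr (_ *~ _); rewrite -[LHS]/(tofrac 'X^k) -qfracX.
exact: (esym (rmorphXn (val : laurent -> _) k q)).
Qed.

Section Extension.
Variables (G : zmodType) (gam : int -> G).

(** The image of q^(-m) p under the additive map that sends q^i to [gam i]. *)
Definition pl (m : nat) p : G := \sum_(k < size p) gam (k%:Z - m%:Z) *~ p`_k.

Lemma pl_widen N m p : (size p <= N)%N ->
  pl m p = \sum_(k < N) gam (k%:Z - m%:Z) *~ p`_k.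
Proof.
move=> pN; rewrite /pl (big_ord_widen _ (fun k => gam (k%:Z - m%:Z) *~ p`_k) pN).
rewrite big_mkcond; apply: eq_bigr => k _; case: ltnP => // kp.
by rewrite nth_default // mulr0z.
Qed.

Lemma plB m p p' : pl m (p - p') = pl m p - pl m p'.
Proof.
set N := maxn (size p) (size p').
rewrite (@pl_widen N m p) ?leq_maxl // (@pl_widen N m p') ?leq_maxr //.
rewrite (@pl_widen N) -?sumrB; last by rewrite (leq_trans (size_polyD _ _)) // size_polyN.
by apply: eq_bigr => k _; rewrite coefB mulrzBr.
Qed.

Lemma pl_shift r m p : pl (m + r) (p * 'X^r) = pl m p.
Proof.
rewrite (@pl_widen (r + size p)); last first.
  have [->|p0] := eqVneq p 0; first by rewrite mul0r size_poly0.
  by rewrite size_mulXn // addnC.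
rewrite big_split_ord /= big1 ?add0r => [|k _]; last first.
  by rewrite coefMXn ltn_ord mulr0z.
apply: eq_bigr => k _; rewrite coefMXn ltnNge leq_addr /= addKn; congr (gam _ *~ _).
by rewrite !PoszD; clear; lia.
Qed.

(** The powers of q are a basis of the Laurent polynomials over Z: each family
    [gam] extends to a unique additive map, by [lext_qpow] and
    [laurent_additive_eq]. *)
Definition lext x : G := pl (lden x) (lnum x).

Lemma lextE x m p : val x * qfrac ^+ m = tofrac p -> lext x = pl m p.
Proof.
move=> xE; rewrite /lext -(pl_shift m) -(pl_shift (lden x) m) addnC; congr pl.
apply/eqP; rewrite -tofrac_eq !tofracM -lnumP -xE -!qfracX -!mulrA.
by rewrite [qfrac ^+ m * _]mulrC.
Qed.

Lemma lext_zmod : zmod_morphism lext.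
Proof.
move=> x y; rewrite (@lextE (x - y) (lden x + lden y)%N
    (lnum x * 'X^(lden y) - lnum y * 'X^(lden x))).
  by rewrite plB pl_shift addnC pl_shift.
rewrite rmorphB /= mulrBl tofracB !tofracM -!lnumP -!qfracX -!mulrA -!exprD.
by rewrite [(lden y + _)%N]addnC.
Qed.

Lemma lext_qpow i : lext (qpow i) = gam i.
Proof.
case: i => r; rewrite /qpow.
  rewrite (@lextE _ 0%N 'X^r); last by rewrite expr0 mulr1 rmorphXn /= qfracX.
  rewrite /pl size_polyXn big_ord_recr /= big1 ?add0r => [|k _]; last first.
    by rewrite coefXn ltn_eqF // mulr0z.
  by rewrite coefXn eqxx mulr1z subr0.
rewrite (@lextE _ r.+1 1); last first.
  by rewrite rmorphXn /= -exprMn mulVf ?qfrac_neq0 // expr1n tofrac1.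
by rewrite /pl size_poly1 big_ord1 /= coef1 mulr1z sub0r NegzE.
Qed.

HB.instance Definition _ := GRing.isZmodMorphism.Build laurent G lext lext_zmod.

End Extension.

Lemma laurent_additive_eq (G : zmodType) (f g : {additive laurent -> G}) :
  (forall i, f (qpow i) = g (qpow i)) -> f =1 g.
Proof.
move=> E x; rewrite (qpolyE (lnumP x)) !raddf_sum; apply: eq_bigr => k _.
by rewrite !raddfMz E.
Qed.

(** An additive map that commutes with q commutes with its inverse, hence with all
    Laurent polynomials. *)
Lemma additive_q_linear (U V : lmodType laurent) (f : {additive U -> V}) :
  (forall u, f (q *: u) = q *: f u) -> linear f.
Proof.
move=> fq; have fqn k u : f (q ^+ k *: u) = q ^+ k *: f u.
  by elim: k u => [|k IHk] u; rewrite ?expr0 ?scale1r // !exprS -!scalerA fq IHk.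
have fp i u : f (qpow i *: u) = qpow i *: f u.
  case: i => r; rewrite /qpow; first exact: fqn.
  have qr : qV ^+ r.+1 * q ^+ r.+1 = 1 by rewrite -exprMn mulrC q_qV expr1n.
  rewrite -[LHS]scale1r -qr -scalerA -fqn scalerA [q ^+ _ * _]mulrC qr scale1r.
  by [].
move=> c u v; rewrite raddfD; congr (_ + _).
have cE := qpolyE (lnumP c); rewrite cE !scaler_suml raddf_sum.
by apply: eq_bigr => k _; rewrite -!scalerMzl raddfMz fp.
Qed.

End Laurent.
(** * The Grothendieck group *)

Section MkAdditive.
Variables (U V : zmodType) (f : U -> V).
Hypothesis add : zmod_morphism f.
Definition mkadd : {additive U -> V} := HB.pack f (GRing.isZmodMorphism.Build U V f add).
End MkAdditive.

Section LaurentModule.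
Variable B : finType.
Local Notation type := (B * int)%type.

(** The model of the Grothendieck group: the free module on [B], with the symbol
    of P_a{i} at q^i times the basis vector a. *)
Definition KB := {ffun B -> laurent^o}.
HB.instance Definition _ := GRing.Lmodule.on KB.

Definition delta (a : B) (x : laurent) : KB := [ffun b => if b == a then x else 0].
Definition sym (t : type) : KB := delta t.1 (qpow t.2).

Lemma delta_zmod a : zmod_morphism (delta a).
Proof. by move=> x y; apply/ffunP => b; rewrite !ffunE; case: ifP; rewrite ?subr0. Qed.

Lemma KB_sum (c : KB) : c = \sum_a delta a (c a).
Proof.
apply/ffunP => b; rewrite sum_ffunE (bigD1 b) //= ffunE eqxx big1 ?addr0 //.
by move=> a ab; rewrite ffunE eq_sym (negPf ab).
Qed.

Lemma KB_additive_eq (G : zmodType) (f g : {additive KB -> G}) :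
  (forall t, f (sym t) = g (sym t)) -> f =1 g.
Proof.
move=> E c; rewrite [c]KB_sum !raddf_sum; apply: eq_bigr => a _.
have add (h : {additive KB -> G}) : zmod_morphism (fun x => h (delta a x)).
  by move=> x y; rewrite delta_zmod raddfB.
exact: (laurent_additive_eq (f := mkadd (add f)) (g := mkadd (add g)) (fun i => E (a, i))).
Qed.

Lemma scale_sym t : q *: sym t = sym (t.1, t.2 + 1).
Proof.
apply/ffunP => b; rewrite !ffunE qpowS /=.
by case: ifP => _; [ | exact: mulr0].
Qed.

(** As an abelian group [KB] is free on the symbols [sym t]; this is the
    extension of a family indexed by them. *)
Definition KBext (G : zmodType) (gam : type -> G) (c : KB) : G :=
  \sum_a lext (fun i => gam (a, i)) (c a).

Lemma KBext_zmod (G : zmodType) (gam : type -> G) : zmod_morphism (KBext gam).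
Proof.
move=> c d; rewrite /KBext -sumrB; apply: eq_bigr => a _.
by rewrite !ffunE raddfB.
Qed.

Lemma KBext_sym (G : zmodType) (gam : type -> G) t : KBext gam (sym t) = gam t.
Proof.
rewrite /KBext (bigD1 t.1) //= ffunE eqxx lext_qpow big1 ?addr0 => [|a at1].
  by case: t.
by rewrite ffunE (negPf at1) raddf0.
Qed.

End LaurentModule.

Section Grothendieck.
Variables (A : gring) (B : finType) (e : B -> A).
Hypothesis bas : basic_gring e.
Local Notation type := (B * int)%type.
Implicit Types P Q R : gmod A.

(** The sum of the symbols of the summands P_a{i}; it does not depend on the
    decomposition by [basis_perm]. *)
Definition std_class P : KB B :=
  if pselect (exists s : seq type, has_basis e P (item (s := s))) is left E
  then \sum_(t <- projT1 (cid E)) sym t else 0.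

Lemma std_classE P (s : seq type) : has_basis e P (item (s := s)) ->
  std_class P = \sum_(t <- s) sym t.
Proof.
move=> bP; rewrite /std_class; case: pselect => [E|[]]; last by exists s.
by case: cid => s' /= bP'; apply/perm_big/(basis_perm bas bP' bP).
Qed.

Lemma std_class_std t : std_class (std bas t) = sym t.
Proof.
rewrite (@std_classE _ [:: t]) ?big_seq1 //.
have bs := has_basis_reindex (h := fun j : idx [:: t] => tt) _ (basis_std bas t).
apply: has_basis_ext (bs _) => [[[]|[]]//|].
by exists (fun _ => inl tt) => [[[]|[]]|[]].
Qed.

(** An additive invariant is determined by its values on the P_a{i}. *)
Lemma additive_class (G : zmodType) (f : gmod A -> G) (s : seq type) P :
  additive_on_fgproj f -> has_basis e P (item (s := s)) ->
  f P = \sum_(t <- s) f (std bas t).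
Proof.
move=> fadd; elim: s P => [|t s IHs] P bP.
  rewrite big_nil; have fgP := basis_fgproj bas bP.
  (* A module without basis vectors is its own double, so its invariant is 0. *)
  have h : giso P (gdsum P P).
    apply: (basis_giso bP).
    have bb := has_basis_reindex (h := fun j : void => match j return void + void with end) _
       (basis_gdsum bP bP).
    apply: has_basis_ext (bb _) => [[]|].
    by exists (fun j : void + void => match j with inl v => v | inr v => v end) => [[]|[[]|[]]].
  by have /eqP := fadd P P P fgP fgP fgP h; rewrite -[X in X == _]addr0 (inj_eq (addrI _)) eq_sym => /eqP.
have bs := basis_std bas t; have bF := basis_Fmod bas id s.
rewrite big_cons -(IHs (Fmod bas id s)) //; apply: fadd.
- exact: basis_fgproj bP.
- exact: basis_fgproj bs.
- exact: basis_fgproj bF.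
apply: basis_giso bP _; apply: has_basis_ext (basis_gdsum bs bF); by case.
Qed.

Lemma std_class_gshift P (s : seq type) i : has_basis e P (item (s := s)) ->
  std_class (gshift P i) = \sum_(t <- s) sym (t.1, t.2 + i).
Proof.
move=> /(basis_gshift i) bP; have [s' bs'] := fgproj_basis bas (basis_fgproj bas bP).
have ps : perm_eq s' [seq (t.1, t.2 + i) | t <- s].
  apply/allP => t _ /=; apply/eqP; rewrite -count_item (basis_count bas t bs' bP).
  rewrite -sum1_card -sum1_count; apply/eqP.
  rewrite -eqz_nat !(big_morph Posz PoszD (erefl _)) big_map.
  rewrite big_mkcond [X in _ == X]big_mkcond /=; apply/eqP.
  exact: (big_idx s (fun u => if (u.1, u.2 + i) == t then 1%:Z else 0)).
by rewrite (std_classE bs') (perm_big _ ps) big_map.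
Qed.

Lemma std_class_additive : additive_on_fgproj std_class.
Proof.
move=> P1 P2 P3 f1 f2 f3 iso.
have [s1 b1] := fgproj_basis bas f1; have [s2 b2] := fgproj_basis bas f2.
have [s3 b3] := fgproj_basis bas f3.
rewrite !(std_classE b1, std_classE b2, std_classE b3) -big_cat.
exact/perm_big/(basis_gdsum_perm bas iso b1 b2 b3).
Qed.

(** The universal property holds because projectives decompose and [KB] is free on
    the classes of the P_a{i}. *)
Lemma std_class_Kp : is_Kp std_class.
Proof.
split; first exact: std_class_additive.
  move=> G f fadd; pose gam t := f (std bas t).
  have hE P : fgproj P -> KBext gam (std_class P) = f P.
    move=> /(fgproj_basis bas)[s bP].
    rewrite (std_classE bP) (additive_class fadd bP).
    apply: etrans (raddf_sum (mkadd (KBext_zmod gam)) _ _ _) _.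
    by apply: eq_bigr => t _; exact: KBext_sym.
  exists (mkadd (KBext_zmod gam)); split=> // h' h'E.
  apply: KB_additive_eq => t; rewrite -std_class_std.
  have fs := basis_fgproj bas (basis_std bas t).
  by rewrite h'E // -hE.
move=> P /(fgproj_basis bas)[s bP].
rewrite (std_class_gshift 1 bP) (std_classE bP) scaler_sumr.
by apply: eq_bigr => t _; rewrite scale_sym.
Qed.

Lemma gshift_fgproj P i : fgproj P -> fgproj (gshift P i).
Proof.
move=> /(fgproj_basis bas)[s bP]; exact: (basis_fgproj bas (basis_gshift i bP)).
Qed.

Lemma gshift_giso P Q i : giso P Q -> giso (gshift P i) (gshift Q i).
Proof. by move=> [f [fb fd]]; exists f; split=> // d x; exact: fd. Qed.

(** Two solutions of the universal property are isomorphic as groups.  The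
    isomorphism commutes with q because P |-> [P{1}] is itself an additive
    invariant, which factors uniquely. *)
Lemma Kp_iso (K : lmodType laurent) (cls : gmod A -> K) : is_Kp cls ->
  exists2 h : {linear K -> KB B}, bijective h &
    forall P, fgproj P -> h (cls P) = std_class P.
Proof.
move=> [cadd cuni cq]; have [sadd suni sq] := std_class_Kp.
have [h [hE huni]] := cuni (KB B) std_class sadd.
have [g [gE guni]] := suni K cls cadd.
have hq u : h (q *: u) = q *: h u.
  have addq : additive_on_fgproj (fun P => std_class (gshift P 1)).
    move=> P1 P2 P3 f1 f2 f3 iso; apply: sadd; try exact: gshift_fgproj.
    exact: (gshift_giso 1 iso).
  have [k [kE kuni]] := cuni (KB B) _ addq.
  have a1 : zmod_morphism (fun u => h (q *: u)) by move=> x y; rewrite scalerBr raddfB.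
  have a2 : zmod_morphism (fun u => q *: h u) by move=> x y; rewrite raddfB scalerBr.
  have E1 := kuni (mkadd a1) _; have E2 := kuni (mkadd a2) _.
  transitivity (k u).
    by apply: E1 => P fP; rewrite -[LHS]/(h (q *: cls P)) cq // hE //; exact: gshift_fgproj.
  by apply/esym/E2 => P fP; rewrite -[LHS]/(q *: h (cls P)) hE // sq.
have hg : cancel g h.
  have a1 : zmod_morphism (fun u => h (g u)) by move=> x y; rewrite !raddfB.
  have a2 : zmod_morphism (fun u : KB B => u) by [].
  have [k [kE kuni]] := suni (KB B) std_class sadd.
  move=> u; transitivity (k u).
    by apply: (kuni (mkadd a1)) => P fP; rewrite -[LHS]/(h (g (std_class P))) gE // hE.
  by apply/esym/(kuni (mkadd a2)) => P fP.
have gh : cancel h g.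
  have a1 : zmod_morphism (fun u => g (h u)) by move=> x y; rewrite !raddfB.
  have a2 : zmod_morphism (fun u : K => u) by [].
  have [k [kE kuni]] := cuni K cls cadd.
  move=> u; transitivity (k u).
    by apply: (kuni (mkadd a1)) => P fP; rewrite -[LHS]/(g (h (cls P))) hE // gE.
  by apply/esym/(kuni (mkadd a2)) => P fP.
by exists (mklin (additive_q_linear hq)); [exists g | exact: hE].
Qed.

Lemma std_class_ideal a : std_class (glideal (bg_deg bas a)) = delta a 1.
Proof.
rewrite (@std_classE _ [:: (a, 0)]) ?big_seq1 //.
have bs := has_basis_reindex (h := fun j : idx [:: (a, 0 : int)] => tt) _ (basis_ideal bas a).
apply: has_basis_ext (bs _) => [[[]|[]]//|].
by exists (fun _ => inl tt) => [[[]|[]]|[]].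
Qed.

Lemma KB_delta_basis (c : KB B) : c = \sum_a c a *: delta a 1.
Proof.
rewrite {1}[c]KB_sum; apply: eq_bigr => a _; apply/ffunP => b; rewrite !ffunE.
case: ifP => _; first by rewrite -[RHS]/(c a * 1) mulr1.
by rewrite -[RHS]/(c a * 0) mulr0.
Qed.

Lemma Kp_basis (K : lmodType laurent) (cls : gmod A -> K) : is_Kp cls ->
  is_basis (fun a => cls (glideal (bg_deg bas a))).
Proof.
move=> KP; have [h hb hE] := Kp_iso KP.
have fg a : fgproj (glideal (bg_deg bas a)) := basis_fgproj bas (basis_ideal bas a).
have hsum (c : {ffun B -> laurent}) :
    h (\sum_a c a *: cls (glideal (bg_deg bas a))) = (c : KB B).
  rewrite raddf_sum [RHS](KB_delta_basis (c : KB B)); apply: eq_bigr => a _.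
  by apply: etrans (linearZ_LR h _ _) _; rewrite hE // std_class_ideal.
move=> x; exists (h x); split; first by apply: (bij_inj hb); rewrite hsum.
by move=> c xE; rewrite xE hsum.
Qed.

Lemma Kp_to_lattice (K : lmodType laurent) (cls : gmod A -> K)
    (V : lmodType laurent) (p : B -> V) : is_Kp cls -> is_basis p ->
  exists2 f : {linear K -> V}, bijective f &
    forall a, f (cls (glideal (bg_deg bas a))) = p a.
Proof.
move=> KP pb; have [h hb hE] := Kp_iso KP.
have lin : linear (fun u : K => \sum_a (h u : KB B) a *: p a).
  move=> c u v; rewrite scaler_sumr -big_split; apply: eq_bigr => a _ /=.
  by rewrite linearP !ffunE scalerDl -[_ *: (h u a)]/(c * (h u : KB B) a) scalerA.
have [g hK gK] := hb.
have [coef coefP] := choice pb.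
exists (mklin lin).
  exists (fun x => g (coef x)) => [u|x].
    have [_ /(_ (h u) erefl)] := coefP (mklin lin u).
    by move=> E; rewrite -[RHS]hK -E.
  have [E _] := coefP x.
  by rewrite mklinE gK -E.
move=> a; rewrite mklinE hE ?std_class_ideal; last exact: basis_fgproj (basis_ideal bas a).
rewrite (bigD1 a) //= ffunE eqxx scale1r big1 ?addr0 // => b ba.
by rewrite ffunE (negPf ba) scale0r.
Qed.

Lemma indecomposable_projectives P :
  (finitely_generated P /\ gprojective P /\ gindecomposable P) <->
  exists a i, giso P (gshift (glideal (bg_deg bas a)) i).
Proof.
split=> [[fg [pr ind]]|[a [i iso]]].
  have [s bP] := fgproj_basis bas (conj fg pr).
  have := (indecomposable_basis bas bP).1 ind; case: s bP => [|t [|]] // bP _.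
  exists t.1, t.2; apply/(giso_std_basis bas P t).
  have bs := has_basis_reindex (h := fun j : unit => inl tt : idx [:: t]) _ bP.
  by apply: bs; exists (fun _ => tt) => [[]|[[]|[]]].
have bP := (giso_std_basis bas P (a, i)).1 iso.
have [fg pr] := basis_fgproj bas bP; split=> //; split=> //.
have bs := has_basis_reindex (h := fun j : idx [:: (a, i)] => tt) _ bP.
apply: (indecomposable_basis bas (s := [:: (a, i)]) _).2 => //.
apply: has_basis_ext (bs _) => [[[]|[]]//|].
by exists (fun _ => inl tt) => [[[]|[]]|[]].
Qed.

End Grothendieck.
(** * The theorem *)

Section ArcBasic.
Variables (n : nat) (A : arc_quotient n).
Implicit Types (a b : pmatching n).

Lemma arc_neg (j : int) (y : A) : j < 0 -> rdeg j y -> y = 0.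
Proof.
move=> j0 /aq_deg[x [xj <-]].
suff -> : x = 0 by rewrite raddf0.
apply/ffunP => t; rewrite ffunE; apply/eqP/negPn/negP => /xj tj.
by have := tdeg_ge0 t; rewrite tj leNgt j0.
Qed.

Lemma Atilde_idem_mul a b :
  Atilde_mul (Atilde_idem a) (Atilde_idem b) = if a == b then Atilde_idem a else 0.
Proof.
apply/ffunP => t; rewrite Atilde_mulE (bigD1 (idem_tensor a)) //=.
rewrite [X in _ + X]big1 ?addr0 => [|u /negPf ua]; last first.
  by apply: big1 => v _; rewrite [X in X * _ * _]ffunE ua !mul0r.
rewrite (bigD1 (idem_tensor b)) //= big1 ?addr0 => [|v /negPf vb]; last first.
  by rewrite [X in _ * X * _]ffunE vb mulr0 mul0r.
have I (c : pmatching n) : Atilde_idem c (idem_tensor c) = 1 by rewrite ffunE eqxx.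
apply: (etrans (congr2 *%R (congr2 *%R (I a) (I b)) (tmul1l _ _ _))).
rewrite !mul1r.
case: (eqVneq (idem_tensor b) t) => [<-|bt]; last first.
  rewrite andbF; case: eqP => [ab|_]; last by rewrite ffunE.
  by rewrite ffunE ab eq_sym (negPf bt).
rewrite andbT -[tsrc _]/b; case: eqP => [->|_]; last by rewrite ffunE.
by rewrite ffunE eqxx.
Qed.

Lemma arc_idem_mul a b :
  aq_idem A a * aq_idem A b = if a == b then aq_idem A a else 0.
Proof.
rewrite /aq_idem -aq_mul Atilde_idem_mul.
by case: ifP; rewrite ?raddf0.
Qed.

Lemma arc_idem_sum : \sum_a aq_idem A a = 1.
Proof. by rewrite -(aq_one A) /Atilde_one raddf_sum. Qed.

Lemma arc_degree0 (y : A) : rdeg 0 y ->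
  exists c : pmatching n -> int, y = \sum_a aq_idem A a *~ c a.
Proof.
move=> /aq_deg[x [x0 <-]]; exists (fun a => x (idem_tensor a)).
rewrite /aq_idem; under eq_bigr => a _ do rewrite -raddfMz.
rewrite -raddf_sum; congr (aq_proj A _); apply/ffunP => t.
rewrite sum_ffunE.
have E a : (Atilde_idem a *~ x (idem_tensor a)) t = (t == idem_tensor a)%:R * x t.
  have -> : (Atilde_idem a *~ x (idem_tensor a)) t =
            Atilde_idem a t *~ x (idem_tensor a).
    have add : zmod_morphism (fun f : Atilde n => f t) by move=> f g; rewrite !ffunE.
    exact: (raddfMz (mkadd add)).
  rewrite ffunE; case: eqP => [<-|_]; first by rewrite mul1r intz.
  by rewrite mul0rz mul0r.
under eq_bigr => a _ do rewrite E.
rewrite -mulr_suml; have [->|xt] := eqVneq (x t) 0; first by rewrite mulr0.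
have tE := tdeg_eq0 (x0 t xt).
rewrite (bigD1 (tsrc t)) //= -tE eqxx big1 ?addr0 ?mul1r // => a aN.
by case: eqP => // ta; case/eqP: aN; rewrite ta.
Qed.

Lemma arc_idem_free a c : aq_idem A a *~ c = 0 -> c = 0.
Proof.
rewrite /aq_idem -raddfMz => /aq_ker Ia.
apply/eqP/negPn/negP => c0; have := idem_not_ideal a; rewrite Ia //.
have add : zmod_morphism (fun f : Atilde n => f (idem_tensor a)).
  by move=> f g; rewrite !ffunE.
by rewrite -[X in X != 0]/(mkadd add _) raddfMz /= ffunE eqxx intz.
Qed.

(** Non-negativity and the description of the part of degree 0 hold for the tensors
    by [tdeg_ge0] and [tdeg_eq0]; the idempotents stay independent in the quotient
    by [idem_not_ideal]. *)
Definition arc_basic : basic_gring (aq_idem A) :=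
  BasicGring arc_neg (aq_idem_deg A) arc_idem_mul arc_idem_sum arc_degree0 arc_idem_free.

End ArcBasic.

Theorem mainTheorem3 (n : nat) :
  inhabited (arc_quotient n) /\
  forall A : arc_quotient n,
    (forall M : gmod A,
       (finitely_generated M /\ gprojective M /\ gindecomposable M) <->
       exists (a : pmatching n) (i : int), giso M (gshift (proj_module A a) i))
    /\ is_basis (@p_vec n)
    /\ (exists (K : lmodType laurent) (cls : gmod A -> K), is_Kp cls)
    /\ (forall (K : lmodType laurent) (cls : gmod A -> K), is_Kp cls ->
          is_basis (fun a : pmatching n => cls (proj_module A a))
          /\ #|{: pmatching n}| = (2 ^ n)%N
          /\ exists f : {linear K -> Vlattice n},
               bijective f /\
               forall a : pmatching n, f (cls (proj_module A a)) = p_vec a).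
Proof.
split; first by constructor; exact: arc_quotient_model.
move=> A; split; first by move=> M; exact: (indecomposable_projectives (arc_basic A)).
split; first exact: p_vec_basis.
split; first by exists (KB (pmatching n)), (std_class (aq_idem A)); exact: (std_class_Kp (arc_basic A)).
move=> K cls KP; split; first exact: (Kp_basis (arc_basic A) KP).
split; first exact: card_pmatching.
have [f fb fE] := Kp_to_lattice (arc_basic A) KP (@p_vec_basis n).
by exists f.
Qed.
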